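(* Let $n>1$, let $K$ be a closed subgroup of $O(n)$ acting transitively on the spheres about $0$ in $\mathbb{R}^n$, and let $G=K\rtimes\mathbb{R}^n$. Let $\lambda\in\mathbb{C}$. Then the natural action of $G$ on the eigenspace $$\mathcal{E}_\lambda(\mathbb{R}^n)=\{f\in\mathcal{E}(\mathbb{R}^n)\mid Lf=-\lambda^2 f\}$$ is irreducible if and only if $\lambda\neq 0$.
   Context: $\mathcal{E}(\mathbb{R}^n)=C^\infty(\mathbb{R}^n)$ is the space of complex-valued smooth functions with its usual Fréchet topology (uniform convergence of all derivatives on compact sets), $L=\sum_i\partial^2/\partial x_i^2$ is the usual Laplacian, and $\mathcal{E}_\lambda(\mathbb{R}^n)$ carries the topology induced from $\mathcal{E}(\mathbb{R}^n)$. $G$ acts on $\mathbb{R}^n$ by rigid motions $x\mapsto kx+v$ ($k\in K$, $v\in\mathbb{R}^n$), and its natural action on functions is $(g\cdot f)(x)=f(g^{-1}\cdot x)$. Irreducible means that the only closed $G$-invariant subspaces are $\{0\}$ and the whole space. *)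

(* Defs.v *)
From HB Require Import structures.
From mathcomp Require Import all_boot all_order all_algebra.
From mathcomp Require Import complex.
From mathcomp Require Import all_classical all_reals all_analysis.

Set Implicit Arguments.
Unset Strict Implicit.
Unset Printing Implicit Defensive.

Import Order.TTheory GRing.Theory Num.Theory.
Import numFieldNormedType.Exports.

Local Open Scope classical_set_scope.
Local Open Scope complex_scope.
Local Open Scope ring_scope.

(* [R[i]] is a numFieldType; this gives it the topology of its modulus and
   makes it a module over itself. *)
HB.instance Definition _ (R : rcfType) := NormedModule.copy R[i] (R[i])^o.

Lemma initial_cvgP (S : choiceType) (T : topologicalType) (u : S -> T)
    (F : set_system S) (x : S) :
  Filter F ->
  (F --> (x : initial_topology u)) <-> (u @ F --> u x).
Proof.
move=> FF; split=> [Fx|uFx].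
  exact: (cvg_comp _ _ Fx (@initial_continuous _ _ u x)).
move=> A; rewrite nbhsE => -[B [[C oC <-] Cux] BA].
by apply: filterS BA _; apply: uFx; exact: open_nbhs_nbhs.
Qed.

Section SmoothFunctions.
Variables (R : realType) (n : nat).
Implicit Types (f : 'cV[R]_n -> R[i]) (s : seq 'I_n).

(* [derivable] and ['D_v] need domain and codomain normed over the same field,
   so derivatives in the real directions are taken on real and imaginary
   parts. *)
Definition pderivable (i : 'I_n) f (x : 'cV[R]_n) : Prop :=
  derivable (fun y => complex.Re (f y)) x (delta_mx i 0) /\
  derivable (fun y => complex.Im (f y)) x (delta_mx i 0).

Definition pderiv (i : 'I_n) f : 'cV[R]_n -> R[i] := fun x =>
  ('D_(delta_mx i 0) (fun y => complex.Re (f y)) x)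
  +i* ('D_(delta_mx i 0) (fun y => complex.Im (f y)) x).

Definition pderivs s f : 'cV[R]_n -> R[i] := foldr pderiv f s.

Definition smooth f : Prop :=
  forall s, continuous (pderivs s f) /\
            forall i x, pderivable i (pderivs s f) x.

Definition laplacian f : 'cV[R]_n -> R[i] :=
  fun x => \sum_(i < n) pderiv i (pderiv i f) x.

Definition all_derivatives (f : [set f | smooth f]) :
    prod_topology (fun _ : seq 'I_n => {family compact, 'cV[R]_n -> R[i]}) :=
  fun s => pderivs s (set_val f).

(* C^oo(R^n) with the initial topology making every
   [pderivs s : C^oo(R^n) -> {family compact, R^n -> C}] continuous. *)
Definition smooth_space : Type := initial_topology all_derivatives.

HB.instance Definition _ := Topological.on smooth_space.

(* As a type, [laplace_eigenspace lambda] carries the induced topology. *)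
Definition laplace_eigenspace (lambda : R[i]) : set smooth_space :=
  [set f | forall x, laplacian (set_val f) x = - lambda ^+ 2 * set_val f x].

Definition eigenfun lambda (f : laplace_eigenspace lambda) : 'cV[R]_n -> R[i] :=
  set_val (set_val f).

Lemma smooth_space_cvgP (F : set_system smooth_space) (f : smooth_space) :
  Filter F ->
  F --> f <->
  forall s (A : set 'cV[R]_n), compact A ->
    {uniform A, (fun g : smooth_space => pderivs s (set_val g)) @ F -->
                pderivs s (set_val f)}.
Proof.
move=> FF; apply: (iff_trans (@initial_cvgP _ _ all_derivatives F f FF)).
split=> [cvF s A cA|cvF].
  have /fam_cvgP : {family compact,
      (fun g : smooth_space => pderivs s (set_val g)) @ F -->
      pderivs s (set_val f)}.
    exact: (cvg_comp _ _ cvF (@proj_continuous _ _ s (all_derivatives f))).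
  exact.
apply/cvg_sup => s.
apply/(@initial_cvgP _ _ (fun h : forall s : seq 'I_n, _ => h s)).
by apply/fam_cvgP => A cA; exact: cvF.
Qed.

End SmoothFunctions.

Section RigidMotions.
Variables (R : realType) (n : nat).
Implicit Types (K : set 'M[R]_n) (g h : 'M[R]_n * 'cV[R]_n).

Definition orthogonal_group : set 'M[R]_n := [set k | k *m k^T = 1%:M].

Definition closed_subgroup_of_On K : Prop :=
  [/\ K `<=` orthogonal_group,
      closed (K : set (subspace orthogonal_group)),
      K 1%:M,
      forall k l, K k -> K l -> K (k *m l) &
      forall k, K k -> K (invmx k)].

Definition euclidean_norm (x : 'cV[R]_n) : R :=
  Num.sqrt (\sum_(i < n) x i 0 ^+ 2).

Definition sphere (r : R) : set 'cV[R]_n := [set x | euclidean_norm x = r].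

Definition transitive_on_spheres K : Prop :=
  forall r, 0 < r -> forall x y, sphere r x -> sphere r y ->
    exists2 k, K k & k *m x = y.

(* The pair [(k, v)] stands for the rigid motion [x |-> k x + v]. *)
Definition motion g (x : 'cV[R]_n) : 'cV[R]_n := g.1 *m x + g.2.

Definition motion_mul g h := (g.1 *m h.1, g.1 *m h.2 + g.2).

Definition motion_inv g := (invmx g.1, - (invmx g.1 *m g.2)).

Definition semidirect K : set ('M[R]_n * 'cV[R]_n) := [set g | K g.1].

Definition translate g (f : 'cV[R]_n -> R[i]) : 'cV[R]_n -> R[i] :=
  fun x => f (motion (motion_inv g) x).

Lemma motionM g h x : motion (motion_mul g h) x = motion g (motion h x).
Proof. by rewrite /motion /= mulmxDr mulmxA addrA. Qed.

Lemma orthogonal_unit k : orthogonal_group k -> k \in unitmx.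
Proof. by case/mulmx1_unit. Qed.

Lemma motionK g : orthogonal_group g.1 ->
  cancel (motion g) (motion (motion_inv g)) /\
  cancel (motion (motion_inv g)) (motion g).
Proof.
move=> /orthogonal_unit gU; split=> x; rewrite /motion /=.
  by rewrite mulmxDr mulKmx // addrK.
by rewrite mulmxBr !mulKVmx // subrK.
Qed.

Lemma semidirect_group K : closed_subgroup_of_On K ->
  [/\ semidirect K (1%:M, 0),
      forall g h, semidirect K g -> semidirect K h ->
        semidirect K (motion_mul g h) &
      forall g, semidirect K g -> semidirect K (motion_inv g)].
Proof. by case=> _ _ K1 KM KV; split=> // g *; [apply: KM|apply: KV]. Qed.

End RigidMotions.

Section Irreducibility.
Variables (R : realType) (n : nat).

Definition linear_subspace (V : set ('cV[R]_n -> R[i])) : Prop :=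
  [/\ V 0,
      forall f g, V f -> V g -> V (f + g) &
      forall (c : R[i]) f, V f -> V (c *: f)].

Definition motion_invariant (K : set 'M[R]_n)
    (V : set ('cV[R]_n -> R[i])) : Prop :=
  forall g f, semidirect K g -> V f -> V (translate g f).

Definition irreducible_eigenspace (K : set 'M[R]_n) (lambda : R[i]) : Prop :=
  forall W : set (@laplace_eigenspace R n lambda),
    closed W ->
    linear_subspace (@eigenfun R n lambda @` W) ->
    motion_invariant K (@eigenfun R n lambda @` W) ->
    @eigenfun R n lambda @` W = [set 0] \/ W = setT.

End Irreducibility.

(* Main.v *)
Require Import Defs.
From HB Require Import structures.
From mathcomp Require Import all_boot all_order all_algebra.
From mathcomp Require Import complex.
From mathcomp Require Import all_classical all_reals all_analysis.
From mathcomp Require Import ring lra zify.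

(** Let [V] be the image in C^oo(R^n) of a closed [G]-invariant subspace of the
eigenspace.

If [lambda = 0], the constants form such a subspace: they are closed because
evaluation at a point is continuous, and they are neither [{0}] nor everything,
since coordinate functions are harmonic ([reducible_of_eq0]).

If [lambda <> 0] and [V <> {0}], every eigenfunction [f] lies in [V].  The
argument replaces Haar integration over [K] and harmonic analysis by Taylor
series at the origin; [P_m f] ([taylor_part]) denotes the homogeneous part of
degree [m].

- Estimates.  An eigenfunction bounded by [M] on a cube of half-side [d <= 1] has
  gradient at most [C M / d] at the centre ([eigen_gradient_bound], by the maximum
  principle).  Iterating with steps of length proportional to [1 / m] bounds the
  derivatives of order [m] by [B m! / rho^m] for every [rho]
  ([eigen_partials_factorial]).  Hence [f = sum_m P_m f] with geometric rate on
  every ball ([eigen_taylor]), uniform convergence of eigenfunctions on compact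
  sets entails that of all derivatives ([eigenspace_cvg]), and [V] is stable under
  partial derivatives ([V_partial]).

- The spherical function.  There is a radial eigenfunction [phi] with [phi(0) = 1],
  a power series in [|x|^2].  It lies in [V] ([spherical_in_V_of]): translate and
  scale some element of [V] to [w] with [w(0) = 1], and consider the convex,
  [K]-stable set of those [u] in [V] with [u(0) = 1] whose [m]-th derivatives at
  [0] have total square at most that of [w], for all [m].  By the parallelogram
  law, the jets of order [< M] of a sequence minimising the total square of the
  derivatives of order [< M] converge to a [K]-invariant limit.  As [K] is
  transitive on spheres this limit is radial, and the eigenvalue equation leaves
  no choice: it is the jet of [phi] ([radial_taylor_form]).  The Taylor tails of
  the competitors are uniformly small, so these approximate [phi].

- The ladder.  If [P_m f = 0] for [m < k], then [P_k f] is harmonic and [V] contains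
  a [g] whose Taylor parts are [P_(k+2j) g = b_(k,j) |x|^(2j) P_k f], with
  [b_(k,0) = 1], and zero otherwise ([ladder]).  For [k = 0] this is [f(0) phi]; for
  [k + 1] it is a multiple of [sum_i d_i g_i], where [g_i] belongs to [d_i f].  The
  multiple involves division by [lambda^2].

- Convergence.  Subtracting [g] from [f] removes [P_k f], so [f] can be reduced by
  elements of [V] to vanish to any order.  For [k] large the coefficients
  [b_(k,j)] are so small that [sum_m |P_m(x)|] does not increase in this process
  ([ladder_step]).  By homogeneity, a function vanishing to order [N] whose sum is
  at most [S] on a ball is at most [S / 2^N] on the ball of half the radius.  So
  [f] is a limit of elements of [V] ([eigen_in_V]), and [V] is closed. *)

Import Order.TTheory GRing.Theory Num.Theory.
Import numFieldNormedType.Exports.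

Local Open Scope classical_set_scope.
Local Open Scope complex_scope.
Local Open Scope ring_scope.

Set Implicit Arguments.
Unset Strict Implicit.
Unset Printing Implicit Defensive.

(** * Real partial derivatives *)

(** Locked, because unification would otherwise unfold nested derivatives. *)
HB.lock Definition rpderiv (R : realType) (n : nat) (i : 'I_n) (u : 'cV[R]_n -> R) :
    'cV[R]_n -> R := fun x => 'D_(delta_mx i 0) u x.
Arguments rpderiv {R n} i u x.

Section RealCalculus.
Variables (R : realType) (n : nat).
Local Notation E := 'cV[R]_n.
Local Notation ei i := (delta_mx i 0 : E).
Implicit Types (u w : E -> R) (x y v : E) (i j : 'I_n) (s : seq 'I_n).

Lemma rpderivE i u x : rpderiv i u x = 'D_(ei i) u x.
Proof. by rewrite rpderiv.unlock. Qed.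

Definition rpderivs s u := foldr rpderiv u s.

Definition rsmooth u := forall s, continuous (rpderivs s u) /\
  forall i x, derivable (rpderivs s u) x (ei i).

Lemma rsmooth_pderiv u i : rsmooth u -> rsmooth (rpderiv i u).
Proof.
move=> su s; have := su (rcons s i).
by rewrite /rpderivs foldr_rcons.
Qed.

Lemma rsmooth_continuous u : rsmooth u -> continuous u.
Proof. by move=> /(_ [::]) []. Qed.

Lemma rsmooth_derivable u : rsmooth u -> forall i x, derivable u x (ei i).
Proof. by move=> /(_ [::]) []. Qed.
Arguments rsmooth_derivable {u} su i x.

Lemma is_derive_line u x v (t : R) d :
  is_derive (x + t *: v) v u d -> is_derive t (1 : R) (fun s : R => u (x + s *: v)) d.
Proof.
move=> [du dE].
have E1 : (fun h : R => h^-1 *: (((fun s : R => u (x + s *: v)) \o shift t) (h *: (1 : R))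
      - u (x + t *: v))) =
    (fun h : R => h^-1 *: ((u \o shift (x + t *: v)) (h *: v) - u (x + t *: v))).
  apply/funext => h /=; congr (_ *: (u _ - _)).
  by rewrite [_%:A]mulr1 scalerDl addrCA.
by split; [rewrite /derivable E1|rewrite /derive E1].
Qed.

Lemma line_MVT u x v (t : R) (du : forall y, derivable u y v) :
  exists2 c : R, `|c| <= `|t| & u (x + t *: v) - u x = t * 'D_v u (x + c *: v).
Proof.
pose f (t : R) := u (x + t *: v); pose df (t : R) := 'D_v u (x + t *: v).
have fd (s : R) : is_derive s (1 : R) f (df s).
  by apply: is_derive_line; exact: derivableP.
have fc : continuous f.
  by move=> s; apply: differentiable_continuous; apply/derivable1_diffP.
have [t0|t0|->] := ltrgt0P t; last first.
- by exists 0; rewrite ?normr0// scale0r addr0 subrr mul0r.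
- have [|c] := @MVT R f df t 0 t0; [exact: continuous_subspaceT|].
  rewrite in_itv/= => /andP[tc c0]; rewrite /f scale0r addr0 => H.
  exists c; first by rewrite !ltr0_norm// ?lerN2 ltW.
  by apply: oppr_inj; rewrite opprB H /df; ring.
- have [|c] := @MVT R f df 0 t t0; [exact: continuous_subspaceT|].
  rewrite in_itv/= => /andP[c0 tc]; rewrite /f scale0r addr0 => H.
  by exists c; [rewrite !gtr0_norm// ltW|rewrite H /df; ring].
Qed.

(** The corners of the path from [0] to [v] that changes one coordinate at a time. *)
Let prefix_col (k : nat) v : E := \col_i (if (i < k)%N then v i 0 else 0).

Let prefixS (i : 'I_n) v : prefix_col i.+1 v = prefix_col i v + v i 0 *: ei i.
Proof.
apply/matrixP => j z; rewrite !mxE (ord1 z) eqxx andbT ltnS leq_eqVlt -val_eqE/=.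
by case: (ltngtP j i) => //= h; rewrite ?mulr0 ?addr0 ?mulr1 ?add0r //;
  congr (v _ _); apply: val_inj.
Qed.

Lemma cV_norm_le v (d : R) : 0 <= d -> (`|v| <= d) = [forall i, `|v i 0| <= d].
Proof.
move=> d0; apply/idP/forallP => [h i|h].
  apply: le_trans h; rewrite [leRHS]/Num.Def.normr/= mx_normrE.
  by apply: (le_trans _ (le_bigmax _ _ (i, 0))).
rewrite [leLHS]/Num.Def.normr/= mx_normrE; apply/bigmax_leP; split => //= -[i j] _ /=.
by rewrite (ord1 j).
Qed.

Lemma cV_coord_le v i : `|v i 0| <= `|v|.
Proof. by have := cV_norm_le v (normr_ge0 v); rewrite lexx => /esym/forallP. Qed.

Lemma norm_delta_le1 i : `|ei i| <= 1.
Proof.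
rewrite cV_norm_le//; apply/forallP => k; rewrite !mxE eqxx andbT.
by case: (k == i); rewrite ?normr1 ?normr0.
Qed.

Lemma sum_coord_le x (rho : R) : `|x| <= rho -> \sum_i `|x i 0| <= n%:R * rho.
Proof.
move=> xr; rewrite mulr_natl -[X in _ *+ X](card_ord n) -sumr_const.
by apply: ler_sum => i _; apply: le_trans xr; exact: cV_coord_le.
Qed.

(** Differentiability from continuous partial derivatives: the increment along [v]
    is cut into increments along the axes, and the mean value theorem applies to
    each of them. *)
Lemma is_derive_dir u x v : rsmooth u ->
  is_derive x v u (\sum_i v i 0 * rpderiv i u x).
Proof.
move=> su.
suff H : (fun h : R => h^-1 *: ((u \o shift x) (h *: v) - u x)) @ 0^' -->
    \sum_i v i 0 * rpderiv i u x.
  by split; [apply/cvg_ex; exists (\sum_i v i 0 * rpderiv i u x)|exact: cvg_lim].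
apply/cvgrPdist_le => e e0.
pose e' := e / (1 + \sum_i `|v i 0|).
have S0 : 0 <= \sum_i `|v i 0| by apply: sumr_ge0.
have e'0 : 0 < e' by rewrite divr_gt0// ltr_pwDl.
have : \forall d \near 0^'+, forall y, `|y - x| <= d -> forall i,
    `|rpderiv i u x - rpderiv i u y| <= e'.
  have : \forall y \near x, forall i, `|rpderiv i u x - rpderiv i u y| <= e'.
    apply: (@filter_forall _ _ (fun i y => `|rpderiv i u x - rpderiv i u y| <= e')
      (nbhs x) (nbhs_filter x)) => i.
    have := rsmooth_continuous (rsmooth_pderiv i su) (x := x).
    by move=> /cvgrPdist_le; exact.
  move=> /nbhs_ballP[r /= r0 H].
  near=> d => y yd; apply: H; rewrite -ball_normE/= distrC.
  apply: le_lt_trans yd _; near: d; exact: nbhs_right_lt.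
move=> [d /= d0 Hd].
pose d1 := d / 2.
have d10 : 0 < d1 by rewrite divr_gt0.
have {}Hd : forall y, `|y - x| <= d1 -> forall i,
    `|rpderiv i u x - rpderiv i u y| <= e'.
  apply: (Hd d1) => //=; rewrite sub0r normrN gtr0_norm// /d1; lra.
have e'D : \sum_i `|v i 0| * e' <= e.
  rewrite -mulr_suml /e' mulrA ler_pdivrMr ?ltr_pwDl// mulrC ler_pM2l//.
  by rewrite lerDr.
near=> h.
have hn0 : h != 0 by near: h; exact: nbhs_dnbhs_neq.
have hv : `|h *: v| <= d1.
  rewrite normrZ; have h1 : `|h| <= d1 / (1 + `|v|).
    by near: h; apply: dnbhs0_le; rewrite divr_gt0// ltr_pwDl.
  apply: le_trans (ler_wpM2r (normr_ge0 v) h1) _.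
  rewrite -mulrA ler_piMr ?(ltW d10)//.
  by rewrite mulrC ler_pdivrMr ?ltr_pwDl// mul1r lerDr.
have telescope_prefix : u (x + h *: v) - u x =
    \sum_(i < n) (u (x + prefix_col i.+1 (h *: v)) - u (x + prefix_col i (h *: v))).
  rewrite -(big_mkord xpredT (fun k : nat => u (x + prefix_col k.+1 (h *: v)) -
    u (x + prefix_col k (h *: v)))) telescope_sumr//.
  congr (u (x + _) - u _); first by apply/matrixP => i z; rewrite [RHS]mxE ltn_ord (ord1 z).
  by rewrite -[LHS]addr0; congr (_ + _); apply/matrixP => i z; rewrite mxE [RHS]mxE.
rewrite /= [h *: v + x]addrC telescope_prefix [_ *: _]mulr_sumr -sumrB.
apply: le_trans (ler_norm_sum _ _ _) _; apply: le_trans e'D; apply: ler_sum => i _.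
rewrite prefixS addrA.
have [c ci Ec] := line_MVT (x + prefix_col i (h *: v)) ((h *: v) i 0)
   (rsmooth_derivable su i).
rewrite Ec mulrA {1}[(h *: v) i 0]mxE mulKf// -mulrBr normrM ler_wpM2l//.
rewrite -rpderivE; apply: Hd; rewrite [X in `|X|]addrAC [x + _]addrC addrK.
apply: le_trans hv; rewrite cV_norm_le//; apply/forallP => j.
rewrite !mxE eqxx andbT; have [ji|ij|/val_inj ->] := ltngtP j i.
- by rewrite -val_eqE (ltn_eqF ji) mulr0 addr0; have := cV_coord_le (h *: v) j; rewrite mxE.
- by rewrite -val_eqE (gtn_eqF ij) mulr0 addr0 normr0.
- by rewrite eqxx mulr1 add0r (le_trans ci)// cV_coord_le.
Unshelve. all: by end_near. Qed.

Let eq_close (a b : R) : (forall e : R, 0 < e -> exists2 c, `|a - c| <= e & `|b - c| <= e) -> a = b.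
Proof.
move=> H; apply/eqP; rewrite -subr_eq0 -normr_le0; apply/ler_addgt0Pr => e e0.
have [|c] := H (e / 2); first lra.
by rewrite !ler_norml; lra.
Qed.

(** Schwarz: the second difference of [u] over a small square of side [h] is [h ^ 2]
    times either mixed derivative, each at some point near [x]. *)
Lemma rpderivC u i j x : rsmooth u -> rpderiv i (rpderiv j u) x = rpderiv j (rpderiv i u) x.
Proof.
move=> su; apply: eq_close => e e0.
have : \forall y \near x, `|rpderiv i (rpderiv j u) x - rpderiv i (rpderiv j u) y| <= e
   /\ `|rpderiv j (rpderiv i u) x - rpderiv j (rpderiv i u) y| <= e.
  apply: filterI.
  - have /cvgrPdist_le := rsmooth_continuous (rsmooth_pderiv i (rsmooth_pderiv j su)) (x := x).
    exact.
  - have /cvgrPdist_le := rsmooth_continuous (rsmooth_pderiv j (rsmooth_pderiv i su)) (x := x).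
    exact.
move=> /nbhs_ballP[r /= r0 H].
pose h := r / 3; have h0 : h != 0 by rewrite gt_eqF// /h; lra.
have near_x (a b : R) (k l : 'I_n) : `|a| <= `|h| -> `|b| <= `|h| ->
    ball x r (x + a *: ei k + b *: ei l).
  move=> ah bh; rewrite -ball_normE/= -addrA opprD addNKr normrN.
  apply: le_lt_trans (ler_normD _ _) _; rewrite !normrZ.
  have hr : `|h| = r / 3 by rewrite gtr0_norm// /h; lra.
  apply: (@le_lt_trans _ _ (r / 3 + r / 3)); last by lra.
  by apply: lerD; rewrite -hr (le_trans (ler_wpM2l _ (norm_delta_le1 _)))// mulr1.
have step (k l : 'I_n) : exists2 y : E, ball x r y &
   u (x + h *: ei k + h *: ei l) - u (x + h *: ei k) - (u (x + h *: ei l) - u x) =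
   h * (h * rpderiv l (rpderiv k u) y).
  pose w y := u (y + h *: ei l) - u y.
  have shiftD y q : is_derive y (ei q) (fun y => u (y + h *: ei l)) (rpderiv q u (y + h *: ei l)).
    have du : derivable u (y + h *: ei l) (ei q) by exact: rsmooth_derivable.
    have E1 : (fun t : R => t^-1 *: (((fun y => u (y + h *: ei l)) \o shift y) (t *: ei q)
        - u (y + h *: ei l))) =
      (fun t : R => t^-1 *: ((u \o shift (y + h *: ei l)) (t *: ei q) - u (y + h *: ei l))).
      by apply/funext => t /=; rewrite addrA.
    by split; [rewrite /derivable E1|rewrite rpderivE /derive E1].
  have wD y q : is_derive y (ei q) w (rpderiv q u (y + h *: ei l) - rpderiv q u y).
    have uD : is_derive y (ei q) u (rpderiv q u y).
      by rewrite rpderivE; apply/derivableP/rsmooth_derivable.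
    have sD := shiftD y q; exact: is_deriveB.
  have [c ch Ec] := @line_MVT w x (ei k) h (fun y => @ex_derive _ _ _ _ _ _ _ (wD y k)).
  have [b bh Eb] := @line_MVT (rpderiv k u) (x + c *: ei k) (ei l) h
    (rsmooth_derivable (rsmooth_pderiv k su) l).
  exists (x + c *: ei k + b *: ei l); first exact: near_x.
  rewrite -/(w (x + h *: ei k)) -/(w x) Ec; congr (h * _).
  by rewrite (@derive_val _ _ _ _ _ _ _ (wD _ k)) [in RHS]rpderivE -Eb.
have [y yr Ey] := step j i; have [z zr Ez] := step i j.
have Eyz : rpderiv i (rpderiv j u) y = rpderiv j (rpderiv i u) z.
  apply: (mulfI h0); apply: (mulfI h0); rewrite -Ey -Ez.
  rewrite [x + _ + _]addrAC; ring.
exists (rpderiv i (rpderiv j u) y); first exact: (H _ yr).1.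
exact: (eq_ind_r (fun c => `|_ - c| <= e) (H _ zr).2 Eyz).
Qed.

End RealCalculus.
Arguments rsmooth_derivable {R n u} su i x.

Section RealContinuity.
Variables (R : realType) (T : topologicalType).
Implicit Types f g : T -> R.

Lemma real_cont_cst (a : R) : continuous (fun _ : T => a).
Proof. by move=> x; exact: cvg_cst. Qed.

Lemma real_contD f g : continuous f -> continuous g -> continuous (fun x => f x + g x).
Proof. by move=> cf cg x; apply: cvgD; [exact: cf|exact: cg]. Qed.

Lemma real_contB f g : continuous f -> continuous g -> continuous (fun x => f x - g x).
Proof. by move=> cf cg x; apply: cvgB; [exact: cf|exact: cg]. Qed.

Lemma real_contM f g : continuous f -> continuous g -> continuous (fun x => f x * g x).
Proof. by move=> cf cg x; apply: cvgM; [exact: cf|exact: cg]. Qed.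

Lemma real_cont_sum (I : Type) (r : seq I) (P : pred I) (f : I -> T -> R) :
  (forall i, P i -> continuous (f i)) -> continuous (fun x => \sum_(i <- r | P i) f i x).
Proof. by move=> cf; apply: continuous_big => //; exact: add_continuous. Qed.

End RealContinuity.

Section LinearityOfPartials.
Variables (R : realType) (n : nat).
Local Notation E := 'cV[R]_n.
Local Notation ei i := (delta_mx i 0 : E).
Implicit Types (u w : E -> R).

Lemma is_derive_rpderiv u i x : rsmooth u -> is_derive x (ei i) u (rpderiv i u x).
Proof. by move=> su; rewrite rpderivE; apply/derivableP/rsmooth_derivable. Qed.

Lemma rpderivD u w i : rsmooth u -> rsmooth w ->
  rpderiv i (u + w) = rpderiv i u + rpderiv i w.
Proof.
move=> su sw; apply/funext => x.
have [_ H] := is_deriveD (is_derive_rpderiv i x su) (is_derive_rpderiv i x sw).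
by rewrite rpderivE H.
Qed.

Lemma rpderivZ u (a : R) i : rsmooth u -> rpderiv i (a \*: u) = a \*: rpderiv i u.
Proof.
move=> su; apply/funext => x.
have [_ H] := is_deriveZ a (is_derive_rpderiv i x su).
by rewrite rpderivE H.
Qed.

Lemma rsmooth_pderivs u s : rsmooth u -> rsmooth (rpderivs s u).
Proof. by move=> su; elim: s => [//|i s IH]; exact: (rsmooth_pderiv i IH). Qed.

Lemma rpderivsD u w s : rsmooth u -> rsmooth w ->
  rpderivs s (u + w) = rpderivs s u + rpderivs s w.
Proof.
move=> su sw; elim: s => [//|i s IH].
rewrite -![rpderivs (i :: s) _]/(rpderiv i (rpderivs s _)) IH.
exact: (rpderivD i (rsmooth_pderivs s su) (rsmooth_pderivs s sw)).
Qed.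

Lemma rpderivsZ u (a : R) s : rsmooth u -> rpderivs s (a \*: u) = a \*: rpderivs s u.
Proof.
move=> su; elim: s => [//|i s IH].
rewrite -![rpderivs (i :: s) _]/(rpderiv i (rpderivs s _)) IH.
exact: (rpderivZ a i (rsmooth_pderivs s su)).
Qed.

Lemma rsmoothD u w : rsmooth u -> rsmooth w -> rsmooth (u + w).
Proof.
move=> su sw s; rewrite rpderivsD//.
have [cu du] := su s; have [cw dw] := sw s; split=> [|i x]; first exact: real_contD.
by apply: derivableD; [exact: du|exact: dw].
Qed.

Lemma rsmoothZ u (a : R) : rsmooth u -> rsmooth (a \*: u).
Proof.
move=> su s; rewrite rpderivsZ//.
have [cu du] := su s; split=> [|i x].
  by apply: real_contM cu; exact: real_cont_cst.
by apply: derivableZ; exact: du.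
Qed.

End LinearityOfPartials.

(** * Interior gradient estimate by the maximum principle *)

Section GradientEstimate.
Variables (R : realType) (n : nat).
Local Notation E := 'cV[R]_n.
Local Notation ei i := (delta_mx i 0 : E).
Implicit Types (u : E -> R) (x y v : E).

(** If [h2] were positive, [h'] would be positive just to the right of its zero [0],
    and [h] would exceed [h 0] there. *)
Lemma second_derivative_at_max (h h' : R -> R) (d h2 : R) : 0 < d ->
  (forall t, `|t| < d -> is_derive t (1 : R) h (h' t)) ->
  is_derive (0 : R) (1 : R) h' h2 ->
  (forall t, `|t| < d -> h t <= h 0) -> h2 <= 0.
Proof.
move=> d0 dh dh' hmax.
have in_d t : t \in `]-d, d[%R -> `|t| < d by rewrite in_itv/= ltr_norml.
have h'0 : h' 0 = 0.
  have dh0 : is_derive (0 : R) (1 : R) h (h' 0) by apply: dh; rewrite normr0.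
  have dd : - d <= d by lra.
  have dm : is_derive (0 : R) (1 : R) h 0.
    apply: (derive1_at_max dd) => [t /in_d td||t /in_d td].
    - by have [] := dh _ td.
    - by rewrite in_itv/= oppr_lt0 d0.
    - exact: hmax.
  by have [_ <-] := dh0; have [_ ->] := dm.
rewrite leNgt; apply/negP => h20.
have [dc dv] := dh'; rewrite /derive in dv; rewrite /derivable in dc.
have : (fun t : R => t^-1 *: ((h' \o shift 0) (t *: (1 : R)) - h' 0)) @ 0^' --> h2.
  by rewrite -dv.
move=> /cvgrPdist_lt /(_ _ h20).
rewrite near_withinE => /nbhs_ballP[r /= r0 H].
pose b := Num.min r d / 2.
have m0 : 0 < Num.min r d by rewrite lt_min r0 d0.
have b0 : 0 < b by rewrite divr_gt0.
have br : b < r by rewrite (@lt_le_trans _ _ (Num.min r d)) ?ge_min ?lexx// /b; lra.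
have bd : b < d by rewrite (@lt_le_trans _ _ (Num.min r d)) ?ge_min ?lexx ?orbT// /b; lra.
have [| |c] := @MVT R h h' 0 b b0.
- move=> t; rewrite in_itv/= => /andP[t0 tb]; apply: dh.
  by rewrite gtr0_norm// (lt_trans tb).
- apply: derivable_within_continuous => t; rewrite in_itv/= => /andP[t0 tb].
  by have [] := dh t _; rewrite ?ger0_norm// (le_lt_trans tb).
rewrite in_itv/= subr0 => /andP[c0 cb] hb.
have : 0 < h' c.
  have := H c; rewrite /ball/= sub0r normrN gtr0_norm// (lt_trans cb br) => /(_ isT).
  rewrite gt_eqF// => /(_ isT); rewrite h'0 subr0 addr0 [c%:A]mulr1 => hc.
  have : 0 < c^-1 * h' c.
    by move: hc; rewrite /GRing.scale/=; move: (c^-1 * _) => q; rewrite ltr_norml; lra.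
  by rewrite pmulr_rgt0// invr_gt0.
have := hmax b; rewrite gtr0_norm// => /(_ bd).
by rewrite -subr_le0 hb leNgt => /negP hn h'c; apply: hn; rewrite mulr_gt0.
Qed.

Lemma trmx_continuous m k : continuous (@trmx R m k : 'M[R]_(m, k) -> 'M[R]_(k, m)).
Proof.
move=> A B [P /= AP PB]; exists (fun i j => P j i) => /= [i j|C CP].
  by have := AP j i; rewrite mxE.
by apply: PB => i j /=; rewrite mxE; exact: CP.
Qed.

Lemma cV_continuous (T : topologicalType) (g : T -> E) :
  (forall i, continuous (fun z => g z i 0)) -> continuous g.
Proof.
move=> cg x B [P /= BP PB].
have /(_ _ _ (fun i => [set z | P i 0 (g z i 0)]) _ (nbhs_filter x)) := @filter_forall.
move=> /(_ (fun i => cg i x _ (BP i 0))); apply: filterS => z Hz.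
by apply: PB => i j /=; rewrite (ord1 j); exact: Hz.
Qed.

Lemma box_max (lo hi : 'I_n -> R) (F : E -> R) : (forall i, lo i <= hi i) ->
  continuous F ->
  exists2 c : E, (forall i, lo i <= c i 0 <= hi i) &
    forall y : E, (forall i, lo i <= y i 0 <= hi i) -> F y <= F c.
Proof.
move=> lohi cF.
pose A := [set r : 'rV[R]_n | forall i, `[lo i, hi i]%classic (r ord0 i)].
have cA : compact A.
  by apply: (@rV_compact _ _ (fun i => `[lo i, hi i]%classic)) => i; exact: segment_compact.
have A0 : A !=set0.
  by exists (\row_i lo i) => i /=; rewrite mxE in_itv/= lexx lohi.
have cFt : continuous (F \o (@trmx R 1 n)).
  by move=> r; apply: continuous_comp; [exact: trmx_continuous|exact: cF].
have [c + cmax] := compact_EVT_max A0 cA (continuous_subspaceT cFt).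
rewrite inE => cA'; exists c^T => [i|y yb].
  by have := cA' i; rewrite /= in_itv/= mxE.
have := cmax y^T; rewrite /= trmxK; apply.
by rewrite inE => i /=; rewrite mxE in_itv/=.
Qed.

Lemma is_derive_coord_line u y i (s t : R) : rsmooth u ->
  is_derive t (1 : R) (fun t => u (y + (s * t) *: ei i))
    (s * rpderiv i u (y + (s * t) *: ei i)).
Proof.
move=> su.
have -> : (fun t => u (y + (s * t) *: ei i)) = (fun t => u (y + t *: (s *: ei i))).
  by apply/funext => t'; rewrite scalerA mulrC.
rewrite [s * t]mulrC -scalerA; apply: is_derive_line.
have := is_derive_dir (y + t *: (s *: ei i)) (s *: ei i) su.
rewrite (bigD1 i)//= big1 ?addr0 => [|k ki].
  by rewrite !mxE !eqxx mulr1.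
by rewrite !mxE (negbTE ki) mulr0 mul0r.
Qed.

Let is_derive_quadratic (A B C t : R) :
  is_derive t (1 : R) (fun t => A + B * t + C * t ^+ 2) (B + (C *+ 2) * t).
Proof.
have d2 := is_deriveX 2 (is_derive_id (t : R) 1).
apply: (is_derive_eq (is_deriveD (is_deriveD (is_derive_cst A t 1)
  (is_deriveZ B (is_derive_id t 1))) (is_deriveZ C d2))).
by rewrite /GRing.scale/=; ring.
Qed.

Let derive_le (g : R -> R) (D C d : R) : 0 < d -> is_derive (0 : R) (1 : R) g D ->
  (forall t, 0 < t -> t <= d -> g t - g 0 <= C * t) -> D <= C.
Proof.
move=> d0 [dc dv] gC; rewrite leNgt; apply/negP => CD.
rewrite /derive in dv; rewrite /derivable in dc.
have : (fun t : R => t^-1 *: ((g \o shift 0) (t *: (1 : R)) - g 0)) @ 0^' --> D.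
  by rewrite -dv.
have DC : 0 < D - C by rewrite subr_gt0.
move=> /cvgrPdist_lt /(_ _ DC); rewrite near_withinE => /nbhs_ballP[r /= r0 H].
pose b := Num.min r d / 2.
have m0 : 0 < Num.min r d by rewrite lt_min r0 d0.
have b0 : 0 < b by rewrite divr_gt0.
have br : b < r by rewrite (@lt_le_trans _ _ (Num.min r d)) ?ge_min ?lexx// /b; lra.
have bd : b < d by rewrite (@lt_le_trans _ _ (Num.min r d)) ?ge_min ?lexx ?orbT// /b; lra.
have := H b; rewrite /ball/= sub0r normrN gtr0_norm// br => /(_ isT).
rewrite gt_eqF// => /(_ isT); rewrite addr0 [b%:A]mulr1.
have : b^-1 * (g b - g 0) <= C by rewrite ler_pdivrMl// mulrC gC// ltW.
by rewrite /GRing.scale/=; move: (b^-1 * _) => q; rewrite ltr_norml; lra.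
Qed.

(** The half cube [{|y - x| <= d, y_j >= x_j}] carries the odd part
    [u y - u (mirror y)], which vanishes on the face [y_j = x_j], is at most [2 M]
    elsewhere and has Laplacian of size less than [2 G].  The barrier [psi] is at
    least as large on the whole boundary and has Laplacian [2 a n - 2 b = - 2 G].
    So the difference [F] has positive Laplacian and no positive maximum inside.
    Along the normal [psi] grows with slope [b d] at most, which bounds the normal
    derivative of [u] at [x]. *)
Section Comparison.
Variables (u : E -> R) (x : E) (j : 'I_n) (d M G : R).
Hypotheses (su : rsmooth u) (d0 : 0 < d) (M0 : 0 <= M)
  (uM : forall y, `|y - x| <= d -> `|u y| <= M)
  (uG : forall y, `|y - x| <= d -> `|\sum_i rpderiv i (rpderiv i u) y| < G).

Let mirror (y : E) : E := y - (2 * (y j 0 - x j 0)) *: ei j.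
Let a := 2 * M / d ^+ 2.
Let b := a * n%:R + G.
Let psi (y : E) := a * (\sum_i (y i 0 - x i 0) ^+ 2) +
  b * ((y j 0 - x j 0) * (d - (y j 0 - x j 0))).
Let F y := u y - u (mirror y) - psi y.
Let lo i := if i == j then x i 0 else x i 0 - d.
Let hi i := x i 0 + d.

Let mirror_coord y i : mirror y i 0 = if i == j then 2 * x j 0 - y j 0 else y i 0.
Proof.
rewrite !mxE eqxx andbT; case: eqVneq => [->|_]; first by rewrite mulr1; ring.
by rewrite mulr0 subr0.
Qed.

Let box_ball y : (forall i, lo i <= y i 0 <= hi i) -> `|y - x| <= d.
Proof.
move=> yb; rewrite cV_norm_le ?(ltW d0)//; apply/forallP => i.
have := yb i; rewrite !mxE ler_norml /lo /hi; case: eqVneq => _; move: d0; lra.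
Qed.

Let box_ball_mirror y : (forall i, lo i <= y i 0 <= hi i) -> `|mirror y - x| <= d.
Proof.
move=> yb; rewrite cV_norm_le ?(ltW d0)//; apply/forallP => i.
rewrite mxE mirror_coord !mxE; have := yb i.
rewrite ler_norml /lo /hi; case: eqVneq => [->|_]; move: d0; lra.
Qed.

Let G0 : 0 < G.
Proof. by apply: le_lt_trans (uG (y := x) _); rewrite ?subrr ?normr0// ltW. Qed.

Let a0 : 0 <= a. Proof. by rewrite divr_ge0 ?mulr_ge0 ?exprn_ge0// ltW. Qed.

Let b0 : 0 <= b. Proof. by rewrite /b addr_ge0 ?(ltW G0)// mulr_ge0. Qed.

Let sqsum_ge0 y : 0 <= \sum_i (y i 0 - x i 0 : R) ^+ 2.
Proof. by apply: sumr_ge0 => i _; exact: sqr_ge0. Qed.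

Let F_boundary y i : (forall i, lo i <= y i 0 <= hi i) ->
  (y i 0 == lo i) || (y i 0 == hi i) -> F y <= 0.
Proof.
move=> yb ybd.
have yj : 0 <= (y j 0 - x j 0) * (d - (y j 0 - x j 0)).
  by have := yb j; rewrite /lo /hi eqxx => /andP[h1 h2]; rewrite mulr_ge0//; lra.
have [ij|ij] := boolP ((i == j) && (y i 0 == lo i)).
  move/andP: ij => [/eqP ij /eqP yl].
  have -> : F y = - psi y.
    rewrite /F; have -> : mirror y = y.
      apply/matrixP => k z; rewrite (ord1 z) mirror_coord; case: eqVneq => [->|//].
      by move: yl; rewrite ij /lo eqxx => ->; ring.
    by rewrite subrr sub0r.
  by rewrite oppr_le0 addr_ge0// mulr_ge0.
have sq : (y i 0 - x i 0) ^+ 2 = d ^+ 2.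
  move: ybd ij; case/orP => /eqP ->; last by rewrite /hi => _; ring.
  by rewrite eqxx andbT /lo => /negbTE ->; ring.
have : 2 * M <= psi y.
  rewrite /psi (bigD1 i)//= sq mulrDr.
  have -> : a * d ^+ 2 = 2 * M.
    by rewrite /a divfK// expf_neq0// gt_eqF.
  rewrite -addrA lerDl addr_ge0// mulr_ge0//.
  by apply: sumr_ge0 => k _; exact: sqr_ge0.
have := uM (box_ball yb); have := uM (box_ball_mirror yb).
by rewrite /F !ler_norml; lra.
Qed.

(** [F] along a coordinate line through [c]; [s] is the sign with which the
    reflection acts on that line. *)
Let F_line (c : E) i : let dl := (i == j)%:R : R in let s := 1 - 2 * dl in
   forall t, F (c + t *: ei i) = u (c + (1 * t) *: ei i) - u (mirror c + (s * t) *: ei i) -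
    (psi c + (2 * a * (c i 0 - x i 0) + b * dl * (d - 2 * (c j 0 - x j 0))) * t +
     (a - b * dl) * t ^+ 2).
Proof.
move=> dl s t; rewrite /F mul1r; congr (_ - u _ - _).
  apply/matrixP => k z; rewrite (ord1 z) mirror_coord !mxE !eqxx !andbT /s /dl.
  by have [->|kj] := eqVneq k j; have [ij|ij] := eqVneq i j; rewrite ?ij ?eqxx ?[j == i]eq_sym
      ?(negbTE ij) ?(negbTE kj) /=; ring.
rewrite /psi.
have -> : \sum_k ((c + t *: ei i) k 0 - x k 0) ^+ 2 =
    \sum_k (c k 0 - x k 0) ^+ 2 + 2 * t * (c i 0 - x i 0) + t ^+ 2.
  rewrite (bigD1 i)//= [in RHS](bigD1 i)//= !mxE !eqxx mulr1.
  rewrite (eq_bigr (fun k => (c k 0 - x k 0) ^+ 2)) => [|k ki].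
    by ring.
  by rewrite !mxE (negbTE ki) mulr0 addr0.
rewrite !mxE eqxx andbT eq_sym -/dl.
have dl2 : dl ^+ 2 = dl by rewrite /dl; case: (i == j); rewrite ?expr1n ?expr0n.
rewrite -[in (a - b * dl)]dl2; ring.
Qed.

Let F_le0 y : (forall i, lo i <= y i 0 <= hi i) -> F y <= 0.
Proof.
have lohi i : lo i <= hi i by rewrite /lo /hi; case: eqVneq => _; move: d0; lra.
have mirror_cont : continuous mirror.
  apply: cV_continuous => i.
  have -> : (fun z => mirror z i 0) = (fun z => if i == j then 2 * x j 0 - z j 0 else z i 0).
    by apply/funext => z; rewrite mirror_coord.
  case: eqVneq => _; last exact: coord_continuous.
  apply: real_contB; [exact: real_cont_cst|exact: coord_continuous].
have F_cont : continuous F.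
  have co i : continuous (fun y : E => y i 0 - x i 0 : R).
    by apply: real_contB; [exact: coord_continuous|exact: real_cont_cst].
  have cu := rsmooth_continuous su.
  have cumirror : continuous (fun z => u (mirror z)).
    by move=> z; exact: (continuous_comp (mirror_cont z) (cu _)).
  apply: real_contB; first exact: real_contB.
  apply: real_contD; apply: real_contM; [exact: real_cont_cst| |exact: real_cont_cst|].
    by apply: real_cont_sum => i _; apply: real_contM; exact: co.
  by apply: real_contM; [exact: co|apply: real_contB; [exact: real_cont_cst|exact: co]].
have [c cb cmax] := box_max lohi F_cont.
move=> yb; apply: le_trans (cmax _ yb) _; rewrite leNgt; apply/negP => Fc.
have inside i : lo i < c i 0 < hi i.
  have /andP[h1 h2] := cb i; rewrite !lt_def h1 h2 !andbT [hi i == _]eq_sym -negb_or.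
  by apply/negP => /(F_boundary cb); rewrite leNgt Fc.
have snd_le0 i : rpderiv i (rpderiv i u) c - rpderiv i (rpderiv i u) (mirror c)
    - (a - b * (i == j)%:R) *+ 2 <= 0.
  pose dl := (i == j)%:R : R; pose s := 1 - 2 * dl.
  have s2 : s * s = 1 by rewrite /s /dl; case: (i == j) => /=; ring.
  pose B := 2 * a * (c i 0 - x i 0) + b * dl * (d - 2 * (c j 0 - x j 0)).
  pose h t := F (c + t *: ei i).
  pose h' t := 1 * rpderiv i u (c + (1 * t) *: ei i) - s * rpderiv i u (mirror c + (s * t) *: ei i)
     - (B + ((a - b * dl) *+ 2) * t).
  have dh t : is_derive t (1 : R) h (h' t).
    have -> : h = (fun t => u (c + (1 * t) *: ei i)) - (fun t => u (mirror c + (s * t) *: ei i))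
       - (fun t => psi c + B * t + (a - b * dl) * t ^+ 2).
      by apply/funext => t'; rewrite /h F_line.
    have d1 := is_derive_coord_line c i 1 t su.
    have d2 := is_derive_coord_line (mirror c) i s t su.
    have d3 := is_derive_quadratic (psi c) B (a - b * dl) t.
    exact: (is_deriveB (is_deriveB d1 d2) d3).
  have dh' : is_derive (0 : R) (1 : R) h' (rpderiv i (rpderiv i u) c -
      rpderiv i (rpderiv i u) (mirror c) - (a - b * dl) *+ 2).
    have sdu := rsmooth_pderiv i su.
    have -> : h' = (1 \*: (fun t => rpderiv i u (c + (1 * t) *: ei i))) -
       (s \*: (fun t => rpderiv i u (mirror c + (s * t) *: ei i)))
       - (fun t => B + ((a - b * dl) *+ 2) * t + 0 * t ^+ 2).
      by apply/funext => t'; rewrite /h' !fctE mul0r addr0.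
    have d1 := is_derive_coord_line c i 1 0 sdu.
    have d2 := is_derive_coord_line (mirror c) i s 0 sdu.
    have d3 := is_derive_quadratic B ((a - b * dl) *+ 2) 0 0.
    apply: (is_derive_eq (is_deriveB (is_deriveB (is_deriveZ 1 d1) (is_deriveZ s d2)) d3)).
    rewrite !mulr0 !scale0r !addr0 /GRing.scale/= !mul1r.
    by rewrite mulrA s2 mul1r.
  pose e := Num.min (c i 0 - lo i) (hi i - c i 0).
  have /andP[i1 i2] := inside i.
  have e0 : 0 < e by rewrite lt_min !subr_gt0 i1 i2.
  apply: (second_derivative_at_max e0 (fun t _ => dh t) dh') => t te.
  rewrite /h scale0r addr0; apply: cmax => k.
  rewrite !mxE eqxx andbT; have [->|_] := eqVneq k i; last by rewrite mulr0 addr0.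
  move: te; rewrite /e lt_min mulr1n mulr1 !ltr_norml.
  by move=> /andP[/andP[? ?] /andP[? ?]]; lra.
have : \sum_i (rpderiv i (rpderiv i u) c - rpderiv i (rpderiv i u) (mirror c)
    - (a - b * (i == j)%:R) *+ 2) <= 0 by apply: sumr_le0 => i _; exact: snd_le0.
have -> : \sum_i (rpderiv i (rpderiv i u) c - rpderiv i (rpderiv i u) (mirror c)
    - (a - b * (i == j)%:R) *+ 2) = \sum_i rpderiv i (rpderiv i u) c -
    \sum_i rpderiv i (rpderiv i u) (mirror c) + 2 * G.
  rewrite !sumrB; congr (_ + _); rewrite sumrMnl.
  rewrite sumrB sumr_const card_ord -mulr_sumr (bigD1 j)//= eqxx big1 => [|i /negbTE ->//].
  by rewrite mulr1n -[a *+ n]mulr_natr /b; ring.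
have := uG (box_ball cb); have := uG (box_ball_mirror cb).
by rewrite !ltr_norml; lra.
Qed.

(** Compare slopes at [t = 0] in [u (x + t e_j) - u (x - t e_j) <= psi (x + t e_j)]. *)
Lemma pderiv_le_half : rpderiv j u x *+ 2 <= (2 * M / d ^+ 2 * n%:R + G) * d.
Proof.
have n0 : (0 < n)%N by apply: leq_ltn_trans (ltn_ord j).
apply: (@derive_le (fun t => u (x + (1 * t) *: ei j) - u (x + (- 1 * t) *: ei j)) _ _ d d0).
  have d1 := is_derive_coord_line x j 1 0 su.
  have d2 := is_derive_coord_line x j (- 1) 0 su.
  apply: (is_derive_eq (is_deriveB d1 d2)); rewrite !mulr0 !scale0r !addr0; ring.
move=> t t0 td; rewrite !mulr0 !scale0r !addr0 subrr subr0 mul1r.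
have yb i : lo i <= (x + t *: ei j) i 0 <= hi i.
  rewrite !mxE eqxx andbT /lo /hi; case: eqVneq => _; rewrite ?mulr1n ?mulr0n; move: d0 t0 td; lra.
have := F_le0 yb; rewrite /F.
have -> : mirror (x + t *: ei j) = x + (-1 * t) *: ei j.
  apply/matrixP => k z; rewrite (ord1 z) mirror_coord !mxE !eqxx andbT /=.
  by case: eqVneq => [->|_]; rewrite ?mulr1n ?mulr0n; ring.
suff : psi (x + t *: ei j) <= b * d * t by rewrite /b /a; lra.
rewrite /psi (bigD1 j)//= big1 => [|i ij]; last first.
  by rewrite !mxE (negbTE ij) mulr0 addr0 subrr expr0n.
rewrite !mxE !eqxx mulr1.
have -> : x j 0 + t - x j 0 = t by ring.
have ab : a <= b.
  rewrite /b -[leLHS]addr0 lerD ?(ltW G0)// ler_peMr// ler1n//.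
have : (b - a) * t ^+ 2 >= 0 by rewrite mulr_ge0 ?subr_ge0// sqr_ge0.
by lra.
Qed.

End Comparison.

Lemma pderiv_bound u x j (d M G : R) : rsmooth u -> 0 < d -> 0 <= M ->
  (forall y, `|y - x| <= d -> `|u y| <= M) ->
  (forall y, `|y - x| <= d -> `|\sum_i rpderiv i (rpderiv i u) y| < G) ->
  `|rpderiv j u x| *+ 2 <= (2 * M / d ^+ 2 * n%:R + G) * d.
Proof.
move=> su d0 M0 uM uG.
have h1 := pderiv_le_half j su d0 M0 uM uG.
have pN (w : E -> R) i : rsmooth w -> rpderiv i (- 1 \*: w) = - 1 \*: rpderiv i w.
  by move=> sw; exact: rpderivZ.
have sN (w : E -> R) y : (- 1 \*: w) y = - w y by exact: (mulN1r (w y)).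
have h2 := @pderiv_le_half (- 1 \*: u) x j d M G (rsmoothZ _ su) d0 M0.
have h3 : - rpderiv j u x *+ 2 <= (2 * M / d ^+ 2 * n%:R + G) * d.
  have -> : - rpderiv j u x = rpderiv j (- 1 \*: u) x.
    by rewrite pN// sN.
  apply: h2 => y yd; first by rewrite sN normrN uM.
  have -> : \sum_i rpderiv i (rpderiv i (-1 \*: u)) y = - \sum_i rpderiv i (rpderiv i u) y.
    rewrite -sumrN; apply: eq_bigr => i _.
    by rewrite pN// pN ?sN//; exact: rsmooth_pderiv.
  by rewrite normrN uG.
have : `|rpderiv j u x *+ 2| <= (2 * M / d ^+ 2 * n%:R + G) * d.
  by move: h1 h3; rewrite mulNrn ler_norml; lra.
by rewrite normrMn.
Qed.

End GradientEstimate.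

Import ComplexField.Normc.

(** * Complex-valued smooth functions *)

Section ComplexNorm.
Variable R : realType.
Implicit Types z w : R[i].

Lemma Re_continuous : continuous (@complex.Re R).
Proof.
move=> z; apply/(@cvgrPdist_lt _ _ _ _ (nbhs_filter z)) => e e0.
apply/nbhs_ballP; exists e%:C; first by rewrite /= ltcR.
move=> w; rewrite -ball_normE/= normc_def ltcR; apply: le_lt_trans.
rewrite -sqrtr_sqr ler_sqrt ?addr_ge0 ?sqr_ge0//.
by case: z w => [a b] [c d]/=; rewrite lerDl sqr_ge0.
Qed.

Lemma Im_continuous : continuous (@complex.Im R).
Proof.
move=> z; apply/(@cvgrPdist_lt _ _ _ _ (nbhs_filter z)) => e e0.
apply/nbhs_ballP; exists e%:C; first by rewrite /= ltcR.
move=> w; rewrite -ball_normE/= normc_def ltcR; apply: le_lt_trans.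
rewrite -sqrtr_sqr ler_sqrt ?addr_ge0 ?sqr_ge0//.
by case: z w => [a b] [c d]/=; rewrite lerDr sqr_ge0.
Qed.

Lemma normc_ReIm z : normc z = Num.sqrt ((complex.Re z) ^+ 2 + (complex.Im z) ^+ 2).
Proof. by case: z. Qed.

Lemma norm_normc z : `|z| = (normc z)%:C.
Proof. by rewrite normc_def normc_ReIm. Qed.

Lemma normc_ge0 z : 0 <= normc z.
Proof. by rewrite normc_ReIm sqrtr_ge0. Qed.

Lemma Re_le_normc z : `|complex.Re z| <= normc z.
Proof. by rewrite normc_ReIm -sqrtr_sqr ler_sqrt ?addr_ge0 ?sqr_ge0// lerDl sqr_ge0. Qed.

Lemma Im_le_normc z : `|complex.Im z| <= normc z.
Proof. by rewrite normc_ReIm -sqrtr_sqr ler_sqrt ?addr_ge0 ?sqr_ge0// lerDr sqr_ge0. Qed.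

Lemma normc_le_ReIm z : normc z <= `|complex.Re z| + `|complex.Im z|.
Proof.
rewrite normc_ReIm -[leRHS]ger0_norm ?addr_ge0// -sqrtr_sqr ler_sqrt ?sqr_ge0//.
rewrite sqrrD !real_normK ?num_real// -addrA lerD2l lerDr.
by rewrite mulrn_wge0// mulr_ge0.
Qed.

Lemma cReD z w : complex.Re (z + w) = complex.Re z + complex.Re w.
Proof. by case: z w => ? ? []. Qed.

Lemma cImD z w : complex.Im (z + w) = complex.Im z + complex.Im w.
Proof. by case: z w => ? ? []. Qed.

Lemma cReN z : complex.Re (- z) = - complex.Re z.
Proof. by case: z. Qed.

Lemma cImN z : complex.Im (- z) = - complex.Im z.
Proof. by case: z. Qed.

Lemma cReM z w : complex.Re (z * w) = complex.Re z * complex.Re w - complex.Im z * complex.Im w.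
Proof. by case: z w => ? ? []. Qed.

Lemma cImM z w : complex.Im (z * w) = complex.Re z * complex.Im w + complex.Im z * complex.Re w.
Proof. by case: z w => ? ? [] ? ? /=; rewrite mulrC addrC. Qed.

Lemma complexP z w : complex.Re z = complex.Re w -> complex.Im z = complex.Im w -> z = w.
Proof. by case: z w => ? ? [] ? ? /= -> ->. Qed.

Lemma Re_sum I (r : seq I) (P : pred I) (F : I -> R[i]) :
  complex.Re (\sum_(i <- r | P i) F i) = \sum_(i <- r | P i) complex.Re (F i).
Proof. by apply: (big_morph _ cReD). Qed.

Lemma Im_sum I (r : seq I) (P : pred I) (F : I -> R[i]) :
  complex.Im (\sum_(i <- r | P i) F i) = \sum_(i <- r | P i) complex.Im (F i).
Proof. by apply: (big_morph _ cImD). Qed.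

Lemma normc_sqr z : normc z ^+ 2 = complex.Re z ^+ 2 + complex.Im z ^+ 2.
Proof. by rewrite normc_ReIm sqr_sqrtr// addr_ge0 ?sqr_ge0. Qed.

Lemma normc_sum (I : Type) (r : seq I) (P : pred I) (F : I -> R[i]) :
  normc (\sum_(i <- r | P i) F i) <= \sum_(i <- r | P i) normc (F i).
Proof.
elim/big_ind2: _ => [|a b c d ab cd|//]; first by rewrite normc0.
by apply: le_trans (le_normcD _ _) _; exact: lerD.
Qed.

Lemma normcR (a : R) : normc a%:C = `|a|.
Proof. by rewrite /= expr0n addr0 sqrtr_sqr. Qed.

Lemma normc_natr m : normc (m%:R : R[i]) = m%:R.
Proof. by rewrite normcMn normc1. Qed.

Lemma complex_cont (T : topologicalType) (f : T -> R[i]) :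
  continuous (fun x => complex.Re (f x)) -> continuous (fun x => complex.Im (f x)) ->
  continuous f.
Proof.
move=> cr ci x; apply/cvgrPdist_lt => e e0.
have [er ei] : e = (complex.Re e)%:C /\ 0 < complex.Re e.
  by move: e0; case: (e) => a b; rewrite ltcE/= => /andP[/eqP -> ->].
have e2 : 0 < complex.Re e / 2 by lra.
near=> y; rewrite er norm_normc ltcR (le_lt_trans (normc_le_ReIm _))//.
rewrite cReD cReN cImD cImN [ltRHS]splitr; apply: ltrD; near: y.
- by move/cvgrPdist_lt : (cr x); exact.
- by move/cvgrPdist_lt : (ci x); exact.
Unshelve. all: by end_near. Qed.

End ComplexNorm.

(** Locked for the same reason as [rpderiv]. *)
HB.lock Definition partial (R : realType) (n : nat) (i : 'I_n) (f : 'cV[R]_n -> R[i]) :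
    'cV[R]_n -> R[i] := pderiv i f.
Arguments partial {R n} i f x.

Section ComplexPartials.
Variables (R : realType) (n : nat).
Local Notation E := 'cV[R]_n.
Local Notation ei i := (delta_mx i 0 : E).
Implicit Types (f g : E -> R[i]).

Definition reF f : E -> R := fun x => complex.Re (f x).
Definition imF f : E -> R := fun x => complex.Im (f x).

Lemma partialE i f x : partial i f x = rpderiv i (reF f) x +i* rpderiv i (imF f) x.
Proof. by rewrite partial.unlock !rpderivE. Qed.

Lemma reF_partial i f : reF (partial i f) = rpderiv i (reF f).
Proof. by apply/funext => x; rewrite /reF partialE. Qed.

Lemma imF_partial i f : imF (partial i f) = rpderiv i (imF f).
Proof. by apply/funext => x; rewrite /imF partialE. Qed.

Definition partials (s : seq 'I_n) f := foldr partial f s.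

Lemma partials_cons i s f : partials (i :: s) f = partial i (partials s f).
Proof. by []. Qed.

Lemma partialsE s f : partials s f = pderivs s f.
Proof.
by elim: s => [//|i s IH]; rewrite partials_cons IH partial.unlock.
Qed.

Lemma reF_partials s f : reF (partials s f) = rpderivs s (reF f).
Proof. by elim: s => [//|i s IH]; rewrite partials_cons reF_partial IH. Qed.

Lemma imF_partials s f : imF (partials s f) = rpderivs s (imF f).
Proof. by elim: s => [//|i s IH]; rewrite partials_cons imF_partial IH. Qed.

Lemma smoothP f : smooth f <-> rsmooth (reF f) /\ rsmooth (imF f).
Proof.
split=> [sf|[sr si] s].
  split=> s; have [cf df] := sf s; rewrite -?reF_partials -?imF_partials partialsE.
    split=> [x|i x]; last by have [] := df i x.
    exact: (continuous_comp (cf x) (@Re_continuous _ _)).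
  split=> [x|i x]; last by have [] := df i x.
  exact: (continuous_comp (cf x) (@Im_continuous _ _)).
have [cr dr] := sr s; have [ci di] := si s.
rewrite -partialsE; rewrite -reF_partials in cr dr; rewrite -imF_partials in ci di.
split=> [|i x]; first exact: complex_cont.
by split; [exact: dr|exact: di].
Qed.

Lemma eq_complex_fun f g : reF f = reF g -> imF f = imF g -> f = g.
Proof.
move=> hr hi; apply/funext => x; apply: complexP.
  by have := congr1 (fun u => u x) hr.
by have := congr1 (fun u => u x) hi.
Qed.

Lemma smooth_partial i f : smooth f -> smooth (partial i f).
Proof.
move=> /smoothP[sr si]; apply/smoothP.
rewrite reF_partial imF_partial; split; exact: rsmooth_pderiv.
Qed.

Lemma smooth_partials s f : smooth f -> smooth (partials s f).
Proof. by move=> sf; elim: s => [//|i s IH]; exact: (smooth_partial i IH). Qed.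

Lemma partialC i j f : smooth f -> partial i (partial j f) = partial j (partial i f).
Proof.
move=> /smoothP[sr si]; apply: eq_complex_fun.
  by rewrite !reF_partial; apply/funext => x; rewrite rpderivC.
by rewrite !imF_partial; apply/funext => x; rewrite rpderivC.
Qed.

Lemma smoothD f g : smooth f -> smooth g -> smooth (fun x => f x + g x).
Proof.
move=> /smoothP[fr fi] /smoothP[gr gi]; apply/smoothP.
have -> : reF (fun x => f x + g x) = reF f + reF g by apply/funext => x; rewrite /reF cReD.
have -> : imF (fun x => f x + g x) = imF f + imF g by apply/funext => x; rewrite /imF cImD.
by split; exact: rsmoothD.
Qed.

Let reFZ (c : R[i]) f : reF (fun x => c * f x) =
  complex.Re c \*: reF f + (- complex.Im c) \*: imF f.
Proof. by apply/funext => x; rewrite /reF cReM -mulNr. Qed.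

Let imFZ (c : R[i]) f : imF (fun x => c * f x) =
  complex.Re c \*: imF f + complex.Im c \*: reF f.
Proof. by apply/funext => x; rewrite /imF cImM. Qed.

Lemma smoothZ (c : R[i]) f : smooth f -> smooth (fun x => c * f x).
Proof.
move=> /smoothP[fr fi]; apply/smoothP; rewrite reFZ imFZ.
by split; apply: rsmoothD; exact: rsmoothZ.
Qed.

Lemma partialD i f g : smooth f -> smooth g ->
  partial i (fun x => f x + g x) = (fun x => partial i f x + partial i g x).
Proof.
move=> /smoothP[fr fi] /smoothP[gr gi]; apply/funext => x; rewrite !partialE.
have -> : reF (fun x => f x + g x) = reF f + reF g by apply/funext => z; rewrite /reF cReD.
have -> : imF (fun x => f x + g x) = imF f + imF g by apply/funext => z; rewrite /imF cImD.
by rewrite (rpderivD i fr gr) (rpderivD i fi gi).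
Qed.

Lemma partialZ i (c : R[i]) f : smooth f ->
  partial i (fun x => c * f x) = (fun x => c * partial i f x).
Proof.
move=> /smoothP[fr fi]; apply/funext => x; rewrite !partialE reFZ imFZ.
rewrite (rpderivD i (rsmoothZ _ fr) (rsmoothZ _ fi)).
rewrite (rpderivD i (rsmoothZ _ fi) (rsmoothZ _ fr)).
rewrite !rpderivZ//; apply: complexP; rewrite ?cReM ?cImM /=.
  by rewrite -mulNr.
by [].
Qed.

Lemma smooth_cst (c : R[i]) : smooth (fun _ : E => c) /\
   forall i, partial i (fun _ : E => c) = fun=> 0.
Proof.
have D i (a : R) : rpderiv i (fun _ : E => a) = fun=> 0.
  by apply/funext => x; rewrite rpderivE (derive_cst a).
have Ds s (a : R) : exists b, rpderivs s (fun _ : E => a) = fun=> b.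
  elim: s => [|i s [b IH]]; first by exists a.
  exists 0; by rewrite -[rpderivs (i :: s) _]/(rpderiv i (rpderivs s _)) IH D.
have S (a : R) : rsmooth (fun _ : E => a).
  move=> s; have [b ->] := Ds s a; split=> [|i x]; first exact: real_cont_cst.
  exact: derivable_cst.
split=> [|i]; first by apply/smoothP; split; exact: S.
by apply: eq_complex_fun; rewrite ?reF_partial ?imF_partial D.
Qed.

Lemma smooth_sum (I : Type) (r : seq I) (P : pred I) (F : I -> E -> R[i]) :
  (forall i, P i -> smooth (F i)) -> smooth (fun x => \sum_(i <- r | P i) F i x).
Proof.
move=> sF; elim: r => [|i r IH].
  by under eq_fun do rewrite big_nil; exact: (smooth_cst 0).1.
under eq_fun do rewrite big_cons.
case Pi: (P i) => //; exact: (smoothD (sF i Pi) IH).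
Qed.

Lemma partial_sum j (I : Type) (r : seq I) (P : pred I) (F : I -> E -> R[i]) :
  (forall i, P i -> smooth (F i)) ->
  partial j (fun x => \sum_(i <- r | P i) F i x) =
  fun x => \sum_(i <- r | P i) partial j (F i) x.
Proof.
move=> sF; elim: r => [|i r IH].
  under eq_fun do rewrite big_nil; under [RHS]eq_fun do rewrite big_nil.
  exact: (smooth_cst 0).2.
under eq_fun do rewrite big_cons; under [RHS]eq_fun do rewrite big_cons.
case Pi: (P i) => //.
by rewrite (partialD j (sF i Pi) (smooth_sum r sF)) IH.
Qed.

Lemma smooth_re_line f x v (t : R) : smooth f ->
  is_derive t (1 : R) (fun t => complex.Re (f (x + t *: v)))
    (complex.Re (\sum_i (v i 0)%:C * partial i f (x + t *: v))).
Proof.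
move=> /smoothP[sr si]; have := is_derive_line (is_derive_dir (x + t *: v) v sr).
by rewrite Re_sum; under [in X in _ -> X]eq_bigr do rewrite cReM mul0r subr0 partialE.
Qed.

Lemma smooth_im_line f x v (t : R) : smooth f ->
  is_derive t (1 : R) (fun t => complex.Im (f (x + t *: v)))
    (complex.Im (\sum_i (v i 0)%:C * partial i f (x + t *: v))).
Proof.
move=> /smoothP[sr si]; have := is_derive_line (is_derive_dir (x + t *: v) v si).
by rewrite Im_sum; under [in X in _ -> X]eq_bigr do rewrite cImM mul0r addr0 partialE.
Qed.

Let rpderiv_linear (u : E -> R) (k : 'M[R]_n) (w : E) i : rsmooth u ->
  rpderiv i (fun x => u (k *m x + w)) = fun x => \sum_j k j i * rpderiv j u (k *m x + w).
Proof.
move=> su; apply/funext => x; rewrite rpderivE.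
have [_ D] := is_derive_dir (k *m x + w) (k *m ei i) su.
transitivity ('D_(k *m ei i) u (k *m x + w)).
  have E1 : (fun h : R => h^-1 *: (((fun x0 => u (k *m x0 + w)) \o shift x) (h *: ei i)
       - u (k *m x + w))) =
     (fun h : R => h^-1 *: ((u \o shift (k *m x + w)) (h *: (k *m ei i)) - u (k *m x + w))).
    by apply/funext => h /=; rewrite mulmxDr scalemxAr addrA.
  by rewrite /derive E1.
by rewrite D; apply: eq_bigr => j _; rewrite -colE mxE.
Qed.

Lemma partial_linear f (k : 'M[R]_n) (w : E) i : smooth f ->
  partial i (fun x => f (k *m x + w)) =
  fun x => \sum_j (k j i)%:C * partial j f (k *m x + w).
Proof.
move=> /smoothP[sr si]; apply/funext => x; rewrite partialE.
rewrite (rpderiv_linear k w i sr) (rpderiv_linear k w i si).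
apply: complexP; rewrite ?Re_sum ?Im_sum /=; apply: eq_bigr => j _.
  by rewrite cReM mul0r subr0 partialE.
by rewrite cImM mul0r addr0 partialE.
Qed.

End ComplexPartials.

(** * Derivative bounds for eigenfunctions *)

(** [m ^ m <= (m + 1) (m + 2) ... (2 m) = 'C(2 m, m) * m!], and the binomial
    coefficient is at most [2 ^ (2 m)]. *)
Lemma expn_self_le_fact m : (m ^ m <= 4 ^ m * m`!)%N.
Proof.
have h : (m ^ m <= (m + m) ^_ m)%N.
  rewrite ffact_prod -[X in (_ ^ X)%N](card_ord m) -prod_nat_const.
  by apply: leq_prod => i _; have := ltn_ord i; lia.
apply: leq_trans h _; rewrite -bin_ffact leq_mul2r; apply/orP; right.
have -> : (4 ^ m = 2 ^ (m + m))%N by rewrite expnD -expnMn.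
rewrite -[2%N]/(1 + 1)%N expnDn (bigD1 (inord m))//= inordK ?ltnS ?leq_addr//.
by rewrite !exp1n !muln1 leq_addr.
Qed.

Section Eigenfunctions.
Variables (R : realType) (n : nat) (lambda : R[i]).
Local Notation E := 'cV[R]_n.
Local Notation ei i := (delta_mx i 0 : E).
Implicit Types (f g : E -> R[i]).

Definition eigenfunction f := smooth f /\
  forall x, \sum_i partial i (partial i f) x = - lambda ^+ 2 * f x.

Lemma eigen_smooth f : eigenfunction f -> smooth f.
Proof. by case. Qed.

Lemma eigen_partial i f : eigenfunction f -> eigenfunction (partial i f).
Proof.
move=> [sf Lf]; split=> [|x]; first exact: smooth_partial.
have -> : \sum_j partial j (partial j (partial i f)) x =
    partial i (fun x => \sum_j partial j (partial j f) x) x.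
  rewrite partial_sum => [|j _]; last by do 2 apply: smooth_partial.
  by apply: eq_bigr => j _; rewrite (partialC j i sf) (partialC j i (smooth_partial j sf)).
have -> : (fun x => \sum_j partial j (partial j f) x) = (fun x => - lambda ^+ 2 * f x).
  by apply/funext.
by rewrite (partialZ i _ sf).
Qed.

Lemma eigen_partials s f : eigenfunction f -> eigenfunction (partials s f).
Proof. by move=> ef; elim: s => [//|i s IH]; exact: (eigen_partial i IH). Qed.

Lemma eigenD f g : eigenfunction f -> eigenfunction g -> eigenfunction (fun x => f x + g x).
Proof.
move=> [sf Lf] [sg Lg]; split=> [|x]; first exact: smoothD.
rewrite mulrDr -Lf -Lg -big_split; apply: eq_bigr => i _.
by rewrite (partialD i sf sg) (partialD i (smooth_partial i sf) (smooth_partial i sg)).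
Qed.

Lemma eigenZ (c : R[i]) f : eigenfunction f -> eigenfunction (fun x => c * f x).
Proof.
move=> [sf Lf]; split=> [|x]; first exact: smoothZ.
rewrite mulrCA -Lf mulr_sumr; apply: eq_bigr => i _.
by rewrite (partialZ i c sf) (partialZ i c (smooth_partial i sf)).
Qed.

Let Lam : R := `|complex.Re (lambda ^+ 2)| + `|complex.Im (lambda ^+ 2)|.

(** [n] comes from the barrier, the size of [lambda ^+ 2] from the equation, and
    the [1] makes the bound on the Laplacian strict. *)
Definition grad_cst : R := n%:R + Lam + 1.

Lemma grad_cst_ge1 : 1 <= grad_cst.
Proof. by rewrite /grad_cst lerDr addr_ge0 ?addr_ge0. Qed.

(** The real estimates apply to real and imaginary parts separately. *)
Definition ReIm_le (M : R) (z : R[i]) := `|complex.Re z| <= M /\ `|complex.Im z| <= M.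

(** The equation bounds the Laplacian of [Re f] and [Im f] by the same [M], up to a
    factor. *)
Lemma eigen_gradient_bound f x j (d M : R) : eigenfunction f -> 0 < d -> d <= 1 -> 0 < M ->
  (forall y, `|y - x| <= d -> ReIm_le M (f y)) -> ReIm_le (grad_cst / d * M) (partial j f x).
Proof.
move=> [sf Lf] d0 d1 M0 fM.
have [sr si] := (smoothP f).1 sf.
pose G := (Lam + 1) * M.
have Lam0 : 0 <= Lam by rewrite addr_ge0.
have small (a b c e : R) : `|a| <= M -> `|b| <= M -> `|c| + `|e| = Lam -> `|c * a + e * b| < G.
  move=> aM bM ce; apply: (@le_lt_trans _ _ (`|c| * M + `|e| * M)).
    by apply: le_trans (ler_normD _ _) _; rewrite !normrM lerD// ler_wpM2l.
  by rewrite -mulrDl ce ltr_pM2r// ltrDl.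
have fin (a : R) : `|a| *+ 2 <= (2 * M / d ^+ 2 * n%:R + G) * d -> `|a| <= grad_cst / d * M.
  move=> h; have : (2 * M / d ^+ 2 * n%:R + G) * d <= (grad_cst / d * M) *+ 2.
    have -> : (2 * M / d ^+ 2 * n%:R + G) * d = (n%:R *+ 2 + (Lam + 1) * d ^+ 2) / d * M.
      by rewrite /G; field; rewrite gt_eqF.
    rewrite -mulrnAl ler_wpM2r ?(ltW M0)// -mulrnAl ler_wpM2r ?invr_ge0 ?(ltW d0)//.
    have : (Lam + 1) * d ^+ 2 <= Lam + 1.
      by rewrite ler_piMr ?addr_ge0// expr_le1// ltW.
    rewrite /grad_cst; lra.
  by lra.
split; rewrite partialE/=; apply: fin; apply: pderiv_bound => //; try exact: ltW.
- by move=> y yd; have [] := fM y yd.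
- move=> y yd; have := congr1 (@complex.Re R) (Lf y); rewrite Re_sum.
  under eq_bigr do rewrite !partialE /= reF_partial.
  move=> ->; rewrite mulNr cReN normrN cReM -mulNr.
  have [h1 h2] := fM y yd; apply: small => //.
  by rewrite normrN.
- by move=> y yd; have [] := fM y yd.
- move=> y yd; have := congr1 (@complex.Im R) (Lf y); rewrite Im_sum.
  under eq_bigr do rewrite !partialE /= imF_partial.
  move=> ->; rewrite mulNr cImN normrN cImM.
  have [h1 h2] := fM y yd; exact: small.
Qed.

(** One gradient estimate for each letter of [s], on cubes growing by [d] each time. *)
Lemma eigen_partials_bound f s x (d M : R) : eigenfunction f -> 0 < d -> d <= 1 -> 0 < M ->
  (forall y, `|y - x| <= (size s)%:R * d -> ReIm_le M (f y)) ->
  ReIm_le ((grad_cst / d) ^+ size s * M) (partials s f x).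
Proof.
move=> ef d0 d1 M0; elim: s x => [|i s IH] x fM.
  by rewrite expr0 mul1r; apply: fM; rewrite subrr normr0 mul0r.
have C0 : 0 < grad_cst / d by rewrite divr_gt0// (lt_le_trans _ grad_cst_ge1).
rewrite partials_cons [size _]/= exprS -mulrA; apply: eigen_gradient_bound => //.
- exact: eigen_partials.
- by rewrite mulr_gt0// exprn_gt0.
move=> y yd; apply: IH => z zy; apply: fM.
rewrite -(subrKA y) (le_trans (ler_normD _ _))// [size (_ :: _)]/= mulrSr mulrDl mul1r.
exact: lerD.
Qed.

Lemma continuous_bounded_ball f (r : R) : continuous f -> 0 <= r ->
  exists2 M : R, 0 < M & forall y, `|y| <= r -> ReIm_le M (f y).
Proof.
move=> cf r0.
have cr : continuous (fun y => complex.Re (f y) : R).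
  by move=> y; exact: (continuous_comp (cf y) (@Re_continuous _ _)).
have ci : continuous (fun y => complex.Im (f y) : R).
  by move=> y; exact: (continuous_comp (cf y) (@Im_continuous _ _)).
have c0 : continuous (fun=> 0 : R) := @real_cont_cst R E 0.
have bnd (u : E -> R) : continuous u -> exists M, forall y, `|y| <= r -> u y <= M.
  move=> cu; have rr : forall i : 'I_n, - r <= r by move=> _; lra.
  have [c _ H] := box_max rr cu; exists (u c) => y yr; apply: H => i.
  by rewrite -ler_norml (le_trans (cV_coord_le _ _)).
have [M1 h1] := bnd _ cr; have [M2 h2] := bnd _ (real_contB c0 cr).
have [M3 h3] := bnd _ ci; have [M4 h4] := bnd _ (real_contB c0 ci).
exists (1 + `|M1| + `|M2| + `|M3| + `|M4|) => [|y yr].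
  by rewrite -!addrA ltr_pwDl// !addr_ge0.
have := h1 y yr; have := h2 y yr; have := h3 y yr; have := h4 y yr.
have := ler_norm M1; have := ler_norm M2; have := ler_norm M3; have := ler_norm M4.
have := normr_ge0 M1; have := normr_ge0 M2; have := normr_ge0 M3; have := normr_ge0 M4.
by move=> *; split; rewrite ler_norml; lra.
Qed.

(** With [m] steps of length [d = r / m], [r = 4 C rho], the factor [(C / d) ^ m] of
    [eigen_partials_bound] is [m ^ m / (4 rho) ^ m <= m! / rho ^ m], and all the cubes
    stay within the fixed distance [r].  For the finitely many orders [m < N] with
    [r / m] possibly greater than [1], steps of length [1] do. *)
Lemma eigen_partials_factorial f (rho : R) : eigenfunction f -> 0 < rho ->
  exists2 B : R, 0 < B & forall s y, `|y| <= rho ->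
    ReIm_le (B * (size s)`!%:R / rho ^+ size s) (partials s f y).
Proof.
move=> ef rho0; pose C := grad_cst; pose r := 4 * C * rho.
have C1 : 1 <= C by exact: grad_cst_ge1.
have r0 : 0 < r by rewrite !mulr_gt0//; lra.
have [N Nr] : exists N : nat, r <= N%:R.
  by exists (Num.bound r); rewrite ltW// archi_boundP// ltW.
have cf : continuous f by have [sf _] := ef; have [] := sf [::].
have [|M M0 fM] := @continuous_bounded_ball f (rho + N%:R) cf.
  by rewrite addr_ge0// ltW.
exists ((1 + C * rho) ^+ N * M) => [|s y yr].
  by rewrite mulr_gt0// exprn_gt0// ltr_pwDl// mulr_ge0 ?ltW//; lra.
have near_y (z : E) : `|z - y| <= N%:R -> ReIm_le M (f z).
  move=> zy; apply: fM; rewrite -[z](subrK y) addrC (le_trans (ler_normD _ _))//.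
  exact: lerD.
have mono (a b : R) z : a <= b -> ReIm_le a z -> ReIm_le b z.
  by move=> ab [h1 h2]; split; exact: le_trans ab.
set m := size s.
have Cr1 : 1 <= 1 + C * rho by rewrite lerDl mulr_ge0 ?ltW//; lra.
have [mN|Nm] := ltnP m N.
  apply: mono (@eigen_partials_bound f s y 1 M ef _ _ M0 _) => //; last first.
    move=> z; rewrite mulr1 => zy; apply: near_y; apply: le_trans zy _.
    by rewrite ler_nat ltnW.
  rewrite divr1 -/m -/C -[_ * M * _]mulrA [M * _]mulrC mulrA [leRHS]mulrAC.
  rewrite ler_wpM2r ?(ltW M0)// ler_pdivlMr ?exprn_gt0// -exprMn.
  apply: (@le_trans _ _ ((1 + C * rho) ^+ m)).
    by rewrite lerXn2r ?nnegrE ?mulr_ge0 ?(ltW rho0) ?lerDr//; lra.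
  apply: (@le_trans _ _ ((1 + C * rho) ^+ N)).
    by rewrite ler_weXn2l// ltnW.
  by rewrite ler_peMr ?exprn_ge0 ?(le_trans ler01 Cr1)// ler1n fact_gt0.
have m0 : 0 < m%:R :> R.
  by apply: lt_le_trans r0 (le_trans Nr _); rewrite ler_nat.
apply: mono (@eigen_partials_bound f s y (r / m%:R) M ef _ _ M0 _).
- rewrite -/m -/C.
  have -> : C / (r / m%:R) = m%:R / (4 * rho).
    by rewrite /r; field; rewrite !gt_eqF//; lra.
  rewrite expr_div_n exprMn mulrAC ler_pdivrMr ?mulr_gt0 ?exprn_gt0//.
  have -> : (1 + C * rho) ^+ N * M * m`!%:R / rho ^+ m * (4 ^+ m * rho ^+ m) =
     (1 + C * rho) ^+ N * (M * (4 ^+ m * m`!%:R)).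
    by field; rewrite expf_neq0// gt_eqF.
  rewrite mulrC; apply: (@le_trans _ _ (M * (4 ^+ m * m`!%:R))).
    rewrite ler_wpM2l ?(ltW M0)// -!natrX -natrM ler_nat; exact: expn_self_le_fact.
  rewrite ler_peMl ?exprn_ege1// !mulr_ge0 ?exprn_ge0//; exact: ltW.
- by rewrite divr_gt0.
- by rewrite ler_pdivrMr// mul1r (le_trans Nr)// ler_nat.
- by move=> z; rewrite -/m mulrC divfK ?gt_eqF// => zy; apply: near_y; exact: le_trans Nr.
Qed.

End Eigenfunctions.

(** * Smoothness of products with polynomials *)

Section SmoothClasses.
Variables (R : realType) (n : nat).
Local Notation E := 'cV[R]_n.
Local Notation ei i := (delta_mx i 0 : E).

(** If the partial derivatives of the members of [B] belong to this class, then the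
    class is stable under differentiation, so its members are smooth; no Leibniz
    formula for iterated derivatives is involved. *)
Inductive coord_closure (B : (E -> R) -> Prop) : (E -> R) -> Prop :=
| CoordBase u : B u -> coord_closure B u
| CoordMul i u : coord_closure B u -> coord_closure B (fun x => x i 0 * u x)
| CoordAdd u w : coord_closure B u -> coord_closure B w ->
    coord_closure B (fun x => u x + w x)
| CoordScale a u : coord_closure B u -> coord_closure B (fun x => a * u x).

Lemma is_derive_coord x i j : is_derive x (ei j) (fun x : E => x i 0 : R) (i == j)%:R.
Proof.
have cv : (fun h : R => h^-1 *: (((fun x : E => x i 0 : R) \o shift x) (h *: ei j) - x i 0))
     @ 0^' --> ((i == j)%:R : R).
  apply: cvg_near_cst; rewrite near_withinE; near=> h => h0 /=.
  by rewrite !mxE eqxx andbT addrK /GRing.scale/= mulrA mulVf// mul1r.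
by split; [apply/cvg_ex; exists (i == j)%:R|exact: cvg_lim].
Unshelve. all: by end_near. Qed.

Lemma coord_closure_smooth (B : (E -> R) -> Prop) :
  (forall u, B u -> continuous u /\ forall i, exists2 du, coord_closure B du &
     forall x, is_derive x (ei i) u (du x)) ->
  forall u, coord_closure B u -> rsmooth u.
Proof.
move=> HB.
have ind u : coord_closure B u -> continuous u /\ forall i, exists2 du, coord_closure B du &
     forall x, is_derive x (ei i) u (du x).
  elim=> {u} [u /HB//|i u cu [uc ud]|u w cu [uc ud] cw [wc wd]|a u cu [uc ud]].
  - split=> [|j]; first by apply: real_contM => //; exact: coord_continuous.
    have [du cdu Hdu] := ud j; exists (fun x : E => x i 0 * du x + (i == j)%:R * u x).
      by apply: CoordAdd; [exact: CoordMul|exact: CoordScale].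
    move=> x; have := is_deriveM (is_derive_coord x i j) (Hdu x).
    by rewrite /GRing.scale/= [u x * _]mulrC.
  - split=> [|j]; first exact: real_contD.
    have [du cdu Hdu] := ud j; have [dw cdw Hdw] := wd j.
    exists (fun x => du x + dw x); first exact: CoordAdd.
    by move=> x; exact: (is_deriveD (Hdu x) (Hdw x)).
  - split=> [|j]; first by apply: real_contM => //; exact: real_cont_cst.
    have [du cdu Hdu] := ud j; exists (fun x => a * du x); first exact: CoordScale.
    by move=> x; exact: (is_deriveZ a (Hdu x)).
have rpd u i : coord_closure B u -> coord_closure B (rpderiv i u).
  move=> /ind [_ /(_ i) [du cdu Hdu]].
  suff -> : rpderiv i u = du by [].
  by apply/funext => x; rewrite rpderivE; have [_ ->] := Hdu x.
move=> u cu s.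
have {cu} /ind [uc ud] : coord_closure B (rpderivs s u).
  by elim: s => [//|i s IH]; exact: (rpd _ i IH).
by split=> // i x; have [du _ Hdu] := ud i; have [] := Hdu x.
Qed.

Lemma rsmooth_coordM i u : rsmooth u -> rsmooth (fun x : E => x i 0 * u x).
Proof.
move=> su; apply: (@coord_closure_smooth (@rsmooth R n)); last exact/CoordMul/CoordBase.
move=> w sw; split=> [|j]; first exact: rsmooth_continuous.
exists (rpderiv j w) => [|x]; first exact/CoordBase/rsmooth_pderiv.
exact: is_derive_rpderiv.
Qed.

Lemma rpderiv_coordM i j u : rsmooth u ->
  rpderiv j (fun x : E => x i 0 * u x) = fun x => (i == j)%:R * u x + x i 0 * rpderiv j u x.
Proof.
move=> su; apply/funext => x; rewrite rpderivE.
have [_ D] := is_deriveM (is_derive_coord x i j) (is_derive_rpderiv j x su).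
by rewrite D /GRing.scale/= addrC mulrC.
Qed.

Lemma smooth_coordM i (f : E -> R[i]) : smooth f -> smooth (fun x : E => (x i 0)%:C * f x).
Proof.
move=> /smoothP[sr si]; apply/smoothP; split.
  have -> : reF (fun x : E => (x i 0)%:C * f x) = fun x : E => x i 0 * reF f x.
    by apply/funext => x; rewrite /reF cReM mul0r subr0.
  exact: rsmooth_coordM.
have -> : imF (fun x : E => (x i 0)%:C * f x) = fun x : E => x i 0 * imF f x.
  by apply/funext => x; rewrite /imF cImM mul0r addr0.
exact: rsmooth_coordM.
Qed.

Lemma partial_coordM i j (f : E -> R[i]) : smooth f ->
  partial j (fun x : E => (x i 0)%:C * f x) =
  fun x => (i == j)%:R * f x + (x i 0)%:C * partial j f x.
Proof.
move=> /smoothP[sr si]; apply/funext => x; rewrite partialE.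
have -> : reF (fun x : E => (x i 0)%:C * f x) = fun x : E => x i 0 * reF f x.
  by apply/funext => y; rewrite /reF cReM mul0r subr0.
have -> : imF (fun x : E => (x i 0)%:C * f x) = fun x : E => x i 0 * imF f x.
  by apply/funext => y; rewrite /imF cImM mul0r addr0.
rewrite !rpderiv_coordM//; apply: complexP; rewrite ?cReD ?cImD ?cReM ?cImM partialE/=.
  by case: (i == j); rewrite /reF /= !mul0r !subr0.
by case: (i == j); rewrite /imF /= !mul0r !addr0.
Qed.

End SmoothClasses.

(** * Taylor expansion at the origin *)

Section TaylorForms.
Variables (R : realType) (n : nat).
Local Notation E := 'cV[R]_n.
Implicit Types (c : seq 'I_n -> R[i]) (x y : E) (f g : E -> R[i]).

(** The sum of [c s * x_s] over words [s] of length [m], [x_s] being the product of the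
    coordinates of [x] along [s].  For [c] the jet of [f] at [0], this is the [m]-th
    derivative of [t |-> f (t x)] at [t = 0]. *)
Fixpoint taylor_form (m : nat) c x : R[i] :=
  if m is m'.+1 then \sum_i (x i 0)%:C * taylor_form m' (fun s => c (i :: s)) x
  else c [::].
Arguments taylor_form : simpl never.

Lemma taylor_formS m c x :
  taylor_form m.+1 c x = \sum_i (x i 0)%:C * taylor_form m (fun s => c (i :: s)) x.
Proof. by []. Qed.

Lemma taylor_form_fun m c : taylor_form m.+1 c =
  fun x => \sum_i (x i 0)%:C * taylor_form m (fun s => c (i :: s)) x.
Proof. by []. Qed.

Lemma taylor_formD m c d x :
  taylor_form m (fun s => c s + d s) x = taylor_form m c x + taylor_form m d x.
Proof.
elim: m c d => [//|m IH] c d; rewrite !taylor_formS -big_split.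
by apply: eq_bigr => i _; rewrite IH mulrDr.
Qed.

Lemma taylor_formZ m (a : R[i]) c x :
  taylor_form m (fun s => a * c s) x = a * taylor_form m c x.
Proof.
elim: m c => [//|m IH] c; rewrite !taylor_formS mulr_sumr.
by apply: eq_bigr => i _; rewrite IH mulrCA.
Qed.

Lemma taylor_form_sum m (I : Type) (r : seq I) (P : pred I) (c : I -> seq 'I_n -> R[i]) x :
  taylor_form m (fun s => \sum_(i <- r | P i) c i s) x =
  \sum_(i <- r | P i) taylor_form m (c i) x.
Proof.
elim: m c => [//|m IH] c; rewrite !taylor_formS exchange_big.
by apply: eq_bigr => i _; rewrite IH mulr_sumr.
Qed.

Lemma eq_taylor_form m c d x : (forall s, size s = m -> c s = d s) ->
  taylor_form m c x = taylor_form m d x.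
Proof.
elim: m c d => [|m IH] c d cd; first exact: cd.
by apply: eq_bigr => i _; congr (_ * _); apply: IH => s sm; apply: cd; rewrite /= sm.
Qed.

Lemma taylor_form_scale m c (t : R) x :
  taylor_form m c (t *: x) = (t ^+ m)%:C * taylor_form m c x.
Proof.
elim: m c => [|m IH] c; first by rewrite expr0 mul1r.
rewrite !taylor_formS mulr_sumr; apply: eq_bigr => i _.
by rewrite IH mxE exprS !rmorphM/= mulrACA.
Qed.

Lemma taylor_form_bound m c x (K : R) : (forall s, size s = m -> normc (c s) <= K) ->
  normc (taylor_form m c x) <= (\sum_i `|x i 0|) ^+ m * K.
Proof.
elim: m c => [|m IH] c cK; first by rewrite expr0 mul1r; exact: cK.
rewrite taylor_formS exprS -mulrA mulr_suml; apply: le_trans (normc_sum _ _ _) _.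
apply: ler_sum => i _; rewrite normcM normcR.
by rewrite ler_wpM2l//; apply: IH => s sm; apply: cK; rewrite /= sm.
Qed.

Lemma smooth_taylor_form m c : smooth (taylor_form m c).
Proof.
elim: m c => [|m IH] c; first exact: (smooth_cst n (c [::])).1.
apply: smooth_sum => i _; apply: smooth_coordM; exact: IH.
Qed.

(** Invariance under adjacent transpositions, hence under all permutations of the
    word. *)
Definition symmetric_jet c := forall s i j t, c (s ++ i :: j :: t) = c (s ++ j :: i :: t).

Lemma symmetric_shift c i : symmetric_jet c -> symmetric_jet (fun s => c (i :: s)).
Proof. by move=> sc s; exact: (sc (i :: s)). Qed.

(** Each of the [m + 1] letters contributes equally, by symmetry. *)
Lemma partial_taylor_form m c j : symmetric_jet c ->
  partial j (taylor_form m.+1 c) = fun x => m.+1%:R * taylor_form m (fun s => c (j :: s)) x.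
Proof.
elim: m c => [|m IH] c sc; apply/funext => x.
all: rewrite [taylor_form _.+1 c]taylor_form_fun.
all: rewrite partial_sum => [|i _]; last exact/smooth_coordM/smooth_taylor_form.
  rewrite (bigD1 j)//= big1 => [|i /negbTE ij].
    rewrite (partial_coordM j j (smooth_cst n (c [:: j])).1) eqxx (smooth_cst n _).2.
    by rewrite mulr0 !addr0.
  by rewrite (partial_coordM i j (smooth_cst n (c [:: i])).1) ij mul0r add0r
    (smooth_cst n _).2 mulr0.
under eq_bigr => i _.
  rewrite (partial_coordM _ _ (smooth_taylor_form _ _)) (IH _ (symmetric_shift i sc)) mulrCA.
  over.
rewrite big_split/= -[X in _ + X]mulr_sumr (bigD1 j)//= eqxx mul1r big1 ?addr0; last first.
  by move=> i /negbTE ->; rewrite mul0r.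
rewrite [in RHS]mulrSr mulrDl mul1r addrC; congr (_ * _ + _).
rewrite taylor_formS; apply: eq_bigr => i _; congr (_ * _).
by apply: eq_taylor_form => s _; exact: (sc [::]).
Qed.

Lemma taylor_form_euler m c x : symmetric_jet c ->
  \sum_i (x i 0)%:C * partial i (taylor_form m.+1 c) x = m.+1%:R * taylor_form m.+1 c x.
Proof.
move=> sc; rewrite taylor_formS mulr_sumr; apply: eq_bigr => i _.
by rewrite partial_taylor_form// mulrCA.
Qed.

End TaylorForms.

Section Jets.
Variables (R : realType) (n : nat).
Local Notation E := 'cV[R]_n.
Implicit Types (x y : E) (f g : E -> R[i]).

Definition jet f y (s : seq 'I_n) := partials s f y.

(** The homogeneous component of degree [m] of the Taylor series of [f] at [0]. *)
Definition taylor_part (m : nat) f x : R[i] := taylor_form m (jet f 0) x / m`!%:R.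

Lemma partials_partial i (s : seq 'I_n) f : smooth f ->
  partials s (partial i f) = partials (i :: s) f.
Proof.
move=> sf; elim: s => [//|j s IH].
by rewrite !partials_cons IH partials_cons (partialC j i (smooth_partials s sf)).
Qed.

Lemma symmetric_jet_smooth f y : smooth f -> symmetric_jet (jet f y).
Proof.
move=> sf s i j t; rewrite /jet /partials !foldr_cat.
by rewrite -[foldr _ _ (i :: _)]/(partials [:: i, j & t] f) !partials_cons
  (partialC i j (smooth_partials t sf)).
Qed.

Lemma jet_partial i f y s : smooth f -> jet (partial i f) y s = jet f y (i :: s).
Proof. by move=> sf; rewrite /jet partials_partial. Qed.

Lemma partialsD (s : seq 'I_n) f g : smooth f -> smooth g ->
  partials s (fun x => f x + g x) = fun x => partials s f x + partials s g x.
Proof.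
move=> sf sg; elim: s => [//|i s IH].
by rewrite partials_cons IH (partialD i (smooth_partials s sf) (smooth_partials s sg)).
Qed.

Lemma partialsZ (s : seq 'I_n) (a : R[i]) f : smooth f ->
  partials s (fun x => a * f x) = fun x => a * partials s f x.
Proof.
move=> sf; elim: s => [//|i s IH].
by rewrite partials_cons IH (partialZ i a (smooth_partials s sf)).
Qed.

Lemma partials_sum (s : seq 'I_n) (I : Type) (r : seq I) (P : pred I) (F : I -> E -> R[i]) :
  (forall i, P i -> smooth (F i)) ->
  partials s (fun x => \sum_(i <- r | P i) F i x) =
  fun x => \sum_(i <- r | P i) partials s (F i) x.
Proof.
move=> sF; elim: s => [//|j s IH].
by rewrite partials_cons IH partial_sum// => i Pi; apply: smooth_partials; exact: sF.
Qed.

Lemma taylor_partD m f g x : smooth f -> smooth g ->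
  taylor_part m (fun x => f x + g x) x = taylor_part m f x + taylor_part m g x.
Proof.
move=> sf sg; rewrite /taylor_part -mulrDl -taylor_formD; congr (_ / _).
by apply: eq_taylor_form => s _; rewrite /jet partialsD.
Qed.

Lemma taylor_partZ m (a : R[i]) f x : smooth f ->
  taylor_part m (fun x => a * f x) x = a * taylor_part m f x.
Proof.
move=> sf; rewrite /taylor_part mulrA -taylor_formZ; congr (_ / _).
by apply: eq_taylor_form => s _; rewrite /jet partialsZ.
Qed.

Lemma taylor_part_sum m (I : Type) (r : seq I) (P : pred I) (F : I -> E -> R[i]) x :
  (forall i, P i -> smooth (F i)) ->
  taylor_part m (fun x => \sum_(i <- r | P i) F i x) x =
  \sum_(i <- r | P i) taylor_part m (F i) x.
Proof.
move=> sF; rewrite /taylor_part -mulr_suml -taylor_form_sum; congr (_ / _).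
by apply: eq_taylor_form => s _; rewrite /jet partials_sum.
Qed.

Lemma smooth_taylor_part m f : smooth (taylor_part m f).
Proof.
rewrite /taylor_part; under eq_fun do rewrite mulrC.
by apply: smoothZ; exact: smooth_taylor_form.
Qed.

Lemma taylor_part_scale m f (t : R) x : taylor_part m f (t *: x) = (t ^+ m)%:C * taylor_part m f x.
Proof. by rewrite /taylor_part taylor_form_scale mulrA. Qed.

Lemma taylor_part0 f x : taylor_part 0 f x = f 0.
Proof. by rewrite /taylor_part divr1. Qed.

Lemma partial_taylor_part m j f : smooth f ->
  partial j (taylor_part m.+1 f) = taylor_part m (partial j f).
Proof.
move=> sf; apply/funext => x.
have -> : taylor_part m.+1 f = fun x => (m.+1`!%:R)^-1 * taylor_form m.+1 (jet f 0) x.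
  by apply/funext => y; rewrite mulrC.
rewrite (partialZ j _ (smooth_taylor_form _ _)).
rewrite (partial_taylor_form m j (symmetric_jet_smooth 0 sf)) /taylor_part.
rewrite factS natrM invfM mulrACA mulVf ?pnatr_eq0// mul1r mulrC; congr (_ / _).
by apply: eq_taylor_form => s _; rewrite jet_partial.
Qed.

Lemma taylor_part_euler m f x : smooth f ->
  \sum_i (x i 0)%:C * partial i (taylor_part m.+1 f) x = m.+1%:R * taylor_part m.+1 f x.
Proof.
move=> sf; rewrite /taylor_part mulrA -taylor_form_euler; last exact: symmetric_jet_smooth.
rewrite mulr_suml; apply: eq_bigr => i _; rewrite -mulrA; congr (_ * _).
have -> : (fun x => taylor_form m.+1 (jet f 0) x / m.+1`!%:R) =
   fun x => (m.+1`!%:R)^-1 * taylor_form m.+1 (jet f 0) x.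
  by apply/funext => y; rewrite mulrC.
by rewrite (partialZ i _ (smooth_taylor_form _ _)) mulrC.
Qed.

Let linear_deriv (v : E) f : E -> R[i] := fun z => \sum_i (v i 0)%:C * partial i f z.

Let smooth_jet_form m v f : smooth f -> smooth (fun z => taylor_form m (jet f z) v).
Proof.
elim: m f => [//|m IH] f sf.
under eq_fun do rewrite taylor_formS.
apply: smooth_sum => i _; apply: smoothZ.
have -> : (fun z => taylor_form m (fun s => jet f z (i :: s)) v) =
    (fun z => taylor_form m (jet (partial i f) z) v).
  by apply/funext => z; apply: eq_taylor_form => s _; rewrite jet_partial.
by apply: IH; exact: smooth_partial.
Qed.

(** Iterated, this makes the Taylor form of the jet of [f] at [z + t v] the [m]-th
    derivative of [t |-> f (z + t v)]. *)
Let linear_deriv_form m v f : smooth f ->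
  linear_deriv v (fun z => taylor_form m (jet f z) v) = fun z => taylor_form m.+1 (jet f z) v.
Proof.
have form_jetS k g z : smooth g -> taylor_form k.+1 (jet g z) v =
   \sum_i (v i 0)%:C * taylor_form k (jet (partial i g) z) v.
  move=> sg; rewrite taylor_formS; apply: eq_bigr => i _; congr (_ * _).
  by apply: eq_taylor_form => s _; rewrite jet_partial.
elim: m f => [|m IH] f sf; apply/funext => z //.
rewrite form_jetS//.
transitivity (\sum_i (v i 0)%:C *
    linear_deriv v (fun z => taylor_form m (jet (partial i f) z) v) z); last first.
  by apply: eq_bigr => i _; rewrite (IH _ (smooth_partial i sf)).
have -> : (fun z => taylor_form m.+1 (jet f z) v) =
   (fun z => \sum_i (v i 0)%:C * taylor_form m (jet (partial i f) z) v).
  by apply/funext => y; rewrite form_jetS.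
have sm i := smooth_jet_form m v (smooth_partial i sf).
rewrite /linear_deriv; under [RHS]eq_bigr do rewrite mulr_sumr.
rewrite exchange_big; apply: eq_bigr => j _.
rewrite partial_sum => [|i _]; last exact: smoothZ.
rewrite mulr_sumr; apply: eq_bigr => i _.
by rewrite (partialZ j _ (sm i)) mulrCA.
Qed.

(** Induction on [M]: the bound for [h 1] says that
    [K t ^ (M+1) / (M+1)! -+ (h 0 t - Taylor polynomial)] has nonnegative derivative, and
    it vanishes at [0]. *)
Lemma taylor_remainder (h : nat -> R -> R) (M : nat) (K : R) :
  (forall m t, is_derive t (1 : R) (h m) (h m.+1 t)) ->
  (forall t, 0 <= t <= 1 -> `|h M t| <= K) ->
  forall t, 0 <= t <= 1 ->
    `|h 0%N t - \sum_(m < M) h m 0 / m`!%:R * t ^+ m| <= K / M`!%:R * t ^+ M.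
Proof.
elim: M h => [|M IH] h dh hK t t01.
  by rewrite big_ord0 subr0 divr1 expr0 mulr1 hK.
have {}IH := IH (fun m => h m.+1) (fun m => dh m.+1) hK.
pose p := \poly_(m < M.+1) (h m 0 / m`!%:R).
have pE s : p.[s] = \sum_(m < M.+1) h m 0 / m`!%:R * s ^+ m by rewrite horner_poly.
have dpE s : (p^`()).[s] = \sum_(m < M) h m.+1 0 / m`!%:R * s ^+ m.
  have -> : p^`() = \poly_(m < M) (h m.+1 0 / m`!%:R).
    apply/polyP => m; rewrite coef_deriv !coef_poly ltnS.
    case: ifP => _; last by rewrite mul0rn.
    rewrite factS natrM invfM -[LHS]mulr_natr -!mulrA; congr (_ * _).
    by rewrite mulrCA mulVf ?mulr1// pnatr_eq0.
  by rewrite horner_poly.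
pose q : {poly R} := (K / M.+1`!%:R)%:P * 'X^(M.+1).
have qE s : q.[s] = K / M.+1`!%:R * s ^+ M.+1 by rewrite !hornerE.
have dqE s : (q^`()).[s] = K / M`!%:R * s ^+ M.
  rewrite /q derivM derivC mul0r add0r derivXn hornerM hornerC.
  rewrite hornerMn hornerXn factS natrM invfM -[s ^+ M *+ _]mulr_natr.
  rewrite [s ^+ M * _]mulrC mulrA; congr (_ * _); rewrite -mulrA; congr (K * _).
  by rewrite mulrAC mulVf ?mul1r// pnatr_eq0.
have hder (r : {poly R}) (s : R) : is_derive s (1 : R) (fun s => r.[s]) (r^`()).[s].
  have dr := @derivable_horner _ r s; split => //.
  by rewrite -derive1E derivE.
have mvt (e : R) : e = 1 \/ e = - 1 -> 0 <= q.[t] - e * (h 0%N t - p.[t]).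
  move=> e1.
  have dF s : is_derive s (1 : R) (fun s => q.[s] - e * (h 0%N s - p.[s]))
      ((q^`()).[s] - e * (h 1%N s - (p^`()).[s])).
    exact: (is_deriveB (hder q s) (is_deriveZ e (is_deriveB (dh 0%N s) (hder p s)))).
  have /andP[t0 t1] := t01.
  have [|c] := @MVT_segment _ _ _ 0 t t0 (fun s _ => dF s).
    by apply: derivable_within_continuous => s _; have [] := dF s.
  rewrite in_itv/= !subr0 => /andP[c0 ct].
  have q0 : q.[0] = 0 by rewrite qE expr0n mulr0.
  have p0 : p.[0] = h 0%N 0.
    rewrite pE big_ord_recl big1 => [|i _]; last by rewrite /= expr0n mulr0.
    by rewrite expr0 mulr1 divr1 addr0.
  rewrite q0 p0 subrr mulr0 !subr0 => ->.
  rewrite mulr_ge0// subr_ge0 dqE dpE.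
  have := IH c; rewrite c0 (le_trans ct t1) => /(_ isT).
  by rewrite ler_norml; case: e1 => ->; lra.
have := mvt 1 (or_introl erefl); have := mvt (- 1) (or_intror erefl).
by rewrite -pE qE ler_norml; lra.
Qed.

Lemma taylor_line_remainder f x (M : nat) (K : R) : smooth f ->
  (forall t, 0 <= t <= 1 -> normc (taylor_form M (jet f (t *: x)) x) <= K) ->
  normc (f x - \sum_(m < M) taylor_part m f x) <= (K / M`!%:R) *+ 2.
Proof.
move=> sf fK.
pose h m (t : R) := taylor_form m (jet f (t *: x)) x.
have z0 : 0 + 1 *: x = x by rewrite add0r scale1r.
have dre m t : is_derive t (1 : R) (fun t => complex.Re (h m t)) (complex.Re (h m.+1 t)).
  have := smooth_re_line 0 x t (smooth_jet_form m x sf).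
  have := congr1 (fun F => F (0 + t *: x)) (linear_deriv_form m x sf); rewrite /linear_deriv => ->.
  by under eq_fun do rewrite add0r; rewrite add0r.
have dim m t : is_derive t (1 : R) (fun t => complex.Im (h m t)) (complex.Im (h m.+1 t)).
  have := smooth_im_line 0 x t (smooth_jet_form m x sf).
  have := congr1 (fun F => F (0 + t *: x)) (linear_deriv_form m x sf); rewrite /linear_deriv => ->.
  by under eq_fun do rewrite add0r; rewrite add0r.
have i01 : 0 <= (1 : R) <= 1 by rewrite ler01 lexx.
have hr := taylor_remainder dre (fun t t01 => le_trans (Re_le_normc _) (fK t t01)) i01.
have hi := taylor_remainder dim (fun t t01 => le_trans (Im_le_normc _) (fK t t01)) i01.
apply: le_trans (normc_le_ReIm _) _; rewrite mulr2n.
have fact_c m : (m`!%:R : R[i]) = (m`!%:R : R)%:C by rewrite rmorph_nat.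
have divC (z : R[i]) (a : R) : complex.Re (z / a%:C) = complex.Re z / a /\
    complex.Im (z / a%:C) = complex.Im z / a.
  by rewrite -fmorphV cReM cImM /= !mulr0 subr0 add0r.
apply: lerD.
- move: hr; rewrite expr1n mulr1 /h scale1r cReD cReN Re_sum.
  under eq_bigr do rewrite expr1n mulr1 scale0r.
  by under [in X in _ -> X]eq_bigr do rewrite /taylor_part fact_c (divC _ _).1.
- move: hi; rewrite expr1n mulr1 /h scale1r cImD cImN Im_sum.
  under eq_bigr do rewrite expr1n mulr1 scale0r.
  by under [in X in _ -> X]eq_bigr do rewrite /taylor_part fact_c (divC _ _).2.
Qed.

(** A Taylor form depends on the values of the function along a line only.  This
    applies to radial functions at two points of a sphere, and to [f] and its
    rotates. *)
Lemma taylor_form_congr m f g x y : smooth f -> smooth g ->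
  (forall t, f (t *: x) = g (t *: y)) ->
  taylor_form m (jet f 0) x = taylor_form m (jet g 0) y.
Proof.
move=> sf sg fg.
suff : forall t, taylor_form m (jet f (t *: x)) x = taylor_form m (jet g (t *: y)) y.
  by move=> /(_ 0); rewrite !scale0r.
elim: m => [|m IH] t; first exact: fg.
have D u v (w : E -> R[i]) : smooth w -> let h t := taylor_form m (jet w (t *: v)) v in
   is_derive u (1 : R) (fun t => complex.Re (h t))
     (complex.Re (taylor_form m.+1 (jet w (u *: v)) v)) /\
   is_derive u (1 : R) (fun t => complex.Im (h t))
     (complex.Im (taylor_form m.+1 (jet w (u *: v)) v)).
  move=> sw h.
  have := congr1 (fun F => F (0 + u *: v)) (linear_deriv_form m v sw); rewrite /linear_deriv => H.
  split.
    have := smooth_re_line 0 v u (smooth_jet_form m v sw); rewrite H.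
    by under eq_fun do rewrite add0r; rewrite add0r.
  have := smooth_im_line 0 v u (smooth_jet_form m v sw); rewrite H.
  by under eq_fun do rewrite add0r; rewrite add0r.
have [[_ r1] [_ i1]] := D t x f sf; have [[_ r2] [_ i2]] := D t y g sg.
apply: complexP; rewrite -?r1 -?r2 -?i1 -?i2; congr ('D_1 _ t); apply/funext => u /=.
  by rewrite IH.
by rewrite IH.
Qed.

End Jets.

(** * Taylor series of eigenfunctions *)

Section EigenTaylor.
Variables (R : realType) (n : nat) (lambda : R[i]).
Local Notation E := 'cV[R]_n.
Local Notation ei i := (delta_mx i 0 : E).
Local Notation eigen := (@eigenfunction R n lambda).
Implicit Types (f g : E -> R[i]).

(** In the factorial bound take [rho'] at least twice [sum_i |x_i|]: the forms of degree
    [m] are then at most [B m! / 2 ^ m]. *)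
Lemma eigen_taylor f (rho : R) : eigen f -> 0 < rho ->
  exists2 B : R, 0 < B & forall m x, `|x| <= rho ->
    normc (taylor_part m f x) <= B / 2 ^+ m /\
    normc (f x - \sum_(k < m) taylor_part k f x) <= B / 2 ^+ m.
Proof.
move=> ef rho0; pose rho' := n%:R * rho *+ 2 + rho.
have rho'0 : 0 < rho' by rewrite ltr_wpDl// mulrn_wge0// mulr_ge0// ltW.
have [B0 B00 HB] := eigen_partials_factorial ef rho'0.
have sf := eigen_smooth ef.
have bound m x t : `|x| <= rho -> 0 <= t <= 1 ->
    normc (taylor_form m (jet f (t *: x)) x) <= (B0 *+ 2) * m`!%:R / 2 ^+ m.
  move=> xr /andP[t0 t1].
  have K s : size s = m -> normc (jet f (t *: x) s) <= (B0 *+ 2) * m`!%:R / rho' ^+ m.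
    move=> sm; have [|h1 h2] := HB s (t *: x).
      rewrite normrZ (ger0_norm t0) (le_trans (ler_piMl _ t1))//.
      by rewrite (le_trans xr)// lerDr mulrn_wge0// mulr_ge0// ltW.
    rewrite sm in h1 h2; apply: le_trans (normc_le_ReIm _) _.
    by rewrite mulrnAl mulrnAl mulr2n lerD.
  apply: le_trans (taylor_form_bound _ K) _.
  have Sx := sum_coord_le xr.
  have Sx0 : 0 <= \sum_i `|x i 0| by apply: sumr_ge0.
  rewrite mulrA mulrC mulrA [leRHS]mulrC ler_wpM2r ?mulr_ge0 ?mulrn_wge0 ?(ltW B00)//.
  rewrite -!exprVn -exprMn lerXn2r ?nnegrE ?mulr_ge0 ?invr_ge0 ?(ltW rho'0)//.
  rewrite mulrC ler_pdivrMr// mulrC ler_pdivlMr//.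
  by rewrite /rho'; move: Sx rho0; lra.
exists (B0 *+ 4) => [|m x xr]; first by rewrite pmulrn_lgt0.
have m0 : (0 : R) < m`!%:R by rewrite ltr0n fact_gt0.
split.
  rewrite /taylor_part normcM normcV normc_natr.
  rewrite ler_pdivrMr// mulrAC.
  have := bound m x 0 xr; rewrite scale0r lexx ler01 => /(_ isT) h.
  apply: (le_trans h); rewrite ler_wpM2r ?invr_ge0 ?exprn_ge0// ler_wpM2r ?(ltW m0)//.
  by rewrite ler_pMn2l.
apply: le_trans (taylor_line_remainder sf (fun t t01 => bound m x t xr t01)) _.
rewrite le_eqVlt; apply/orP; left; apply/eqP; rewrite -[4%N]/(2 * 2)%N mulrnA.
by field; rewrite expf_neq0//= gt_eqF.
Qed.

Lemma taylor_part_laplace m f x : eigen f ->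
  \sum_i partial i (partial i (taylor_part m.+2 f)) x = - lambda ^+ 2 * taylor_part m f x.
Proof.
move=> [sf Lf].
under eq_bigr => i _ do rewrite (partial_taylor_part m.+1 i sf)
  (partial_taylor_part m i (smooth_partial i sf)).
rewrite -taylor_part_sum => [|i _]; last by do 2 apply: smooth_partial.
have -> : (fun x => \sum_i partial i (partial i f) x) = (fun x => - lambda ^+ 2 * f x).
  by apply/funext.
by rewrite taylor_partZ.
Qed.

(** The gradient estimate applied to differences of eigenfunctions turns locally
    uniform convergence into convergence of all derivatives. *)
Lemma eigen_partials_small f s (rho e : R) : eigen f -> 0 < e ->
  (forall x, `|x| <= rho + (size s)%:R -> normc (f x) <= e) ->
  forall x, `|x| <= rho -> normc (partials s f x) <= (grad_cst n lambda ^+ size s * e) *+ 2.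
Proof.
move=> ef e0 fe x xr.
have [|h1 h2] := @eigen_partials_bound R n lambda f s x 1 e ef ltr01 (lexx _) e0.
  move=> y; rewrite mulr1 => yx; have ye : normc (f y) <= e.
    apply: fe; rewrite -[y](subrK x) addrC (le_trans (ler_normD _ _))//; exact: lerD.
  split; [apply: le_trans (Re_le_normc _) ye|exact: le_trans (Im_le_normc _) ye].
by move: h1 h2; rewrite divr1 => h1 h2; rewrite mulr2n (le_trans (normc_le_ReIm _))// lerD.
Qed.

Let real_quotient (u : E -> R) i x (h M : R) : rsmooth u -> 0 < h -> h <= 1 ->
  (forall y, `|y| <= `|x| + 1 -> `|rpderiv i (rpderiv i u) y| <= M) ->
  `|h^-1 * (u (x + h *: ei i) - u x) - rpderiv i u x| <= h * M.
Proof.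
move=> su h0 h1 uM.
have [c ch ->] := line_MVT x h (rsmooth_derivable su i).
have [b bc Eb] := line_MVT x c (rsmooth_derivable (rsmooth_pderiv i su) i).
rewrite mulKf ?gt_eqF// -rpderivE Eb -rpderivE normrM.
rewrite (gtr0_norm h0) in ch; apply: ler_pM => //; apply: uM.
apply: le_trans (ler_normD _ _) _; rewrite lerD2l normrZ.
by rewrite mulr_ile1 ?norm_delta_le1// (le_trans bc)// (le_trans ch).
Qed.

(** Translation invariance and closedness give invariance under [partial i] through
    this uniform limit. *)
Lemma difference_quotient f i (rho e : R) : smooth f -> 0 < e -> 0 <= rho ->
  exists2 h : R, 0 < h & forall x, `|x| <= rho ->
   normc (partial i f x - (h^-1)%:C * (f (x + h *: ei i) - f x)) <= e.
Proof.
move=> sf e0 rho0.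
have [sr si] := (smoothP f).1 sf.
have s2 : smooth (partial i (partial i f)) by do 2 apply: smooth_partial.
have c2 : continuous (partial i (partial i f)) by have [] := s2 [::].
have [|M M0 fM] := @continuous_bounded_ball R n _ (rho + 1) c2; first by rewrite addr_ge0.
exists (Num.min 1 (e / (M *+ 2))).
  by rewrite lt_min ltr01 divr_gt0// pmulrn_lgt0.
set h := Num.min _ _ => x xr.
have h0 : 0 < h by rewrite lt_min ltr01 divr_gt0// pmulrn_lgt0.
have h1 : h <= 1 by rewrite ge_min lexx.
have hM : h * M *+ 2 <= e.
  rewrite -mulrnAr -ler_pdivlMr ?pmulrn_lgt0//; first by rewrite ge_min lexx orbT.
have yM y : `|y| <= `|x| + 1 -> `|y| <= rho + 1.
  by move=> yx; apply: le_trans yx _; rewrite lerD2r.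
apply: le_trans (normc_le_ReIm _) _; apply: le_trans hM; rewrite mulr2n; apply: lerD.
  rewrite cReD cReN cReM /= mul0r subr0 cReD cReN -normrN opprB partialE /=.
  apply: (real_quotient sr h0 h1) => y /yM /fM [+ _].
  by rewrite partialE/= reF_partial.
rewrite cImD cImN cImM /= mul0r addr0 cImD cImN -normrN opprB partialE /=.
apply: (real_quotient si h0 h1) => y /yM /fM [_ +].
by rewrite partialE/= imF_partial.
Qed.

End EigenTaylor.

(** * The spherical function *)

Section EntireSeries.
Variable R : realType.
Implicit Types (c : nat -> R).

(** The coefficients of a power series with infinite radius of convergence. *)
Definition rapid c := forall r : R, 0 < r -> exists B : R, forall j, `|c j| * r ^+ j <= B.

Definition entire c (x : R) : R := limn (pseries c x).

Lemma rapid_diffs c : rapid c -> rapid (pseries_diffs c).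
Proof.
move=> rc r r0; have [|B HB] := rc (r *+ 2); first by rewrite pmulrn_lgt0.
exists (B / r) => j; rewrite /pseries_diffs normrM ger0_norm//.
rewrite ler_pdivlMr// -mulrA -exprSr; apply: le_trans (HB j.+1).
rewrite mulrAC mulrC ler_wpM2l// -[r *+ 2]mulr_natl exprMn ler_wpM2r ?exprn_ge0 ?(ltW r0)//.
by rewrite -natrX ler_nat ltnW// ltn_expl.
Qed.

Lemma rapidZ a c : rapid c -> rapid (fun j => a * c j).
Proof.
move=> rc r r0; have [B HB] := rc r r0; exists (`|a| * B) => j.
by rewrite normrM -mulrA ler_wpM2l.
Qed.

Lemma rapid_mulj c : rapid c -> rapid (fun j => j%:R * c j).
Proof.
move=> rc r r0; have [|B HB] := rc (r *+ 2); first by rewrite pmulrn_lgt0.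
exists B => j; apply: le_trans (HB j).
rewrite normrM ger0_norm// -[r *+ 2]mulr_natl exprMn mulrAC mulrC mulrCA mulrA mulrA.
rewrite ler_wpM2r ?exprn_ge0 ?(ltW r0)// [j%:R * _]mulrC ler_wpM2l//.
by rewrite -natrX ler_nat ltnW// ltn_expl.
Qed.

Lemma rapid_cvg c x : rapid c -> cvgn (pseries c x).
Proof.
move=> rc; have [|B HB] := rc ((1 + `|x|) *+ 2); first by rewrite pmulrn_lgt0// ltr_pwDl.
apply: normed_cvg.
apply: (@series_le_cvg _ _ (fun j => B * (2^-1) ^+ j)).
- by move=> j; exact: normr_ge0.
- move=> j; rewrite mulr_ge0 ?exprn_ge0 ?invr_ge0//.
  by apply: le_trans (HB 0%N); rewrite mulr_ge0 ?exprn_ge0// mulrn_wge0// addr_ge0.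
- move=> j /=; rewrite normrM normrX exprVn ler_pdivlMr ?exprn_gt0// -mulrA.
  apply: le_trans (HB j); rewrite ler_wpM2l// -[(1 + `|x|) *+ 2]mulr_natr exprMn.
  rewrite ler_wpM2r ?exprn_ge0// lerXn2r ?nnegrE ?addr_ge0// lerDr//.
have := @is_cvg_geometric_series R B (2^-1).
rewrite ger0_norm ?invr_ge0//; apply.
by rewrite invf_lt1// ltr1n.
Qed.

Lemma is_derive_entire c x : rapid c ->
  is_derive x (1 : R) (entire c) (entire (pseries_diffs c) x).
Proof.
move=> rc; apply: (@pseries_snd_diffs R c (`|x| + 1)).
- exact: rapid_cvg.
- exact/rapid_cvg/rapid_diffs.
- exact/rapid_cvg/rapid_diffs/rapid_diffs.
- by rewrite [ltRHS]ger0_norm ?addr_ge0// ltrDl.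
Qed.

Lemma entireD c d x : rapid c -> rapid d ->
  entire (fun j => c j + d j) x = entire c x + entire d x.
Proof.
move=> rc rd; apply: cvg_lim => //.
have -> : pseries (fun j => c j + d j) x = pseries c x + pseries d x.
  apply/funext => N; rewrite /pseries /series /= -[RHS]/(_ + _) -big_split.
  by apply: eq_bigr => j _; rewrite mulrDl.
by apply: cvgD; exact: rapid_cvg.
Qed.

Lemma entireZ a c x : rapid c -> entire (fun j => a * c j) x = a * entire c x.
Proof.
move=> rc; apply: cvg_lim => //.
have -> : pseries (fun j => a * c j) x = a \*: pseries c x.
  apply/funext => N; rewrite /pseries /series /= -[RHS]/(a * _) mulr_sumr.
  by apply: eq_bigr => j _; rewrite mulrA.
by apply: cvgZl_tmp; exact: rapid_cvg.
Qed.

Lemma entire_mulX c x : rapid c ->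
  x * entire (pseries_diffs c) x = entire (fun j => j%:R * c j) x.
Proof.
move=> rc; apply/esym/cvg_lim => //.
rewrite -(cvg_shiftS (pseries (fun j => j%:R * c j) x)).
have -> : [sequence pseries (fun j => j%:R * c j) x N.+1]_N = x \*: pseries (pseries_diffs c) x.
  apply/funext => N; rewrite /pseries /series /= -[RHS]/(x * _) mulr_sumr.
  rewrite big_nat_recl// !mul0r add0r.
  by apply: eq_bigr => j _; rewrite /pseries_diffs exprS; ring.
by apply: cvgZl_tmp; exact/rapid_cvg/rapid_diffs.
Qed.

Lemma entire0 c : entire c 0 = c 0%N.
Proof.
apply: cvg_lim => //; rewrite -(cvg_shiftS (pseries c 0)); apply: cvg_near_cst.
apply: nearW => N; rewrite /pseries /series /= big_nat_recl// expr0 mulr1.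
by rewrite big1 ?addr0// => j _; rewrite expr0n mulr0.
Qed.

Lemma rapid_ratio c (K : R) : 0 <= K -> (forall j, `|c j.+1| * j.+1%:R <= K * `|c j|) -> rapid c.
Proof.
move=> K0 cK r r0; pose N := Num.bound (K * r).
have KN : K * r < N%:R by rewrite archi_boundP// mulr_ge0// ltW.
pose B := \sum_(j < N.+1) `|c j| * r ^+ j.
have B1 j : (j <= N)%N -> `|c j| * r ^+ j <= B.
  rewrite -ltnS => jN; rewrite /B (bigD1 (Ordinal jN))//= lerDl sumr_ge0// => i _.
  by rewrite mulr_ge0// exprn_ge0// ltW.
exists B; elim=> [|j IH]; first exact: B1.
have [jN|Nj] := leqP j.+1 N; first exact: B1.
apply: le_trans IH; have j0 : 0 < j.+1%:R :> R by rewrite ltr0n.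
rewrite -(ler_pM2r j0) mulrAC exprS mulrCA mulrA mulrC mulrA.
apply: (@le_trans _ _ (K * `|c j| * r * r ^+ j)).
  have rr : 0 <= r * r ^+ j by rewrite mulr_ge0 ?exprn_ge0// ltW.
  have := ler_wpM2r rr (cK j); rewrite -!mulrA => h.
  by apply: le_trans h; rewrite le_eqVlt; apply/orP; left; apply/eqP; ring.
have -> : K * `|c j| * r * r ^+ j = `|c j| * r ^+ j * (K * r) by ring.
rewrite ler_wpM2l ?mulr_ge0 ?exprn_ge0 ?(ltW r0)// (le_trans (ltW KN))// ler_nat.
exact: ltnW.
Qed.

End EntireSeries.

Section Radial.
Variables (R : realType) (n : nat).
Local Notation E := 'cV[R]_n.
Local Notation ei i := (delta_mx i 0 : E).
Implicit Types (x y : E) (f : E -> R[i]).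

Definition sqnorm x : R := \sum_i x i 0 ^+ 2.

Lemma sqnorm_ge0 x : 0 <= sqnorm x.
Proof. by apply: sumr_ge0 => i _; exact: sqr_ge0. Qed.

Lemma sqnormZ (t : R) x : sqnorm (t *: x) = t ^+ 2 * sqnorm x.
Proof. by rewrite /sqnorm mulr_sumr; apply: eq_bigr => i _; rewrite mxE exprMn. Qed.

Lemma sqnorm_le x (rho : R) : `|x| <= rho -> sqnorm x <= n%:R * rho ^+ 2.
Proof.
move=> xr; rewrite mulr_natl -[X in _ *+ X](card_ord n) -sumr_const.
apply: ler_sum => i _; rewrite -real_normK ?num_real//; apply: lerXn2r; rewrite ?nnegrE//.
  exact: le_trans (normr_ge0 _) xr.
by apply: le_trans xr; exact: cV_coord_le.
Qed.

Lemma is_derive_sqnorm x i : is_derive x (ei i) sqnorm (2 * x i 0).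
Proof.
have -> : sqnorm = (\sum_(k < n) (fun x : E => x k 0 * x k 0)) :> (E -> R).
  by apply/funext => y; rewrite fct_sumE; apply: eq_bigr => k _; rewrite expr2.
have d k : is_derive x (ei i) (fun x : E => x k 0 * x k 0) (2 * (k == i)%:R * x k 0).
  apply: (is_derive_eq (is_deriveM (is_derive_coord x k i) (is_derive_coord x k i))).
  by rewrite /GRing.scale/=; ring.
have -> : 2 * x i 0 = \sum_(k < n) 2 * (k == i)%:R * x k 0.
  rewrite (bigD1 i)//= big1 ?addr0 ?eqxx ?mulr1// => k /negbTE ->.
  by rewrite mulr0 mul0r.
exact: (is_derive_sum d).
Qed.

Lemma sqnorm_continuous : continuous sqnorm.
Proof.
rewrite /sqnorm; apply: real_cont_sum => i _; under eq_fun do rewrite expr2.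
by apply: real_contM; exact: coord_continuous.
Qed.

Lemma is_derive_of_line (u : E -> R) x v d :
  is_derive (0 : R) (1 : R) (fun s : R => u (x + s *: v)) d -> is_derive x v u d.
Proof.
move=> [du dE].
have E1 : (fun h : R => h^-1 *: (((fun s : R => u (x + s *: v)) \o shift 0) (h *: (1 : R))
      - u (x + 0 *: v))) =
    (fun h : R => h^-1 *: ((u \o shift x) (h *: v) - u x)).
  apply/funext => h /=; congr (_ *: (u _ - u _)); last by rewrite scale0r addr0.
  by rewrite [_%:A]mulr1 addr0 addrC.
by split; [rewrite /derivable -E1|rewrite /derive -E1].
Qed.

Lemma is_derive_radial (F : R -> R) (d : R) x i :
  is_derive (sqnorm x) (1 : R) F d -> is_derive x (ei i) (fun y => F (sqnorm y)) (2 * x i 0 * d).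
Proof.
move=> dF; apply: is_derive_of_line.
have x0 : x + 0 *: ei i = x by rewrite scale0r addr0.
have dg : is_derive (0 : R) (1 : R) (fun s : R => sqnorm (x + s *: ei i)) (2 * x i 0).
  by apply: is_derive_line; rewrite x0; exact: is_derive_sqnorm.
rewrite mulrC; apply: (@is_derive1_comp _ F (fun s : R => sqnorm (x + s *: ei i))).
by rewrite x0.
Qed.

Definition radial_entire (c : nat -> R) : E -> R := fun x => entire c (sqnorm x).

Lemma rsmooth_radial_entire c : rapid c -> rsmooth (radial_entire c).
Proof.
move=> rc; pose B u := exists2 d, rapid d & u = radial_entire d.
apply: (@coord_closure_smooth _ _ B); last by apply: CoordBase; exists c.
move=> _ {c rc} [c rc ->]; split=> [x|i].
  apply: (@continuous_comp _ _ _ sqnorm (entire c)); first exact: sqnorm_continuous.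
  apply: differentiable_continuous; apply/derivable1_diffP.
  by have [] := is_derive_entire (sqnorm x) rc.
exists (fun x : E => 2 * (x i 0 * radial_entire (pseries_diffs c) x)) => [|x].
  by apply/CoordScale/CoordMul/CoordBase; exists (pseries_diffs c) => //; exact: rapid_diffs.
by rewrite mulrA; apply: is_derive_radial; exact: is_derive_entire.
Qed.

Lemma rpderiv_radial_entire c i : rapid c -> rpderiv i (radial_entire c) =
  fun x : E => 2 * (x i 0 * radial_entire (pseries_diffs c) x).
Proof.
move=> rc; apply/funext => x; rewrite rpderivE mulrA.
by have [_ ->] := is_derive_radial i (is_derive_entire (sqnorm x) rc).
Qed.

(** [L (F (|x|^2)) = 2 n F' + 4 |x|^2 F''], read on the coefficients of [F']. *)
Lemma laplace_radial_entire c x : rapid c ->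
  \sum_i rpderiv i (rpderiv i (radial_entire c)) x =
  radial_entire (fun j => (2 * n%:R + 4 * j%:R) * pseries_diffs c j) x.
Proof.
move=> rc; have rc1 := rapid_diffs rc; have rc2 := rapid_diffs rc1.
have rj := rapid_mulj rc1.
pose F1 := radial_entire (pseries_diffs c).
pose F2 := radial_entire (pseries_diffs (pseries_diffs c)).
have -> : \sum_i rpderiv i (rpderiv i (radial_entire c)) x =
    \sum_i (2 * F1 x + 4 * F2 x * x i 0 ^+ 2).
  apply: eq_bigr => i _; rewrite rpderiv_radial_entire//.
  have s1 := rsmooth_radial_entire rc1.
  have := rpderivZ 2 i (rsmooth_coordM i s1) => /(congr1 (fun u => u x)) /= ->.
  rewrite rpderiv_coordM// eqxx rpderiv_radial_entire// /GRing.scale/= -/F1 -/F2.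
  by ring.
rewrite big_split/= sumr_const card_ord -mulr_sumr -/(sqnorm x).
rewrite -mulrA [F2 x * _]mulrC entire_mulX//.
rewrite /F1 /radial_entire.
have -> : (fun j => (2 * n%:R + 4 * j%:R) * pseries_diffs c j) =
   (fun j => 2 * n%:R * pseries_diffs c j + 4 * (j%:R * pseries_diffs c j)).
  by apply/funext => j; ring.
rewrite entireD ?entireZ//.
  by rewrite -mulr_natr; ring.
all: exact: rapidZ.
Qed.

End Radial.

Section SqnormMultiplication.
Variables (R : realType) (n : nat).
Local Notation E := 'cV[R]_n.
Implicit Types (x y : E) (f : E -> R[i]).

Definition sqmul j f : E -> R[i] := fun x => (sqnorm x ^+ j)%:C * f x.

Let sqmulE f : (fun x : E => (sqnorm x)%:C * f x) =
  fun x : E => \sum_k (x k 0)%:C * ((x k 0)%:C * f x).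
Proof.
apply/funext => x; rewrite /sqnorm rmorph_sum mulr_suml; apply: eq_bigr => k _.
by rewrite mulrA -rmorphM expr2.
Qed.

Let smooth_sq f : smooth f -> smooth (fun x : E => (sqnorm x)%:C * f x).
Proof.
move=> sf; rewrite sqmulE; apply: smooth_sum => k _.
by do 2 apply: smooth_coordM.
Qed.

Let partial_sq i f : smooth f -> partial i (fun x : E => (sqnorm x)%:C * f x) =
  fun x : E => 2 * ((x i 0)%:C * f x) + (sqnorm x)%:C * partial i f x.
Proof.
move=> sf; rewrite sqmulE partial_sum => [|k _]; last by do 2 apply: smooth_coordM.
apply/funext => x.
under eq_bigr => k _ do rewrite (partial_coordM k i (smooth_coordM k sf)) (partial_coordM k i sf).
have -> : (sqnorm x)%:C * partial i f x = \sum_k (x k 0)%:C * ((x k 0)%:C * partial i f x).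
  by have := congr1 (fun F => F x) (sqmulE (partial i f)).
rewrite (bigD1 i)//= [in RHS](bigD1 i)//= eqxx addrA.
congr (_ + _); first by rewrite !mul1r mulrDr; ring.
by apply: eq_bigr => k /negbTE ->; rewrite !mul0r !add0r.
Qed.

Lemma sqmul0 f : sqmul 0 f = f.
Proof. by apply/funext => x; rewrite /sqmul expr0 mul1r. Qed.

Lemma sqmulS j f : sqmul j.+1 f = (fun x => (sqnorm x)%:C * sqmul j f x).
Proof. by apply/funext => x; rewrite /sqmul exprS rmorphM mulrA. Qed.

Lemma smooth_sqmul j f : smooth f -> smooth (sqmul j f).
Proof.
move=> sf; elim: j => [|j IH]; first by rewrite sqmul0.
by rewrite sqmulS; exact: smooth_sq.
Qed.

Lemma partial_sqmul j i f : smooth f -> partial i (sqmul j.+1 f) =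
  fun x => (2 * j.+1)%:R * ((x i 0)%:C * sqmul j f x) + sqmul j.+1 (partial i f) x.
Proof.
move=> sf; elim: j => [|j IH].
  rewrite sqmulS sqmul0 (partial_sq i sf); apply/funext => x.
  by rewrite sqmulS sqmul0.
rewrite sqmulS (partial_sq i (smooth_sqmul j.+1 sf)) IH; apply/funext => x.
rewrite [sqmul j.+2 _]sqmulS [sqmul j.+1 f]sqmulS mulrDr addrA; congr (_ + _).
by rewrite !mulnS !natrD; ring.
Qed.

Lemma laplace_sqnorm_pow j (a : R[i]) x :
  \sum_i partial i (partial i (sqmul j.+1 (fun=> a))) x =
  ((2 * j + 2) * (2 * j + n))%:R * ((sqnorm x ^+ j)%:C * a).
Proof.
have sa := (@smooth_cst R n a).1.
have s0 := (@smooth_cst R n 0).1.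
have E1 i : partial i (sqmul j.+1 (fun=> a)) =
   fun x => (2 * j.+1)%:R * ((x i 0)%:C * sqmul j (fun=> a) x).
  rewrite (partial_sqmul j i sa) (@smooth_cst R n a).2; apply/funext => y.
  by rewrite /sqmul mulr0 addr0.
have sj := smooth_sqmul j sa.
under eq_bigr => i _ do
  rewrite E1 (partialZ i _ (smooth_coordM i sj)) (partial_coordM i i sj) eqxx mul1r.
rewrite -mulr_sumr big_split/= sumr_const card_ord.
have -> : \sum_i (x i 0)%:C * partial i (sqmul j (fun=> a)) x =
    (2 * j)%:R * sqmul j (fun=> a) x.
  case: j {E1 sj} => [|j].
    rewrite mul0r sqmul0 big1// => i _; by rewrite (@smooth_cst R n a).2 mulr0.
  rewrite [X in _ = _ * X x]sqmulS [X in _ * (X%:C * _)]/sqnorm rmorph_sum mulr_suml mulr_sumr.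
  apply: eq_bigr => i _.
  rewrite (partial_sqmul j i sa) (@smooth_cst R n a).2 /sqmul mulr0 addr0.
  by rewrite rmorphXn /=; ring.
rewrite -/(sqmul j (fun=> a) x) -[_ *+ n]mulr_natl -[j.+1]addn1 !(natrM, natrD); ring.
Qed.

End SqnormMultiplication.

Section SphericalFunction.
Variables (R : realType) (n : nat) (lambda : R[i]).
Local Notation E := 'cV[R]_n.
Local Notation ei i := (delta_mx i 0 : E).
Local Notation eigen := (@eigenfunction R n lambda).
Hypothesis n_gt0 : (0 < n)%N.

(** Dictated by [L |x|^(2j+2) = (2j+2)(2j+n) |x|^(2j)]. *)
Definition spherical_coef j : R[i] :=
  \prod_(i < j) (- lambda ^+ 2 / ((2 * i + 2) * (2 * i + n))%:R).

Lemma spherical_coefS j : spherical_coef j.+1 * ((2 * j + 2) * (2 * j + n))%:R =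
  - lambda ^+ 2 * spherical_coef j.
Proof.
rewrite /spherical_coef big_ord_recr/= -mulrA divfK; first by rewrite mulrC.
by rewrite pnatr_eq0 -lt0n muln_gt0 !addn_gt0 n_gt0 !orbT.
Qed.

Let rapid_coef : rapid (fun j => normc (spherical_coef j)).
Proof.
apply: (@rapid_ratio _ _ (normc (- lambda ^+ 2))) => [|j]; first exact: normc_ge0.
rewrite !ger0_norm ?normc_ge0// -normcM -spherical_coefS normcM normc_natr.
rewrite ler_wpM2l ?normc_ge0// ler_nat.
have : (0 < 2 * j + n)%N by rewrite addn_gt0 n_gt0 orbT.
nia.
Qed.

Let rapid_le (c d : nat -> R) : rapid d -> (forall j, `|c j| <= `|d j|) -> rapid c.
Proof.
move=> rd cd r r0; have [B HB] := rd r r0; exists B => j; apply: le_trans (HB j).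
by rewrite ler_wpM2r ?exprn_ge0// ltW.
Qed.

Let a j := complex.Re (spherical_coef j).
Let b j := complex.Im (spherical_coef j).

Let rapid_a : rapid a.
Proof.
by apply: rapid_le rapid_coef _ => j; rewrite [leRHS]ger0_norm ?normc_ge0 ?Re_le_normc.
Qed.

Let rapid_b : rapid b.
Proof.
by apply: rapid_le rapid_coef _ => j; rewrite [leRHS]ger0_norm ?normc_ge0 ?Im_le_normc.
Qed.

Definition spherical_function : E -> R[i] :=
  fun x => radial_entire a x +i* radial_entire b x.

Lemma spherical_function0 : spherical_function 0 = 1.
Proof.
have s0 : sqnorm (0 : E) = 0 by rewrite /sqnorm big1// => i _; rewrite mxE expr0n.
rewrite /spherical_function /radial_entire s0 !entire0 /a /b /spherical_coef big_ord0.
by [].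
Qed.

Lemma spherical_function_radial x y : sqnorm x = sqnorm y ->
  spherical_function x = spherical_function y.
Proof. by rewrite /spherical_function /radial_entire => ->. Qed.

Let coef_rec j :
  ((2 * n%:R + 4 * j%:R) * pseries_diffs a j =
     (- complex.Re (lambda ^+ 2)) * a j + complex.Im (lambda ^+ 2) * b j) /\
  ((2 * n%:R + 4 * j%:R) * pseries_diffs b j =
     (- complex.Re (lambda ^+ 2)) * b j + (- complex.Im (lambda ^+ 2)) * a j).
Proof.
have := spherical_coefS j.
have -> : (((2 * j + 2) * (2 * j + n))%:R : R[i]) = (((2 * n%:R + 4 * j%:R) * j.+1%:R : R))%:C.
  rewrite -(natrM _ 2) -(natrM _ 4) -natrD -natrM rmorph_nat; congr (_%:R); lia.
rewrite /pseries_diffs; move: (lambda ^+ 2) => L H; split.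
  have := congr1 (@complex.Re R) H; rewrite !cReM cReN cImN /= mulr0 subr0.
  rewrite -/(a _) -/(a _) -/(b _); move: (complex.Re L) (complex.Im L) => Lr Li H1.
  transitivity (a j.+1 * ((2 * n%:R + 4 * j%:R) * j.+1%:R)); first by ring.
  by rewrite H1; ring.
have := congr1 (@complex.Im R) H; rewrite !cImM cReN cImN /= mulr0 add0r.
rewrite -/(b _) -/(a _) -/(b _); move: (complex.Re L) (complex.Im L) => Lr Li H1.
transitivity (b j.+1 * ((2 * n%:R + 4 * j%:R) * j.+1%:R)); first by ring.
exact: H1.
Qed.

Lemma eigen_spherical_function : eigen spherical_function.
Proof.
have reE : reF spherical_function = radial_entire a by [].
have imE : imF spherical_function = radial_entire b by [].
split=> [|x]; first by apply/smoothP; rewrite reE imE; split; exact: rsmooth_radial_entire.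
apply: complexP; rewrite ?Re_sum ?Im_sum.
  under eq_bigr do rewrite partialE/= reF_partial reE.
  rewrite laplace_radial_entire// cReM cReN cImN /radial_entire/=.
  rewrite (_ : (fun j => _) = (fun j => (- complex.Re (lambda ^+ 2)) * a j +
     complex.Im (lambda ^+ 2) * b j)); last by apply/funext => j; exact: (coef_rec j).1.
  rewrite entireD ?entireZ//; try exact: rapidZ.
  by rewrite [- complex.Im _ * _]mulNr opprK.
under eq_bigr do rewrite partialE/= imF_partial imE.
rewrite laplace_radial_entire// cImM cReN cImN /radial_entire/=.
rewrite (_ : (fun j => _) = (fun j => (- complex.Re (lambda ^+ 2)) * b j +
   (- complex.Im (lambda ^+ 2)) * a j)); last by apply/funext => j; exact: (coef_rec j).2.
by rewrite entireD ?entireZ//; exact: rapidZ.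
Qed.

(** An odd radial form vanishes; an even one is a multiple of a power of [|x|^2], and
    the eigenvalue equation determines the multiple from the preceding one.  Only
    orders below [M] are concerned, so that the lemma applies to limits of
    truncated jets. *)
Lemma radial_taylor_form (c : seq 'I_n -> R[i]) M : symmetric_jet c ->
  (forall t, (size t + 2 < M)%N -> \sum_i c [:: i, i & t] = - lambda ^+ 2 * c t) ->
  (forall m x y, (m < M)%N -> sqnorm x = sqnorm y -> taylor_form m c x = taylor_form m c y) ->
  forall j x, ((2 * j < M)%N -> taylor_form (2 * j) c x =
       c [::] * (2 * j)`!%:R * spherical_coef j * (sqnorm x ^+ j)%:C) /\
     ((2 * j + 1 < M)%N -> taylor_form (2 * j + 1) c x = 0).
Proof.
move=> sc ec rc j x; split; last first.
  move=> jM; have sx : sqnorm (- 1 *: x) = sqnorm x by rewrite sqnormZ sqrrN expr1n mul1r.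
  have := rc _ _ _ jM sx.
  have -> : taylor_form (2 * j + 1) c (- 1 *: x) = - taylor_form (2 * j + 1) c x.
    by rewrite taylor_form_scale addn1 exprS exprM sqrrN !expr1n mulr1 rmorphN1 mulN1r.
  by move/eqP; rewrite eq_sym -subr_eq0 opprK -mulr2n mulrn_eq0 => /eqP.
elim: j x => [|j IH] x jM.
  by rewrite muln0 /spherical_coef big_ord0 fact0 !mulr1.
pose e : E := ei (Ordinal n_gt0).
have sqe : sqnorm e = 1.
  rewrite /sqnorm (bigD1 (Ordinal n_gt0))//= big1 ?addr0 => [|k /negbTE kn].
    by rewrite mxE !eqxx expr1n.
  by rewrite mxE kn expr0n.
pose g := taylor_form (2 * j.+1) c e.
have Tg : taylor_form (2 * j.+1) c = sqmul j.+1 (fun=> g).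
  apply/funext => y; have -> := rc _ y (Num.sqrt (sqnorm y) *: e) jM.
    by rewrite taylor_form_scale exprM sqr_sqrtr ?sqnorm_ge0.
  by rewrite sqnormZ sqe mulr1 sqr_sqrtr ?sqnorm_ge0.
have L1 := laplace_sqnorm_pow j g e.
have E2 : (2 * j.+1 = (2 * j).+2)%N by lia.
have L2 : \sum_i partial i (partial i (taylor_form (2 * j.+1) c)) e =
    ((2 * j).+2 * (2 * j).+1)%:R * (- lambda ^+ 2 * taylor_form (2 * j) c e).
  rewrite E2 -taylor_formZ.
  rewrite (_ : taylor_form _ (fun s => _ * c s) e =
     \sum_i taylor_form (2 * j) (fun s => c [:: i, i & s]) e).
    rewrite mulr_sumr; apply: eq_bigr => i _.
    rewrite (partial_taylor_form _ i sc) (partialZ i _ (smooth_taylor_form _ _)).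
    by rewrite (partial_taylor_form _ i (symmetric_shift i sc)) natrM mulrA.
  rewrite -taylor_form_sum; apply: eq_taylor_form => s sj.
  by rewrite ec// sj; lia.
rewrite Tg L1 in L2; rewrite sqe expr1n mul1r in L2.
rewrite (IH e (ltn_trans _ jM)) in L2; last lia.
rewrite sqe expr1n mulr1 in L2.
have nz : (((2 * j + 2) * (2 * j + n))%:R : R[i]) != 0.
  by rewrite pnatr_eq0 -lt0n muln_gt0 !addn_gt0 n_gt0 !orbT.
have gE : g = c [::] * (2 * j.+1)`!%:R * spherical_coef j.+1.
  apply: (mulfI nz); rewrite L2.
  rewrite [in RHS]mulrC -[RHS]mulrA spherical_coefS E2 !factS !natrM; ring.
by rewrite Tg /sqmul gE mulrC.
Qed.

End SphericalFunction.

(** * An orthogonally invariant norm on jets *)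

Section JetNorm.
Variables (R : realType) (n : nat).
Local Notation E := 'cV[R]_n.
Implicit Types (c d : seq 'I_n -> R[i]) (x y : E) (f g : E -> R[i]).

(** Recursive in the same way as [taylor_form], so that the Cauchy--Schwarz inequality
    and the orthogonal invariance follow by induction on [m], one letter at a time. *)
Fixpoint jet_norm m c : R :=
  if m is m'.+1 then \sum_i jet_norm m' (fun s => c (i :: s)) else normc (c [::]) ^+ 2.
Arguments jet_norm : simpl never.

Lemma jet_normS m c : jet_norm m.+1 c = \sum_i jet_norm m (fun s => c (i :: s)).
Proof. by []. Qed.

Lemma jet_norm_ge0 m c : 0 <= jet_norm m c.
Proof. by elim: m c => [|m IH] c; [exact: sqr_ge0|apply: sumr_ge0]. Qed.

Lemma eq_jet_norm m c d : (forall s, size s = m -> c s = d s) -> jet_norm m c = jet_norm m d.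
Proof.
elim: m c d => [|m IH] c d cd; first by congr (normc _ ^+ 2); exact: cd.
by apply: eq_bigr => i _; apply: IH => s sm; apply: cd; rewrite /= sm.
Qed.

Lemma jet_norm_coef s c : normc (c s) ^+ 2 <= jet_norm (size s) c.
Proof.
elim: s c => [|i s IH] c; first exact: lexx.
rewrite [size _]/= jet_normS (bigD1 i)//=; apply: le_trans (IH (fun s => c (i :: s))) _.
by rewrite lerDl sumr_ge0// => j _; exact: jet_norm_ge0.
Qed.

Lemma jet_norm_le m c (B : R) : (forall s, size s = m -> normc (c s) <= B) ->
  jet_norm m c <= n%:R ^+ m * B ^+ 2.
Proof.
elim: m c => [|m IH] c cB.
  by rewrite expr0 mul1r lerXn2r ?nnegrE ?normc_ge0 ?cB// (le_trans (normc_ge0 _) (cB [::] erefl)).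
rewrite jet_normS exprS -mulrA mulr_natl -[X in _ *+ X](card_ord n) -sumr_const.
by apply: ler_sum => i _; apply: IH => s sm; apply: cB; rewrite /= sm.
Qed.

Lemma jet_norm_parallelogram m c d :
  jet_norm m (fun s => c s + d s) + jet_norm m (fun s => c s - d s) =
  (jet_norm m c + jet_norm m d) *+ 2.
Proof.
elim: m c d => [|m IH] c d.
  rewrite /jet_norm !normc_sqr !cReD !cImD cReN cImN; ring.
rewrite !jet_normS -!big_split/= -sumrMnl; apply: eq_bigr => i _; exact: IH.
Qed.

Lemma jet_normZ m (a : R[i]) c : jet_norm m (fun s => a * c s) = normc a ^+ 2 * jet_norm m c.
Proof.
elim: m c => [|m IH] c; first by rewrite /jet_norm normcM exprMn.
by rewrite !jet_normS mulr_sumr; apply: eq_bigr => i _; exact: IH.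
Qed.

Lemma cauchy_schwarz (p q : 'I_n -> R) :
  (\sum_i p i * q i) ^+ 2 <= (\sum_i p i ^+ 2) * (\sum_i q i ^+ 2).
Proof.
have : 0 <= \sum_i \sum_j (p i * q j - p j * q i) ^+ 2.
  by do 2 (apply: sumr_ge0 => ? _); exact: sqr_ge0.
have -> : \sum_i \sum_j (p i * q j - p j * q i) ^+ 2 =
    ((\sum_i p i ^+ 2) * (\sum_i q i ^+ 2) - (\sum_i p i * q i) ^+ 2) *+ 2.
  rewrite mulr2n -{1}[X in _ - X]opprK.
  have E1 : \sum_i \sum_j p i ^+ 2 * q j ^+ 2 = (\sum_i p i ^+ 2) * (\sum_i q i ^+ 2).
    by rewrite mulr_suml; apply: eq_bigr => i _; rewrite mulr_sumr.
  have E2 : \sum_i \sum_j p j ^+ 2 * q i ^+ 2 = (\sum_i p i ^+ 2) * (\sum_i q i ^+ 2).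
    by rewrite exchange_big.
  have E3 : \sum_i \sum_j (p i * q i) * (p j * q j) = (\sum_i p i * q i) ^+ 2.
    by rewrite expr2 mulr_suml; apply: eq_bigr => i _; rewrite mulr_sumr.
  transitivity (\sum_i \sum_j p i ^+ 2 * q j ^+ 2 + \sum_i \sum_j p j ^+ 2 * q i ^+ 2
     - 2 * \sum_i \sum_j (p i * q i) * (p j * q j)).
    rewrite mulr_sumr -big_split -sumrB; apply: eq_bigr => i _ /=.
    rewrite mulr_sumr -big_split -sumrB; apply: eq_bigr => j _ /=; ring.
  by rewrite E1 E2 E3; ring.
by rewrite pmulrn_lge0// subr_ge0.
Qed.

(** Cauchy--Schwarz in each letter. *)
Lemma taylor_form_jet_norm m c x :
  normc (taylor_form m c x) ^+ 2 <= jet_norm m c * sqnorm x ^+ m.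
Proof.
elim: m c => [|m IH] c; first by rewrite expr0 mulr1.
rewrite taylor_formS jet_normS.
apply: (@le_trans _ _ ((\sum_i x i 0 * (Num.sg (x i 0) *
   normc (taylor_form m (fun s => c (i :: s)) x))) ^+ 2)).
  rewrite lerXn2r ?nnegrE ?normc_ge0//.
    apply: sumr_ge0 => i _; rewrite mulrA [_ * Num.sg _]mulrC -normrEsg.
    by rewrite mulr_ge0// normc_ge0.
  apply: le_trans (normc_sum _ _ _) _; apply: ler_sum => i _.
  by rewrite normcM normcR mulrA [_ * Num.sg _]mulrC -normrEsg.
apply: le_trans (cauchy_schwarz _ _) _.
rewrite exprS mulrCA -/(sqnorm x) ler_wpM2l ?sqnorm_ge0//.
rewrite mulr_suml; apply: ler_sum => i _; apply: le_trans (IH _).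
rewrite exprMn ler_piMl ?sqr_ge0// -real_normK ?num_real// normr_sg.
by case: (_ == _); rewrite ?expr1n ?expr0n.
Qed.

Let orth_sum (k : 'M[R]_n) (p : 'I_n -> R) : k *m k^T = 1%:M ->
  \sum_i (\sum_j k j i * p j) ^+ 2 = \sum_j p j ^+ 2.
Proof.
move=> kk; pose v : E := \col_j p j.
have E1 (u : E) : (u^T *m u) 0 0 = \sum_j u j 0 ^+ 2.
  by rewrite mxE; apply: eq_bigr => j _; rewrite mxE expr2.
transitivity (((k^T *m v)^T *m (k^T *m v)) 0 0).
  rewrite E1; apply: eq_bigr => i _; rewrite mxE; congr (_ ^+ 2).
  by apply: eq_bigr => j _; rewrite !mxE.
rewrite trmx_mul trmxK mulmxA -[v^T *m k *m k^T]mulmxA kk mulmx1 E1.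
by apply: eq_bigr => j _; rewrite mxE.
Qed.

(** An orthogonal matrix applied in one letter preserves the sum of squares. *)
Let jet_norm_orth m (k : 'M[R]_n) (c : 'I_n -> seq 'I_n -> R[i]) : k *m k^T = 1%:M ->
  \sum_i jet_norm m (fun s => \sum_j (k j i)%:C * c j s) = \sum_j jet_norm m (c j).
Proof.
move=> kk; elim: m c => [|m IH] c.
  rewrite /jet_norm; under eq_bigr => i _ do rewrite normc_sqr Re_sum Im_sum.
  under [RHS]eq_bigr => i _ do rewrite normc_sqr.
  rewrite !big_split -(orth_sum (fun j => complex.Re (c j [::])) kk).
  rewrite -(orth_sum (fun j => complex.Im (c j [::])) kk).
  congr (_ + _); apply: eq_bigr => i _; congr (_ ^+ 2); apply: eq_bigr => j _.
    by rewrite cReM mul0r subr0.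
  by rewrite cImM mul0r addr0.
under eq_bigr => i _ do rewrite jet_normS.
rewrite exchange_big; under [RHS]eq_bigr => i _ do rewrite jet_normS.
rewrite [RHS]exchange_big; apply: eq_bigr => l _.
exact: (IH (fun j s => c j (l :: s))).
Qed.

(** The chain rule applies the orthogonal matrix [k] in each letter of the jet. *)
Lemma jet_norm_orthogonal m (k : 'M[R]_n) f : k *m k^T = 1%:M -> smooth f ->
  smooth (fun x => f (k *m x)) ->
  jet_norm m (jet (fun x => f (k *m x)) 0) = jet_norm m (jet f 0).
Proof.
move=> kk; elim: m f => [|m IH] f sf sfk; first by rewrite /jet_norm /jet /= mulmx0.
have pk i : partial i (fun x => f (k *m x)) =
    fun x => (fun z => \sum_j (k j i)%:C * partial j f z) (k *m x).
  have -> : (fun x => f (k *m x)) = (fun x => f (k *m x + 0)).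
    by apply/funext => x; rewrite addr0.
  by rewrite (partial_linear k 0 i sf); apply/funext => x; rewrite addr0.
have sg i : smooth (fun z => \sum_j (k j i)%:C * partial j f z).
  by apply: smooth_sum => j _; apply: smoothZ; exact: smooth_partial.
have sgk i : smooth (fun x => (fun z => \sum_j (k j i)%:C * partial j f z) (k *m x)).
  by rewrite -pk; exact: (smooth_partial i sfk).
rewrite !jet_normS.
transitivity (\sum_i jet_norm m (jet (fun z => \sum_j (k j i)%:C * partial j f z) 0)).
  apply: eq_bigr => i _; rewrite -(IH _ (sg i) (sgk i)).
  by apply: eq_jet_norm => s _; rewrite -(jet_partial _ _ _ sfk) pk.
transitivity (\sum_j jet_norm m (jet (partial j f) 0)); last first.
  by apply: eq_bigr => j _; apply: eq_jet_norm => s _; rewrite jet_partial.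
transitivity (\sum_i jet_norm m (fun s => \sum_j (k j i)%:C * jet (partial j f) 0 s)).
  apply: eq_bigr => i _; apply: eq_jet_norm => s _; rewrite /jet.
  rewrite partials_sum => [|j _]; last exact/smoothZ/smooth_partial.
  by apply: eq_bigr => j _; rewrite (partialsZ s _ (smooth_partial j sf)).
exact: (jet_norm_orth m (fun j => jet (partial j f) 0) kk).
Qed.

End JetNorm.

(** * Closed invariant spaces of eigenfunctions *)

Lemma exists_pow2 (R : realType) (B e : R) : 0 <= B -> 0 < e -> exists N : nat, B / 2 ^+ N <= e.
Proof.
move=> B0 e0; exists (Num.bound (B / e)).
rewrite ler_pdivrMr ?exprn_gt0// mulrC -ler_pdivrMr//.
apply: le_trans (_ : (Num.bound (B / e))%:R <= _).
  by rewrite ltW// archi_boundP// divr_ge0// ltW.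
by rewrite -natrX ler_nat ltnW// ltn_expl.
Qed.

Section LimitJet.
Variables (R : realType) (n : nat).
Local Notation E := 'cV[R]_n.
Implicit Types (c d : seq 'I_n -> R[i]).

Lemma taylor_form_close m c d (x : E) (r : R) :
  (forall s, size s = m -> normc (c s - d s) <= r) ->
  normc (taylor_form m c x - taylor_form m d x) <= (\sum_i `|x i 0|) ^+ m * r.
Proof.
move=> cd; rewrite -mulN1r -taylor_formZ -taylor_formD.
by apply: taylor_form_bound => s sm; rewrite mulN1r; exact: cd.
Qed.

(** The limit is the supremum of the lower bounds [a j - 2 ^ (- j)]. *)
Lemma real_geometric_limit (a : nat -> R) :
  (forall j l, (j <= l)%N -> `|a l - a j| <= 1 / 2 ^+ j) ->
  exists b, forall j, `|b - a j| <= 1 / 2 ^+ j.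
Proof.
move=> ha.
pose sup_set := [set z | exists j, z = a j - 1 / 2 ^+ j].
have s0 : sup_set !=set0 by exists (a 0%N - 1 / 2 ^+ 0); exists 0%N.
have ub j : ubound sup_set (a j + 1 / 2 ^+ j).
  move=> _ [l ->].
  have p k : 0 < 1 / 2 ^+ k :> R by rewrite divr_gt0// exprn_gt0.
  have pj := p j; have pl := p l.
  have [jl|lj] := leqP j l.
    by have := ha j l jl; rewrite ler_norml; lra.
  by have := ha l j (ltnW lj); rewrite ler_norml; lra.
exists (sup sup_set) => j; rewrite ler_norml; apply/andP; split.
  have : a j - 1 / 2 ^+ j <= sup sup_set.
    by apply: sup_upper_bound; [split => //; exists (a 0%N + 1 / 2 ^+ 0); exact: ub|exists j].
  by lra.
have : sup sup_set <= a j + 1 / 2 ^+ j by apply: ge_sup => //; exact: ub.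
by lra.
Qed.

Lemma eq0_of_geometric (z : R[i]) (B : R) : (forall j, normc z <= B / 2 ^+ j) -> z = 0.
Proof.
move=> zB; apply: eq0_normc; apply/eqP; rewrite eq_le normc_ge0 andbT.
apply/ler_addgt0Pr => e e0; rewrite add0r.
have B0 : 0 <= B by have := zB 0%N; rewrite divr1; apply: le_trans; exact: normc_ge0.
by have [j] := exists_pow2 B0 e0; exact: le_trans (zB j).
Qed.

Lemma limit_jet (c : nat -> seq 'I_n -> R[i]) M :
  (forall j l s, (j <= l)%N -> (size s < M)%N -> normc (c l s - c j s) <= 1 / 2 ^+ j) ->
  exists d, (forall j s, (size s < M)%N -> normc (d s - c j s) <= 2 / 2 ^+ j) /\
    (forall s, (M <= size s)%N -> d s = 0).
Proof.
move=> hc.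
have lim s : exists z, ((size s < M)%N -> forall j, normc (z - c j s) <= 2 / 2 ^+ j) /\
    ((M <= size s)%N -> z = 0).
  have [sM|Ms] := ltnP (size s) M; last by exists 0; split.
  have [|a ha] := @real_geometric_limit (fun j => complex.Re (c j s)).
    move=> j l jl; have -> : complex.Re (c l s) - complex.Re (c j s) = complex.Re (c l s - c j s).
      by rewrite cReD cReN.
    by apply: le_trans (Re_le_normc _) _; exact: hc.
  have [|b hb] := @real_geometric_limit (fun j => complex.Im (c j s)).
    move=> j l jl; have -> : complex.Im (c l s) - complex.Im (c j s) = complex.Im (c l s - c j s).
      by rewrite cImD cImN.
    by apply: le_trans (Im_le_normc _) _; exact: hc.
  exists (a +i* b); split=> // _ j; apply: le_trans (normc_le_ReIm _) _.
  rewrite cReD cReN cImD cImN /=.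
  have -> : 2 / 2 ^+ j = 1 / 2 ^+ j + 1 / 2 ^+ j :> R by rewrite -mulrDl.
  exact: lerD.
have [d hd] := choice lim.
by exists d; split=> [j s sM|s Ms]; [exact: (hd s).1|exact: (hd s).2].
Qed.

End LimitJet.

Section InvariantSpace.
Variables (R : realType) (n : nat) (lambda : R[i]) (K : set 'M[R]_n).
Local Notation E := 'cV[R]_n.
Local Notation ei i := (delta_mx i 0 : E).
Local Notation eigen := (@eigenfunction R n lambda).
Hypothesis n_gt0 : (0 < n)%N.
Hypothesis K_orthogonal : forall k, K k -> k *m k^T = 1%:M.
Hypothesis K1 : K 1%:M.
Hypothesis K_transitive : forall x y : E, sqnorm x = sqnorm y -> exists2 k, K k & k *m x = y.

Variable V : (E -> R[i]) -> Prop.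
Hypothesis V_eigen : forall f, V f -> eigen f.
Hypothesis V_add : forall f g, V f -> V g -> V (fun x => f x + g x).
Hypothesis V_scale : forall (a : R[i]) f, V f -> V (fun x => a * f x).
Hypothesis V_motion : forall k v f, K k -> V f -> V (fun x => f (k *m x + v)).
(** Closedness needs only locally uniform approximation, without derivatives; see
    [closed_eigenspace]. *)
Hypothesis V_closed : forall f, eigen f ->
  (forall rho e : R, 0 < rho -> 0 < e ->
     exists2 g, V g & forall x, `|x| <= rho -> normc (f x - g x) <= e) -> V f.

Lemma V_smooth f : V f -> smooth f.
Proof. by move=> /V_eigen[]. Qed.

Lemma V_rotate k f : K k -> V f -> V (fun x => f (k *m x)).
Proof.
by move=> Kk Vf; have := V_motion 0 Kk Vf; under eq_fun do rewrite addr0.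
Qed.

Lemma V_translate v f : V f -> V (fun x => f (x + v)).
Proof.
by move=> Vf; have := V_motion v K1 Vf; under eq_fun do rewrite mul1mx.
Qed.

Lemma V_partial i f : V f -> V (partial i f).
Proof.
move=> Vf; have ef := V_eigen Vf; apply: V_closed; first exact: eigen_partial.
move=> rho e rho0 e0; have [h h0 H] := difference_quotient i (eigen_smooth ef) e0 (ltW rho0).
exists (fun x => (h^-1)%:C * (f (x + h *: ei i) + (-1) * f x)) => [|x xr].
  by apply: V_scale; apply: V_add; [exact: V_translate|exact: V_scale].
by rewrite mulN1r; exact: H.
Qed.

(** * The spherical function belongs to the invariant space *)

Section Minimisation.
Variable w : E -> R[i].
Hypotheses (Vw : V w) (w1 : w 0 = 1).

(** The competitors for the minimisation.  The bounds by the jet of [w] make their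
    Taylor tails uniformly small, and survive rotations and midpoints. *)
Let U u := [/\ V u, u 0 = 1 &
  forall m, jet_norm m (jet u 0) <= jet_norm m (jet w 0)].

Let U_rotate k u : K k -> U u -> U (fun x => u (k *m x)).
Proof.
move=> Kk [Vu u1 uw]; split=> [||m]; first exact: V_rotate.
  by rewrite mulmx0.
by rewrite jet_norm_orthogonal ?uw//; [exact: K_orthogonal|exact: V_smooth|
  apply: V_smooth; exact: V_rotate].
Qed.

Let midpoint (u v : E -> R[i]) x := 2^-1 * (u x + v x).

Let jet_midpoint u v s : smooth u -> smooth v ->
  jet (midpoint u v) 0 s = 2^-1 * (jet u 0 s + jet v 0 s).
Proof.
move=> su sv; rewrite /jet /midpoint (partialsZ s _ (smoothD su sv)).
by rewrite (partialsD s su sv).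
Qed.

Let normc_half : normc (2^-1 : R[i]) ^+ 2 = 4^-1.
Proof.
have -> : (2^-1 : R[i]) = (2^-1 : R)%:C by rewrite fmorphV rmorph_nat.
by rewrite normcR ger0_norm ?invr_ge0//; field.
Qed.

Let jet_norm_midpoint m u v : smooth u -> smooth v ->
  jet_norm m (fun s => jet u 0 s - jet v 0 s) =
  (jet_norm m (jet u 0) + jet_norm m (jet v 0)) *+ 2 - 4 * jet_norm m (jet (midpoint u v) 0).
Proof.
move=> su sv; rewrite -jet_norm_parallelogram.
have -> : jet_norm m (jet (midpoint u v) 0) = 4^-1 * jet_norm m (fun s => jet u 0 s + jet v 0 s).
  rewrite -normc_half -jet_normZ; apply: eq_jet_norm => s _; exact: jet_midpoint.
by rewrite mulrA mulfV// mul1r; ring.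
Qed.

Let U_midpoint u v : U u -> U v -> U (midpoint u v).
Proof.
move=> [Vu u1 uw] [Vv v1 vw]; split=> [||m]; first by apply: V_scale; exact: V_add.
  by rewrite /midpoint u1 v1 -mulr2n -[1 *+ 2]/(2 : R[i]) mulVf// pnatr_eq0.
have := jet_norm_midpoint m (V_smooth Vu) (V_smooth Vv).
have := jet_norm_ge0 m (fun s => jet u 0 s - jet v 0 s).
have := uw m; have := vw m; lra.
Qed.

Let total M (u : E -> R[i]) : R := \sum_(m < M) jet_norm m (jet u 0).

Let near_minimal M : exists c : R, (forall u, U u -> c <= total M u) /\
  forall e, 0 < e -> exists2 u, U u & total M u <= c + e.
Proof.
pose S := [set z | exists2 u, U u & z = total M u].
have Sw : S (total M w) by exists w.
have lb : lbound S 0.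
  by move=> _ [u _ ->]; apply: sumr_ge0 => m _; exact: jet_norm_ge0.
have hS : has_inf S by split; [exists (total M w)|exists 0].
exists (inf S); split=> [u Uu|e e0].
  by apply: ge_inf; [exists 0|exists u].
have [_ [u Uu ->] h] := inf_adherent e0 hS.
by exists u => //; exact: ltW.
Qed.

(** By the parallelogram law two near-minimisers are close to each other, as their
    midpoint is a competitor too. *)
Let close_minimizers M (c e : R) u v : (forall u, U u -> c <= total M u) ->
  U u -> U v -> total M u <= c + e -> total M v <= c + e ->
  forall s, (size s < M)%N -> normc (jet u 0 s - jet v 0 s) ^+ 2 <= 4 * e.
Proof.
move=> cmin Uu Uv ue ve s sM.
have [Vu _ _] := Uu; have [Vv _ _] := Uv.
apply: le_trans (jet_norm_coef s (fun s => jet u 0 s - jet v 0 s)) _.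
apply: (@le_trans _ _ (\sum_(m < M) jet_norm m (fun s => jet u 0 s - jet v 0 s))).
  by rewrite (bigD1 (Ordinal sM))//= lerDl sumr_ge0// => m _; exact: jet_norm_ge0.
under eq_bigr do rewrite (jet_norm_midpoint _ (V_smooth Vu) (V_smooth Vv)).
rewrite sumrB sumrMnl big_split/= -mulr_sumr -/(total M u) -/(total M v) -/(total M (midpoint u v)).
by have := cmin _ (U_midpoint Uu Uv); lra.
Qed.

(** The jets of a minimising sequence converge below order [M].  The limit [d] is
    symmetric and satisfies the eigenvalue equation.  It is [K]-invariant because
    rotating a near-minimiser gives a near-minimiser, which is close to it; so the
    limit is radial, and coincides with the jet of the spherical function. *)
Let jets_close M : exists u : nat -> E -> R[i], (forall j, U (u j)) /\
  forall j m x, (m < M)%N ->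
    normc (taylor_form m (jet (u j) 0) x -
           taylor_form m (jet (@spherical_function R n lambda) 0) x) <=
    (\sum_i `|x i 0|) ^+ m * (2 / 2 ^+ j).
Proof.
have [c [cmin capp]] := near_minimal M.
(* excess [4 ^ (- j) / 4], so that by [close_minimizers] jets differ by [2 ^ (- j)] *)
have pos j : 0 < 1 / (4 * 4 ^+ j) :> R by rewrite divr_gt0// mulr_gt0// exprn_gt0.
have ex j : exists u, U u /\ total M u <= c + 1 / (4 * 4 ^+ j).
  by have [u Uu h] := capp _ (pos j); exists u.
have [u hu] := choice ex; have Uu j : U (u j) := (hu j).1.
have eps_mono j l : (j <= l)%N -> 1 / (4 * 4 ^+ l) <= 1 / (4 * 4 ^+ j) :> R.
  move=> jl; rewrite !mul1r lef_pV2 ?posrE ?mulr_gt0 ?exprn_gt0// ler_pM2l//.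
  by rewrite ler_weXn2l// ler1n.
have sq_small j (z : R[i]) : normc z ^+ 2 <= 4 * (1 / (4 * 4 ^+ j)) -> normc z <= 1 / 2 ^+ j.
  move=> h; rewrite -(@ler_pXn2r _ 2)// ?nnegrE ?normc_ge0 ?divr_ge0 ?exprn_ge0//.
  apply: le_trans h _; rewrite expr_div_n expr1n -exprM mulnC exprM.
  have -> : (2 : R) ^+ 2 = 4 by rewrite -natrX.
  by rewrite !div1r invfM mulrA mulfV// mul1r.
have cauchy j l s : (j <= l)%N -> (size s < M)%N ->
    normc (jet (u l) 0 s - jet (u j) 0 s) <= 1 / 2 ^+ j.
  move=> jl sM; apply: sq_small; apply: (close_minimizers cmin) => //.
    by apply: le_trans (hu l).2 _; rewrite lerD2l eps_mono.
  exact: (hu j).2.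
have [d [hd d0]] := limit_jet cauchy.
have d_lim s z : (size s < M)%N -> (forall j, jet (u j) 0 s = z) -> d s = z.
  move=> sM uz; apply/eqP; rewrite -subr_eq0; apply/eqP; apply: (@eq0_of_geometric _ _ 2) => j.
  by rewrite -(uz j) hd.
have su j : smooth (u j) by have [Vu _ _] := Uu j; exact: V_smooth.
have d_sym : symmetric_jet d.
  move=> s i j t; have [sM|Ms] := ltnP (size (s ++ i :: j :: t)) M; last first.
    by rewrite (d0 _ Ms) d0//; move: Ms; rewrite !size_cat.
  apply/eqP; rewrite -subr_eq0; apply/eqP; apply: (@eq0_of_geometric _ _ 4) => l.
  have h1 := hd l _ sM.
  have h2 : normc (d (s ++ j :: i :: t) - jet (u l) 0 (s ++ j :: i :: t)) <= 2 / 2 ^+ l.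
    by apply: hd; move: sM; rewrite !size_cat.
  have e := symmetric_jet_smooth 0 (su l) s i j t.
  rewrite -(subrKA (jet (u l) 0 (s ++ i :: j :: t))) {2}e.
  apply: le_trans (le_normcD _ _) _.
  have -> : 4 / 2 ^+ l = 2 / 2 ^+ l + 2 / 2 ^+ l :> R by rewrite -mulrDl; congr (_ / _); ring.
  by rewrite lerD// -normcN opprB.
have d_eigen (t : seq 'I_n) : (size t + 2 < M)%N -> \sum_i d [:: i, i & t] = - lambda ^+ 2 * d t.
  move=> tM; apply/eqP; rewrite -subr_eq0; apply/eqP.
  pose B := \sum_(i < n) 2 + normc (- lambda ^+ 2) * 2 : R.
  apply: (@eq0_of_geometric _ _ B) => l.
  have L : \sum_i jet (u l) 0 [:: i, i & t] - (- lambda ^+ 2) * jet (u l) 0 t = 0.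
    have [Vu _ _] := Uu l; have [_ Lu] := eigen_partials t (V_eigen Vu).
    by apply/eqP; rewrite subr_eq0; apply/eqP; exact: Lu.
  have -> : \sum_i d [:: i, i & t] - - lambda ^+ 2 * d t =
     \sum_i (d [:: i, i & t] - jet (u l) 0 [:: i, i & t]) -
       - lambda ^+ 2 * (d t - jet (u l) 0 t).
    rewrite sumrB mulrBr; move/eqP: L; rewrite subr_eq0 => /eqP ->; ring.
  apply: le_trans (le_normcD _ _) _; rewrite normcN normcM /B mulrDl; apply: lerD.
    apply: le_trans (normc_sum _ _ _) _; rewrite mulr_suml; apply: ler_sum => i _.
    by apply: hd; rewrite addn2 in tM.
  rewrite -mulrA ler_wpM2l ?normc_ge0// hd//.
  by apply: leq_ltn_trans tM; exact: leq_addr.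
have d_radial m x y : (m < M)%N -> sqnorm x = sqnorm y -> taylor_form m d x = taylor_form m d y.
  move=> mM xy; have [k Kk kx] := K_transitive xy.
  apply/eqP; rewrite -subr_eq0; apply/eqP.
  pose B := (\sum_i `|x i 0|) ^+ m * 2 + (\sum_i `|x i 0|) ^+ m * 1 +
    (\sum_i `|y i 0|) ^+ m * 2 : R.
  apply: (@eq0_of_geometric _ _ B) => l.
  have Vk : U (fun z => u l (k *m z)) by exact: U_rotate.
  have svk : smooth (fun z => u l (k *m z)) by have [Vu _ _] := Vk; exact: V_smooth.
  have T1 : taylor_form m (jet (u l) 0) y = taylor_form m (jet (fun z => u l (k *m z)) 0) x.
    apply: taylor_form_congr => // t; by rewrite -scalemxAr kx.
  have close z : normc (taylor_form m d z - taylor_form m (jet (u l) 0) z) <=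
      (\sum_i `|z i 0|) ^+ m * (2 / 2 ^+ l).
    by apply: taylor_form_close => s sm; apply: hd; rewrite sm.
  have closek : normc (taylor_form m (jet (u l) 0) x -
      taylor_form m (jet (fun z => u l (k *m z)) 0) x) <= (\sum_i `|x i 0|) ^+ m * (1 / 2 ^+ l).
    apply: taylor_form_close => s sm; apply: sq_small.
    apply: (close_minimizers cmin) => //; [exact: (hu l).2| |by rewrite sm].
    have -> : total M (fun z => u l (k *m z)) = total M (u l); last exact: (hu l).2.
    by apply: eq_bigr => i _; rewrite jet_norm_orthogonal//; exact: K_orthogonal.
  have close_y := close y; rewrite -normcN opprB in close_y.
  rewrite -T1 in closek; rewrite /B 2!mulrDl -!mulrA.
  have -> : taylor_form m d x - taylor_form m d y =
      (taylor_form m d x - taylor_form m (jet (u l) 0) x) +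
      (taylor_form m (jet (u l) 0) x - taylor_form m (jet (u l) 0) y) +
      (taylor_form m (jet (u l) 0) y - taylor_form m d y) by ring.
  apply: le_trans (le_normcD _ _) _; apply: lerD close_y.
  by apply: le_trans (le_normcD _ _) _; exact: lerD (close x) closek.
have phi_eigen := eigen_spherical_function lambda n_gt0.
have phi_smooth := eigen_smooth phi_eigen.
have phi_sym := symmetric_jet_smooth 0 phi_smooth.
have phi_lap (t : seq 'I_n) : (size t + 2 < M)%N ->
    \sum_i jet (@spherical_function R n lambda) 0 [:: i, i & t] =
    - lambda ^+ 2 * jet (@spherical_function R n lambda) 0 t.
  by move=> _; have [_ Lu] := eigen_partials t phi_eigen; exact: Lu.
have phi_radial m x y : (m < M)%N -> sqnorm x = sqnorm y ->
    taylor_form m (jet (@spherical_function R n lambda) 0) x =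
    taylor_form m (jet (@spherical_function R n lambda) 0) y.
  move=> _ xy; apply: taylor_form_congr => // t.
  by apply: spherical_function_radial; rewrite !sqnormZ xy.
have d_phi m x : (m < M)%N ->
    taylor_form m d x = taylor_form m (jet (@spherical_function R n lambda) 0) x.
  move=> mM.
  have [ev od] := radial_taylor_form n_gt0 d_sym d_eigen d_radial (m./2) x.
  have [ev' od'] := radial_taylor_form n_gt0 phi_sym phi_lap phi_radial (m./2) x.
  have M0 : (0 < M)%N by apply: leq_ltn_trans mM.
  have d1 : d [::] = 1.
    by apply: d_lim => // j; have [_ u1 _] := Uu j.
  have phi1 : jet (@spherical_function R n lambda) 0 [::] = 1.
    exact: spherical_function0.
  have [om|em] := boolP (odd m).
    have mE : (m = 2 * m./2 + 1)%N by rewrite -{1}(odd_double_half m) om; lia.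
    by rewrite -mE in od od'; rewrite od// od'.
  have mE : (m = 2 * m./2)%N by rewrite -{1}(odd_double_half m) (negbTE em); lia.
  by rewrite -mE in ev ev'; rewrite ev// ev'// d1 phi1.
exists u; split=> [j|j m x mM]; first exact: Uu.
rewrite -d_phi// -normcN opprB; apply: taylor_form_close => s sm.
by apply: hd; rewrite sm.
Qed.

(** The proof of [eigen_taylor] with constants depending on the jet norms of [w]
    only. *)
Let U_taylor (rho : R) : 0 < rho -> exists2 B : R, 0 < B & forall u m x, U u -> `|x| <= rho ->
   normc (u x - \sum_(k < m) taylor_part k u x) <= B / 2 ^+ m.
Proof.
move=> rho0; pose rho' := n%:R * rho *+ 2 + rho.
have nr0 : 0 <= n%:R * rho by rewrite mulr_ge0// ltW.
have rho'0 : 0 < rho' by rewrite ltr_wpDl// mulrn_wge0.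
have [B0 B00 HB] := eigen_partials_factorial (V_eigen Vw) rho'0.
pose B := B0 *+ 2; have B_gt0 : 0 < B by rewrite pmulrn_lgt0.
have nz m : 0 <= n%:R ^+ m :> R by rewrite exprn_ge0.
have wbound m : jet_norm m (jet w 0) <= n%:R ^+ m * (B * m`!%:R / rho' ^+ m) ^+ 2.
  apply: jet_norm_le => s sm; have [|h1 h2] := HB s 0; first by rewrite normr0 ltW.
  rewrite sm in h1 h2; apply: le_trans (normc_le_ReIm _) _.
  by rewrite /B mulrnAl mulrnAl mulr2n lerD.
have part_bound u m x : U u -> `|x| <= rho -> normc (taylor_part m u x) <= B / 2 ^+ m.
  move=> [Vu u1 uw] xr.
  have m0 : (0 : R) < m`!%:R by rewrite ltr0n fact_gt0.
  have sx := sqnorm_le xr.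
  have h : normc (taylor_form m (jet u 0) x) <= B * m`!%:R / 2 ^+ m.
    have rhs0 : 0 <= B * m`!%:R / 2 ^+ m.
      by rewrite divr_ge0 ?exprn_ge0// mulr_ge0 ?(ltW m0)// ltW.
    suff sq : normc (taylor_form m (jet u 0) x) ^+ 2 <= (B * m`!%:R / 2 ^+ m) ^+ 2.
      by move: sq; rewrite ler_pXn2r ?nnegrE ?normc_ge0.
    apply: le_trans (taylor_form_jet_norm _ _ _) _.
    apply: (@le_trans _ _ (n%:R ^+ m * (B * m`!%:R / rho' ^+ m) ^+ 2 * (n%:R * rho ^+ 2) ^+ m)).
      apply: ler_pM; [exact: jet_norm_ge0|by rewrite exprn_ge0// sqnorm_ge0| |].
        by apply: le_trans (uw m) (wbound m).
      apply: lerXn2r => //; rewrite nnegrE ?sqnorm_ge0//.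
      by apply: le_trans sx; exact: sqnorm_ge0.
    have -> : n%:R ^+ m * (B * m`!%:R / rho' ^+ m) ^+ 2 * (n%:R * rho ^+ 2) ^+ m =
        (B * m`!%:R * (n%:R * rho / rho') ^+ m) ^+ 2.
      have e2 : (rho ^+ 2) ^+ m = (rho ^+ m) ^+ 2 by rewrite -!exprM mulnC.
      rewrite [(n%:R * rho ^+ 2) ^+ m]exprMn e2
        [(n%:R * rho / rho') ^+ m]expr_div_n [(n%:R * rho) ^+ m]exprMn; field.
      by rewrite expf_neq0// gt_eqF.
    rewrite lerXn2r ?nnegrE ?mulr_ge0 ?exprn_ge0 ?divr_ge0 ?(ltW m0) ?(ltW B_gt0) ?(ltW rho'0)//.
    rewrite ler_wpM2l ?mulr_ge0 ?(ltW m0) ?(ltW B_gt0)// -exprVn.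
    apply: lerXn2r; rewrite ?nnegrE ?divr_ge0 ?(ltW rho'0)//.
    rewrite ler_pdivrMr// /rho' -mulr_natr; move: rho0 nr0; lra.
  rewrite /taylor_part normcM normcV normc_natr.
  by rewrite ler_pdivrMr// mulrAC.
exists (B *+ 2) => [|u m x Uu xr]; first by rewrite pmulrn_lgt0.
have [Vu _ _] := Uu; have [Bu Bu0 hu] := eigen_taylor (V_eigen Vu) rho0.
have geom N : \sum_(i < N) (B / 2 ^+ (m + i)) <= B *+ 2 / 2 ^+ m.
  have -> : \sum_(i < N) (B / 2 ^+ (m + i)) = B / 2 ^+ m * (2 - 2 / 2 ^+ N).
    elim: N => [|N IH]; first by rewrite big_ord0 divr1 subrr mulr0.
    by rewrite big_ord_recr/= IH exprS exprD; field; rewrite !expf_neq0.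
  have -> : B *+ 2 / 2 ^+ m = B / 2 ^+ m * 2 by rewrite mulrnAl mulr_natr.
  rewrite ler_wpM2l ?divr_ge0 ?exprn_ge0 ?(ltW B_gt0)//.
  by rewrite lerBlDr lerDl divr_ge0 ?exprn_ge0.
apply/ler_addgt0Pr => e e0.
have [N hBu] := exists_pow2 (ltW Bu0) e0.
have [_ hN] := hu (m + N)%N x xr.
have -> : u x - \sum_(k < m) taylor_part k u x =
   u x - \sum_(k < m + N) taylor_part k u x + \sum_(i < N) taylor_part (m + i)%N u x.
  by rewrite big_split_ord/=; ring.
apply: le_trans (le_normcD _ _) _; rewrite addrC; apply: lerD.
  apply: le_trans (normc_sum _ _ _) _; apply: le_trans (geom N).
  by apply: ler_sum => i _; exact: part_bound.
apply: le_trans hN (le_trans _ hBu); rewrite ler_wpM2l ?(ltW Bu0)//.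
by rewrite lef_pV2 ?posrE ?exprn_gt0// ler_weXn2l ?ler1n// leq_addl.
Qed.

Lemma spherical_in_V_of : V (@spherical_function R n lambda).
Proof.
have ephi := eigen_spherical_function lambda n_gt0.
apply: V_closed => // rho e rho0 e0.
have [B B0 HB] := U_taylor rho0; have [Bp Bp0 HBp] := eigen_taylor ephi rho0.
have e2 : 0 < e / 2 by rewrite divr_gt0.
(* first cut both Taylor series at a common order, then let the jets converge *)
have [M hM] := exists_pow2 (ltW (addr_gt0 B0 Bp0)) e2.
have [u [Uu uclose]] := jets_close M.
pose S := \sum_(m < M) (n%:R * rho) ^+ m * 2 : R.
have nr0 : 0 <= n%:R * rho by rewrite mulr_ge0// ltW.
have S0 : 0 <= S by apply: sumr_ge0 => m _; rewrite mulr_ge0// exprn_ge0.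
have [j hj] := exists_pow2 S0 e2.
have [Vu _ _] := Uu j; exists (u j) => // x xr.
have Sx := sum_coord_le xr.
have Sx0 : 0 <= \sum_i `|x i 0| by apply: sumr_ge0.
set phi := spherical_function lambda.
have -> : phi x - u j x = (phi x - \sum_(m < M) taylor_part m phi x) +
   (- (u j x - \sum_(m < M) taylor_part m (u j) x) +
    - \sum_(m < M) (taylor_part m (u j) x - taylor_part m phi x)).
  by rewrite sumrB; ring.
rewrite [leRHS]splitr.
apply: (@le_trans _ _ (Bp / 2 ^+ M + (B / 2 ^+ M + S / 2 ^+ j))); last first.
  rewrite addrA; apply: lerD => //; apply: le_trans hM.
  by rewrite mulrDl addrC.
apply: le_trans (le_normcD _ _) _; apply: lerD; first exact: (HBp M x xr).2.
apply: le_trans (le_normcD _ _) _; rewrite !normcN; apply: lerD; first exact: HB.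
apply: le_trans (normc_sum _ _ _) _; rewrite mulr_suml; apply: ler_sum => m _.
rewrite /taylor_part -mulrBl normcM normcV normc_natr.
rewrite ler_pdivrMr ?ltr0n ?fact_gt0//.
apply: le_trans (uclose j m x (ltn_ord m)) _.
apply: (@le_trans _ _ ((n%:R * rho) ^+ m * 2 / 2 ^+ j)).
  by rewrite -mulrA ler_wpM2r ?divr_ge0 ?exprn_ge0// lerXn2r ?nnegrE.
by rewrite ler_peMr ?ler1n ?fact_gt0// divr_ge0 ?exprn_ge0// mulr_ge0// exprn_ge0.
Qed.

End Minimisation.

(** * Every eigenfunction belongs to the invariant space *)

Section Ladder.
Hypothesis lambda_neq0 : lambda != 0.
Hypothesis V_spherical : V (@spherical_function R n lambda).

Let V_sum (F : 'I_n -> E -> R[i]) : (forall i, V (F i)) -> V (fun x => \sum_i F i x).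
Proof.
move=> VF.
have H (r : seq 'I_n) : V (fun x => \sum_(i <- r) F i x).
  elim: r => [|i r IH].
    have -> : (fun x => \sum_(i <- [::]) F i x) = fun x => 0 * @spherical_function R n lambda x.
      by apply/funext => x; rewrite big_nil mul0r.
    exact: V_scale.
  have -> : (fun x => \sum_(j <- i :: r) F j x) = fun x => F i x + \sum_(j <- r) F j x.
    by apply/funext => x; rewrite big_cons.
  exact: V_add.
exact: H.
Qed.

(** The [spherical_coef] of dimension [n + 2 k]: a harmonic polynomial of degree [k]
    times the corresponding series in [|x|^2] is an eigenfunction. *)
Definition ladder_coef k j : R[i] :=
  \prod_(i < j) (- lambda ^+ 2 / ((2 * i + 2) * (2 * i + n + 2 * k))%:R).

Let ladder_denom_neq0 k i : (((2 * i + 2) * (2 * i + n + 2 * k))%:R : R[i]) != 0.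
Proof. by rewrite pnatr_eq0 -lt0n muln_gt0 !addn_gt0 n_gt0 !orbT. Qed.

Let ladder_coefS k j : ladder_coef k j.+1 =
  ladder_coef k j * (- lambda ^+ 2 / ((2 * j + 2) * (2 * j + n + 2 * k))%:R).
Proof. by rewrite /ladder_coef big_ord_recr. Qed.

Let ladder_coef_shift k j :
  ladder_coef k j.+1 * j.+1%:R = ladder_coef k 1 * ladder_coef k.+1 j.
Proof.
elim: j => [|j IH]; first by rewrite mulr1 /ladder_coef big_ord0 mulr1.
rewrite (ladder_coefS k j.+1) (ladder_coefS k.+1 j) [RHS]mulrA -IH.
have d1 := ladder_denom_neq0 k j.+1; have d2 := ladder_denom_neq0 k.+1 j.
have -> : (((2 * j.+1 + 2) * (2 * j.+1 + n + 2 * k))%:R : R[i]) =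
    2 * (j.+2)%:R * (2 * j.+1 + n + 2 * k)%:R.
  by rewrite -!natrM; congr (_%:R); lia.
have -> : (((2 * j + 2) * (2 * j + n + 2 * k.+1))%:R : R[i]) =
    2 * (j.+1)%:R * (2 * j.+1 + n + 2 * k)%:R.
  by rewrite -!natrM; congr (_%:R); lia.
have n1 : (j.+1%:R : R[i]) != 0 by rewrite pnatr_eq0.
have n2 : (j.+2%:R : R[i]) != 0 by rewrite pnatr_eq0.
have n3 : ((2 * j.+1 + n + 2 * k)%:R : R[i]) != 0 by rewrite pnatr_eq0; lia.
move: (ladder_coef k j.+1) (j.+1%:R) (j.+2%:R) ((2 * j.+1 + n + 2 * k)%:R) n1 n2 n3.
by move=> L a b c a0 b0 c0; field; rewrite a0 b0 c0.
Qed.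

Let spherical_taylor_part j x :
  taylor_part (2 * j) (@spherical_function R n lambda) x =
    spherical_coef n lambda j * (sqnorm x ^+ j)%:C /\
  taylor_part (2 * j + 1) (@spherical_function R n lambda) x = 0.
Proof.
have phi_eigen := eigen_spherical_function lambda n_gt0.
have phi_smooth := eigen_smooth phi_eigen.
have phi_lap (t : seq 'I_n) : (size t + 2 < 2 * j + 2)%N ->
    \sum_i jet (@spherical_function R n lambda) 0 [:: i, i & t] =
    - lambda ^+ 2 * jet (@spherical_function R n lambda) 0 t.
  by move=> _; have [_ Lu] := eigen_partials t phi_eigen; exact: Lu.
have phi_radial m y z : (m < 2 * j + 2)%N -> sqnorm y = sqnorm z ->
    taylor_form m (jet (@spherical_function R n lambda) 0) y =
    taylor_form m (jet (@spherical_function R n lambda) 0) z.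
  move=> _ yz; apply: taylor_form_congr => // t.
  by apply: spherical_function_radial; rewrite !sqnormZ yz.
have [ev od] := radial_taylor_form n_gt0 (symmetric_jet_smooth 0 phi_smooth)
  phi_lap phi_radial j x.
rewrite /taylor_part ev ?od; try lia.
split; last by rewrite mul0r.
have -> : jet (@spherical_function R n lambda) 0 [::] = 1 by exact: spherical_function0.
by rewrite mul1r -[_ * _ * (_)%:C]mulrA [X in X / _]mulrC mulfK// pnatr_eq0 -lt0n fact_gt0.
Qed.

(** Let [P] be the lowest part of [f], of degree [k + 1], and [g_i] the function obtained
    for [partial i f], whose lowest part is [partial i P].  In
    [sum_i partial i (|x|^(2j+2) partial i P)] the harmonicity of [P] and the Euler
    identity leave [2 (j+1) (k+1) |x|^(2j) P], so [sum_i partial i g_i] has the desired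
    shape, and [ladder_coef_shift] identifies its coefficients. *)
Lemma ladder k f : eigen f -> (forall m x, (m < k)%N -> taylor_part m f x = 0) ->
  exists g, [/\ V g, forall m x, (m < k)%N -> taylor_part m g x = 0 &
    forall j x, taylor_part (k + 2 * j) g x = ladder_coef k j * sqmul j (taylor_part k f) x /\
      taylor_part (k + 2 * j + 1) g x = 0].
Proof.
elim: k f => [|k IH] f ef f0.
  exists (fun x => f 0 * @spherical_function R n lambda x).
  have sphi := V_smooth V_spherical.
  split=> [|//|j x]; first exact: V_scale.
  rewrite !add0n !(taylor_partZ _ _ _ sphi).
  have [-> ->] := spherical_taylor_part j x.
  rewrite mulr0; split=> //; rewrite /sqmul taylor_part0 /ladder_coef /spherical_coef.
  under [in RHS]eq_bigr do rewrite muln0 addn0.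
  by rewrite mulrC -mulrA.
have [sf _] := ef.
pose P := taylor_part k.+1 f.
have sP : smooth P := smooth_taylor_part k.+1 f.
have ex i : exists g, [/\ V g, forall m x, (m < k)%N -> taylor_part m g x = 0 &
    forall j x, taylor_part (k + 2 * j) g x = ladder_coef k j * sqmul j (partial i P) x /\
      taylor_part (k + 2 * j + 1) g x = 0].
  have [|g [Vg g0 gE]] := IH (partial i f) (eigen_partial i ef).
    move=> m x mk; rewrite -(partial_taylor_part m i sf).
    have -> : taylor_part m.+1 f = fun=> 0 by apply/funext => y; exact: f0.
    by rewrite (@smooth_cst R n 0).2.
  exists g; split=> // j x; have [-> ->] := gE j x.
  by rewrite (partial_taylor_part k i sf).
have [g hg] := choice ex.
have Vg i : V (g i) by have [] := hg i.
have sg i := V_smooth (Vg i).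
have lapP x : \sum_i partial i (partial i P) x = 0.
  rewrite /P; case: (k) f0 => [|k'] f0.
    apply: big1 => i _; rewrite (partial_taylor_part 0 i sf).
    have -> : taylor_part 0 (partial i f) = fun=> partial i f 0.
      by apply/funext => y; rewrite taylor_part0.
    by rewrite (@smooth_cst R n _).2.
  by rewrite (taylor_part_laplace k' x ef) f0 ?mulr0.
pose G x := \sum_i partial i (g i) x.
have VG : V G by apply: V_sum => i; exact: V_partial.
have tG m x : taylor_part m G x = \sum_i partial i (taylor_part m.+1 (g i)) x.
  have sdg i (_ : true) : smooth (partial i (g i)) by exact: (smooth_partial i (sg i)).
  rewrite /G (@taylor_part_sum R n m _ (index_enum _) xpredT (fun i => partial i (g i)) x sdg).
  by apply: eq_bigr => i _; rewrite (partial_taylor_part m i (sg i)).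
have partial_zero i (u : E -> R[i]) x : (forall y, u y = 0) -> partial i u x = 0.
  move=> u0; have -> : u = fun=> 0 by apply/funext.
  by rewrite (@smooth_cst R n 0).2.
(* the factor by which [G] exceeds the function sought; nonzero as [lambda] is *)
pose a := 2 * k.+1%:R * ladder_coef k 1.
have a0 : a != 0.
  rewrite /a !mulf_neq0 ?pnatr_eq0// /ladder_coef big_ord1 mulf_neq0 ?invr_eq0//.
  by rewrite oppr_eq0 expf_neq0.
have sG := V_smooth VG.
exists (fun x => a^-1 * G x); split=> [|m x mk|j x]; first exact: V_scale.
  rewrite taylor_partZ// tG; have [mk1|mk1|mk1] := ltngtP m.+1 k.
  - rewrite big1 ?mulr0// => i _; apply: partial_zero => y.
    by have [_ g0 _] := hg i; exact: g0.
  - rewrite big1 ?mulr0// => i _; apply: partial_zero => y.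
    have -> : (m.+1 = k + 2 * 0 + 1)%N by lia.
    by have [_ _ gE] := hg i; exact: (gE 0%N y).2.
  - have Ei i : taylor_part m.+1 (g i) = partial i P.
      apply/funext => y; have [_ _ gE] := hg i; have := (gE 0%N y).1.
      by rewrite muln0 addn0 sqmul0 /ladder_coef big_ord0 mul1r -mk1.
    by under eq_bigr do rewrite Ei; rewrite lapP mulr0.
rewrite !(taylor_partZ _ _ _ sG) !tG; split; last first.
  rewrite big1 ?mulr0// => i _; apply: partial_zero => y.
  have -> : ((k.+1 + 2 * j + 1).+1 = k + 2 * j.+1 + 1)%N by lia.
  by have [_ _ gE] := hg i; exact: (gE j.+1 y).2.
have Ei i : taylor_part (k.+1 + 2 * j).+1 (g i) =
    fun y => ladder_coef k j.+1 * sqmul j.+1 (partial i P) y.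
  apply/funext => y; have [_ _ gE] := hg i; rewrite -(gE j.+1 y).1.
  by congr (taylor_part _ _ _); lia.
have sPi i := smooth_partial i sP.
transitivity (a^-1 * (ladder_coef k j.+1 *
   ((2 * j.+1)%:R * ((sqnorm x ^+ j)%:C * (k.+1%:R * P x)) +
    (sqnorm x ^+ j.+1)%:C * \sum_i partial i (partial i P) x))).
  congr (_ * _); rewrite -(taylor_part_euler k x sf) !mulr_sumr -big_split mulr_sumr.
  apply: eq_bigr => i _; rewrite Ei (partialZ i _ (smooth_sqmul j.+1 (sPi i))).
  rewrite (partial_sqmul j i (sPi i)) /sqmul /=; congr (_ * (_ * _ + _)).
  by rewrite mulrCA.
rewrite lapP mulr0 addr0 natrM.
have S := ladder_coef_shift k j.
transitivity (a^-1 * (2 * k.+1%:R * (ladder_coef k j.+1 * j.+1%:R)) * sqmul j P x).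
  by rewrite /sqmul; ring.
by rewrite S [2 * k.+1%:R * _]mulrA -/a mulKf.
Qed.

Let ladder_coef_small (s : R) : 0 <= s -> exists2 k0 : nat, (0 < k0)%N &
  forall k j, (k0 <= k)%N -> normc (ladder_coef k j) * s ^+ j <= 1 / 4 ^+ j.
Proof.
move=> s0; pose L := normc (- lambda ^+ 2).
have L0 : 0 <= L := normc_ge0 _.
have [k0 hk0] : exists k0 : nat, L * s <= k0%:R.
  by exists (Num.bound (L * s)); rewrite ltW// archi_boundP// mulr_ge0.
exists k0.+1 => // k j k0k; elim: j => [|j IH].
  by rewrite /ladder_coef big_ord0 normc1 mulr1 divr1.
rewrite ladder_coefS normcM (exprSr s j) mulrACA (exprS 4 j).
have -> : 1 / (4 * 4 ^+ j) = 1 / 4 ^+ j * (1 / 4) :> R by rewrite invfM !mul1r mulrC.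
have f0 : 0 <= normc (- lambda ^+ 2 / ((2 * j + 2) * (2 * j + n + 2 * k))%:R) := normc_ge0 _.
apply: (ler_pM _ _ IH); rewrite ?mulr_ge0 ?normc_ge0 ?exprn_ge0//.
rewrite normcM normcV normc_natr -/L; set D := (_ * _)%N.
have D0 : (0 < D)%N by rewrite /D muln_gt0 !addn_gt0 n_gt0 !orbT.
rewrite mulrAC ler_pdivrMr ?ltr0n// mulrAC mul1r ler_pdivlMr//.
apply: (@le_trans _ _ (k0%:R * 4)); first by rewrite ler_wpM2r.
by rewrite -natrM ler_nat /D; nia.
Qed.

(** Subtracting [g] cancels [P_k F], of modulus [p], at [x], and adds at most [p / 2 ^ d]
    to the part of degree [k + d]; these additions sum up to [p] at most. *)
Let ladder_step k0 (r : R) :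
  (forall k j, (k0 <= k)%N -> normc (ladder_coef k j) * (n%:R * r ^+ 2) ^+ j <= 1 / 4 ^+ j) ->
  forall k F, (k0 <= k)%N -> eigen F -> (forall m x, (m < k)%N -> taylor_part m F x = 0) ->
  exists g, [/\ V g, forall m x, (m < k.+1)%N -> taylor_part m (fun x => F x + (-1) * g x) x = 0 &
    forall M x, `|x| <= r -> \sum_(m < M) normc (taylor_part m (fun x => F x + (-1) * g x) x) <=
      \sum_(m < M) normc (taylor_part m F x)].
Proof.
move=> small k F k0k eF F0; have [g [Vg g0 gE]] := ladder eF F0.
have sF := eigen_smooth eF; have sg := V_smooth Vg.
have tE m x : taylor_part m (fun x => F x + (-1) * g x) x = taylor_part m F x - taylor_part m g x.
  by rewrite (taylor_partD m x sF (smoothZ _ sg)) (taylor_partZ _ _ _ sg) mulN1r.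
have gk x : taylor_part k g x = taylor_part k F x.
  by have := (gE 0%N x).1; rewrite muln0 addn0 sqmul0 /ladder_coef big_ord0 mul1r.
have van m x : (m < k.+1)%N -> taylor_part m F x - taylor_part m g x = 0.
  rewrite ltnS leq_eqVlt => /orP[/eqP->|mk]; first by rewrite gk subrr.
  by rewrite F0// g0// subrr.
exists g; split=> // [m x mk|M x xr]; first by rewrite tE van.
under eq_bigr do rewrite tE.
have sx := sqnorm_le xr.
set p := normc (taylor_part k F x); have p0 : 0 <= p := normc_ge0 _.
have decay d : normc (taylor_part (k + d) g x) <= p / 2 ^+ d.
  have [od|ed] := boolP (odd d).
    have -> : (k + d = k + 2 * d./2 + 1)%N by rewrite -{1}(odd_double_half d) od; lia.
    by rewrite (gE d./2 x).2 normc0 divr_ge0// exprn_ge0.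
  have dE : (d = 2 * d./2)%N by rewrite -{1}(odd_double_half d) (negbTE ed); lia.
  rewrite dE (gE d./2 x).1 /sqmul normcM normcM normcR -/p mulrA mulrC.
  rewrite ler_wpM2l// ger0_norm ?exprn_ge0 ?sqnorm_ge0//.
  apply: (@le_trans _ _ (normc (ladder_coef k d./2) * (n%:R * r ^+ 2) ^+ d./2)).
    rewrite ler_wpM2l ?normc_ge0//; apply: lerXn2r; rewrite ?nnegrE ?sqnorm_ge0//.
    by rewrite (le_trans _ sx)// sqnorm_ge0.
  apply: le_trans (small k _ k0k) _; rewrite mul1r exprM.
  by have -> : (2 : R) ^+ 2 = 4 by rewrite -natrX.
have [Mk|kM] := leqP M k.
  apply: ler_sum => m _; rewrite van ?normc0 ?normc_ge0//.
  by rewrite ltnS ltnW// (leq_trans (ltn_ord m)).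
rewrite -(subnKC kM); move: (M - k.+1)%N => d.
suff : \sum_(m < k.+1 + d) normc (taylor_part m F x - taylor_part m g x) <=
   \sum_(m < k.+1 + d) normc (taylor_part m F x) - p / 2 ^+ d.
  move/le_trans; apply; rewrite gerBl divr_ge0// exprn_ge0.
elim: d => [|d IH].
  rewrite addn0 big1 => [|m _]; last by rewrite van ?normc0.
  rewrite expr0 divr1 subr_ge0 big_ord_recr/= lerDr.
  by apply: sumr_ge0 => m _; exact: normc_ge0.
have := decay d.+1; rewrite addnS [(k + d).+1](_ : _ = k.+1 + d)%N ?addnS//.
move: (k.+1 + d)%N IH => N IH h'; rewrite !big_ord_recr/=.
have := le_normcD (taylor_part N F x) (- taylor_part N g x); rewrite normcN => h.
have e : p / 2 ^+ d = p / 2 ^+ d.+1 + p / 2 ^+ d.+1.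
  by rewrite exprS; field; rewrite expf_neq0.
by rewrite e in IH; move: h h' IH; lra.
Qed.

Let iterate_ladder k f : eigen f -> exists2 h, V h &
  forall m x, (m < k)%N -> taylor_part m (fun x => f x + (-1) * h x) x = 0.
Proof.
move=> ef; elim: k => [|k [h Vh hE]].
  by exists (fun x => 0 * @spherical_function R n lambda x) => //; exact: V_scale.
have eF := eigenD ef (eigenZ (-1) (V_eigen Vh)).
have [g [Vg g0 gE]] := ladder eF hE.
have sF := eigen_smooth eF; have sg := V_smooth Vg.
exists (fun x => h x + g x) => [|m x mk]; first exact: V_add.
rewrite (_ : (fun x => _) = fun x => (f x + (-1) * h x) + (-1) * g x); last first.
  by apply/funext => y; ring.
rewrite (taylor_partD m x sF (smoothZ _ sg)) (taylor_partZ _ _ _ sg) mulN1r.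
move: mk; rewrite ltnS leq_eqVlt => /orP[/eqP->|mk]; last by rewrite hE// g0// subrr.
have := (gE 0%N x).1; rewrite muln0 addn0 sqmul0 /ladder_coef big_ord0 mul1r => ->.
by rewrite subrr.
Qed.

(** Reduce [f] first to vanish to order [k0], where the coefficients become small, and
    then [N] orders further, keeping the sum of the moduli of the Taylor parts
    bounded by [2 B] on the ball of radius [2 rho]. *)
Lemma eigen_in_V f : eigen f -> V f.
Proof.
move=> ef; apply: V_closed => // rho e rho0 e0.
pose r := 2 * rho; have r0 : 0 < r by rewrite mulr_gt0.
have [|k0 k00 small] := @ladder_coef_small (n%:R * r ^+ 2).
  by rewrite mulr_ge0// exprn_ge0// ltW.
have [h0 Vh0 h0E] := iterate_ladder k0 ef.
have [B B0 HB] := eigen_taylor (eigenD ef (eigenZ (-1) (V_eigen Vh0))) r0.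
have sum_bound M x : `|x| <= r ->
    \sum_(m < M) normc (taylor_part m (fun x => f x + (-1) * h0 x) x) <= 2 * B.
  move=> xr; apply: (@le_trans _ _ (2 * B - 2 * B / 2 ^+ M)); last first.
    by rewrite gerBl divr_ge0 ?exprn_ge0 ?mulr_ge0 ?(ltW B0).
  elim: M => [|M IH]; first by rewrite big_ord0 expr0 divr1 subrr.
  rewrite big_ord_recr/=; have [h _] := HB M x xr.
  have E : 2 * B / 2 ^+ M = B / 2 ^+ M + 2 * B / 2 ^+ M.+1.
    by rewrite exprS; field; rewrite expf_neq0.
  by rewrite E in IH; move: IH h; lra.
have iter N : exists h, [/\ V h,
    forall m x, (m < k0 + N)%N -> taylor_part m (fun x => f x + (-1) * h x) x = 0 &
    forall M x, `|x| <= r ->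
      \sum_(m < M) normc (taylor_part m (fun x => f x + (-1) * h x) x) <= 2 * B].
  elim: N => [|N [h [Vh hE hB]]]; first by exists h0; split=> // m x; rewrite addn0; exact: h0E.
  have eF := eigenD ef (eigenZ (-1) (V_eigen Vh)).
  have [g [Vg gE gB]] := ladder_step small (leq_addr N k0) eF hE.
  exists (fun x => h x + g x).
  rewrite (_ : (fun x => f x + (-1) * (h x + g x)) =
    fun x => (f x + (-1) * h x) + (-1) * g x); last first.
    by apply/funext => y; ring.
  split=> [|m x|M x xr]; first exact: V_add.
    by rewrite addnS; exact: gE.
  by apply: le_trans (gB M x xr) (hB M x xr).
have [N hN] : exists N : nat, 2 * B / 2 ^+ N <= e.
  by apply: exists_pow2 => //; rewrite mulr_ge0// ltW.
have [h [Vh hE hB]] := iter N; exists h => // x xr.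
have eF := eigenD ef (eigenZ (-1) (V_eigen Vh)).
rewrite -mulN1r; set F := fun x => f x + (-1) * h x in eF hE hB *.
apply: le_trans hN; rewrite -/(F x).
have partial_sum M : normc (\sum_(m < M) taylor_part m F x) <= 2 * B / 2 ^+ N.
  apply: le_trans (normc_sum _ _ _) _.
  have x2 : `|2 *: x| <= r by rewrite normrZ ger0_norm// ler_pM2l.
  rewrite ler_pdivlMr ?exprn_gt0//; apply: le_trans (hB M _ x2).
  rewrite mulr_suml; apply: ler_sum => m _.
  rewrite taylor_part_scale [normc (_%:C * _)]normcM normcR.
  have [mk|km] := ltnP m (k0 + N); first by rewrite hE// normc0 mul0r mulr0.
  rewrite ger0_norm ?exprn_ge0// mulrC ler_wpM2r ?normc_ge0//.
  by rewrite ler_weXn2l ?ler1n// (leq_trans _ km)// leq_addl.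
have [Bx Bx0 HBx] := eigen_taylor eF rho0.
apply/ler_addgt0Pr => d d0; have [M hM] := exists_pow2 (ltW Bx0) d0.
have -> : F x = \sum_(m < M) taylor_part m F x + (F x - \sum_(m < M) taylor_part m F x) by ring.
apply: le_trans (le_normcD _ _) _; apply: lerD; first exact: partial_sum.
by apply: le_trans hM; exact: (HBx M x xr).2.
Qed.

End Ladder.

Lemma invariant_eigenspace_full f0 x0 : lambda != 0 -> V f0 -> f0 x0 != 0 ->
  forall f, eigen f -> V f.
Proof.
move=> lambda0 Vf0 f0x f ef; apply: eigen_in_V => //.
apply: (@spherical_in_V_of (fun x => (f0 x0)^-1 * f0 (x + x0))).
  by apply: V_scale; exact: V_translate.
by rewrite add0r mulVf.
Qed.

End InvariantSpace.

(** * The topology of the eigenspace *)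

Section Eigenspace.
Variables (R : realType) (n : nat) (lambda : R[i]).
Local Notation E := 'cV[R]_n.
Local Notation eigen := (@eigenfunction R n lambda).
Local Notation eigenspace := (@laplace_eigenspace R n lambda).
Implicit Types (w : eigenspace) (f : E -> R[i]).

Lemma eigenfun_eigenfunction w : eigen (eigenfun w).
Proof.
split=> [|x]; first exact: (set_valP (set_val w)).
by rewrite partial.unlock; exact: (set_valP w x).
Qed.

Lemma eigenfunction_eigenfun f : eigen f -> exists w : eigenspace, eigenfun w = f.
Proof.
move=> [sf Lf].
pose u : smooth_space R n := exist _ f (mem_set (sf : [set f | smooth f] f)).
have eu : laplace_eigenspace lambda u.
  by move=> x; have := Lf x; rewrite partial.unlock.
by exists (exist _ u (mem_set eu)).
Qed.

Lemma eigenfun_inj : injective (@eigenfun R n lambda).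
Proof. by move=> w1 w2 e; apply: val_inj; apply: val_inj. Qed.

Lemma entourage_normc (A : set (R[i] * R[i])) : entourage A ->
  exists2 e : R, 0 < e & forall a b, normc (a - b) < e -> A (a, b).
Proof.
rewrite -entourage_from_ballE => -[e /= e0 eA].
have re : e = (normc e)%:C by rewrite -norm_normc gtr0_norm.
exists (normc e) => [|a b ab]; first by rewrite re ltcR in e0.
by apply: eA => /=; rewrite -ball_normE /ball_ /= norm_normc re ltcR.
Qed.

(** By [eigen_partials_small] all derivatives converge as well, uniformly on compact
    sets. *)
Lemma eigenspace_cvg (u : nat -> eigenspace) w :
  (forall (rho e : R), 0 < rho -> 0 < e -> exists N, forall j, (N <= j)%N ->
     forall x, `|x| <= rho -> normc (eigenfun w x - eigenfun (u j) x) <= e) ->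
  u @ \oo --> w.
Proof.
move=> uw; apply/initial_cvgP; apply/smooth_space_cvgP => s A cA P.
move=> /uniform_nbhs[D [entD DP]].
have [e e0 eD] := entourage_normc entD.
have [rho rho0 Arho] := pinfty_ex_gt0 (compact_bounded cA).
pose c := grad_cst n lambda ^+ size s *+ 2.
have [d d0 dc] : exists2 d : R, 0 < d & c * d < e.
  exists (e / (`|c| + 1)); first by rewrite divr_gt0// ltr_wpDl.
  rewrite mulrCA gtr_pMr// ltr_pdivrMr ?ltr_wpDl// mul1r.
  by rewrite (le_lt_trans (ler_norm _))// ltrDl.
have rs0 : 0 < rho + (size s)%:R by rewrite ltr_wpDr.
have [N hN] := uw _ _ rs0 d0.
exists N => // j /= Nj; apply: DP => x Ax /=; apply: eD.
have ew := eigenfun_eigenfunction w; have euj := eigenfun_eigenfunction (u j).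
have ediff := eigenD ew (eigenZ (-1) euj).
have small := @eigen_partials_small R n lambda _ s rho d ediff d0.
apply: le_lt_trans dc; rewrite /c mulrnAl.
have -> : pderivs s (eigenfun w) x - pderivs s (eigenfun (u j)) x =
   partials s (fun y => eigenfun w y + (-1) * eigenfun (u j) y) x.
  rewrite (partialsD s (eigen_smooth ew) (smoothZ _ (eigen_smooth euj))).
  by rewrite (partialsZ s _ (eigen_smooth euj)) !partialsE mulN1r.
apply: small => [y yr|]; last exact: Arho.
by rewrite mulN1r; exact: hN.
Qed.

Lemma closed_eigenspace (W : set eigenspace) f : closed W -> eigen f ->
  (forall rho e : R, 0 < rho -> 0 < e -> exists2 g, (@eigenfun R n lambda @` W) g &
     forall x, `|x| <= rho -> normc (f x - g x) <= e) ->
  (@eigenfun R n lambda @` W) f.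
Proof.
move=> cW ef app; have [w wf] := eigenfunction_eigenfun ef.
have ex (j : nat) : exists v : eigenspace, W v /\ forall x, `|x| <= j.+1%:R ->
    normc (f x - eigenfun v x) <= 1 / j.+1%:R.
  have [||_ [v Wv <-] h] := app j.+1%:R (1 / j.+1%:R); rewrite ?divr_gt0 ?ltr0n//.
  by exists v.
have [u hu] := choice ex.
exists w => //; apply: (closed_cvg _ cW _ w (@eigenspace_cvg u w _)).
  by near=> j; exact: (hu j).1.
move=> rho e rho0 e0.
exists (maxn (Num.bound rho) (Num.bound (1 / e))) => j; rewrite geq_max => /andP[h1 h2] x xr.
have jr : rho <= j.+1%:R.
  rewrite (le_trans (ltW (archi_boundP (ltW rho0))))// ler_nat; exact: leqW.
have je : 1 / j.+1%:R <= e.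
  rewrite ler_pdivrMr ?ltr0n// mulrC -ler_pdivrMr//.
  rewrite (le_trans (ltW (archi_boundP _)))// ?divr_ge0 ?(ltW e0)// ler_nat; exact: leqW.
by rewrite wf (le_trans ((hu j).2 x (le_trans xr jr))).
Unshelve. all: by end_near.
Qed.

End Eigenspace.

(** * Irreducibility *)

Lemma sqnorm_eq0 (R : realType) (n : nat) (x : 'cV[R]_n) : sqnorm x = 0 -> x = 0.
Proof.
move=> /eqP; rewrite /sqnorm psumr_eq0 => [/allP x0|i _]; last exact: sqr_ge0.
apply/matrixP => i j; rewrite ord1 mxE; apply/eqP.
by have := x0 i (mem_index_enum _); rewrite /= sqrf_eq0.
Qed.

Lemma irreducible_of_neq0 (R : realType) (n : nat) (K : set 'M[R]_n) (lambda : R[i]) :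
  (0 < n)%N -> closed_subgroup_of_On K -> transitive_on_spheres K ->
  lambda != 0 -> irreducible_eigenspace K lambda.
Proof.
move=> n_gt0 [K_orth _ K1 _ KV] K_trans lambda0 W cW [V0 VD VZ] Vinv.
have [[f0 [x0 [Vf0 f0x]]]|none] :=
  pselect (exists f x, (@eigenfun R n lambda @` W) f /\ f x != 0); last first.
  left; apply/seteqP; split=> [f Vf|_ ->]; last exact: V0.
  apply/funext => x; apply/eqP/negPn/negP => fx; apply: none.
  by exists f, x.
right; apply/seteqP; split=> // w _.
have [w' Ww' /eigenfun_inj <-//] : (@eigenfun R n lambda @` W) (eigenfun w).
apply: (invariant_eigenspace_full n_gt0 K_orth K1 _ _ VD VZ _ _ lambda0 Vf0 f0x);
  last exact: eigenfun_eigenfunction.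
(* the sphere of radius [0] is not covered by the hypothesis on [K] *)
- move=> x y xy; have [x0'|x_neq0] := eqVneq (sqnorm x) 0.
    exists 1%:M => //; rewrite mul1mx (sqnorm_eq0 x0').
    by rewrite xy in x0'; rewrite (sqnorm_eq0 x0').
  apply: (K_trans (Num.sqrt (sqnorm x))); first by rewrite sqrtr_gt0 lt_def x_neq0 sqnorm_ge0.
    by [].
  by rewrite xy.
- by move=> _ [v _ <-]; exact: eigenfun_eigenfunction.
(* [translate] acts through inverses, so [motion_inv (k, v)] yields the substitution
   [x |-> k x + v] *)
- move=> k v f Kk Vf; have := Vinv (motion_inv (k, v)) f (KV _ Kk) Vf.
  have ku : k \in unitmx := orthogonal_unit (K_orth _ Kk).
  congr (image _ _ _); apply/funext => x; rewrite /translate /motion /= invmxK.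
  by rewrite mulmxN opprK mulKVmx.
- by move=> f ef app; exact: closed_eigenspace.
Qed.

(** The constants are closed since evaluations are continuous, and proper since
    coordinate functions are harmonic. *)
Lemma reducible_of_eq0 (R : realType) (n : nat) (K : set 'M[R]_n) :
  (0 < n)%N -> ~ irreducible_eigenspace K (0 : R[i]).
Proof.
move=> n_gt0 irr; pose E := 'cV[R]_n.
have eigen_cst (a : R[i]) : eigenfunction 0 (fun _ : E => a).
  split=> [|x]; first exact: (@smooth_cst R n a).1.
  rewrite expr0n oppr0 mul0r big1// => i _.
  by rewrite (@smooth_cst R n a).2 (@smooth_cst R n 0).2.
pose W : set (@laplace_eigenspace R n 0) :=
  [set w | forall x, eigenfun w x = eigenfun w 0].
have imW f : (@eigenfun R n 0 @` W) f <-> exists a, f = fun=> a.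
  split=> [[w Ww <-]|[a ->]].
    by exists (eigenfun w 0); apply/funext => x; exact: Ww.
  by have [w wa] := eigenfunction_eigenfun (eigen_cst a); exists w => // x; rewrite wa.
have eval_cvg x (w : @laplace_eigenspace R n 0) :
    eigenfun v x @[v --> w] --> eigenfun w x.
  have : set_val v @[v --> w] --> set_val w by exact: initial_continuous.
  move=> /(smooth_space_cvgP _)/(_ [::] [set x] (@compact_set1 _ x)) cvg_w.
  have FF : Filter (set_val v @[v --> w]) by exact: (@fmap_filter _ _ _ _ (nbhs_filter w)).
  by have := cvg_w FF; rewrite uniform_set1.
have cW : closed W.
  move=> w clw x; apply/eqP; rewrite -subr_eq0; apply/eqP.
  apply: eq0_normc; apply/eqP; rewrite eq_le normc_ge0 andbT.
  apply/ler_addgt0Pr => e e0; rewrite add0r.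
  have e2 : 0 < (e / 2)%:C :> R[i] by rewrite ltcR divr_gt0.
  have near y : \forall v \near w, normc (eigenfun w y - eigenfun v y) < e / 2.
    have := (@cvgrPdist_lt _ _ _ _ (nbhs_filter w) _ _).1 (eval_cvg y w) _ e2.
    by apply: filterS => v /=; rewrite norm_normc ltcR.
  have [v [Wv [vx v0]]] := clw _ (filterI (near x) (near 0)).
  have -> : eigenfun w x - eigenfun w 0 =
      (eigenfun w x - eigenfun v x) - (eigenfun w 0 - eigenfun v 0).
    by rewrite (Wv x); ring.
  apply: le_trans (le_normcD _ _) _; rewrite normcN [leRHS]splitr.
  by rewrite lerD// ltW.
case: (irr W cW).
- split; first by apply/imW; exists 0.
    by move=> _ _ /imW[a ->] /imW[b ->]; apply/imW; exists (a + b).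
  by move=> c _ /imW[a ->]; apply/imW; exists (c * a).
- by move=> g _ _ /imW[a ->]; apply/imW; exists a.
- move=> W0; have : (@eigenfun R n 0 @` W) (fun=> 1) by apply/imW; exists 1.
  by rewrite W0 => /(congr1 (fun f => f 0)) /eqP; rewrite oner_eq0.
- pose i0 := Ordinal n_gt0; move=> WT.
  have ex : eigenfunction 0 (fun x : E => (x i0 0)%:C * 1).
    have s1 := (@smooth_cst R n 1).1.
    split=> [|x]; first exact: smooth_coordM.
    rewrite expr0n oppr0 mul0r big1// => i _.
    rewrite (partial_coordM i0 i s1) (@smooth_cst R n 1).2.
    rewrite (_ : (fun y : E => _) = fun=> (i0 == i)%:R); first by rewrite (@smooth_cst R n _).2.
    by apply/funext => y; rewrite mulr1 mulr0 addr0.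
  have [w wx] := eigenfunction_eigenfun ex.
  have : W w by rewrite WT.
  move=> /(_ (delta_mx i0 0)); rewrite wx !mxE !eqxx mul0r mul1r => /eqP.
  by rewrite oner_eq0.
Qed.

Unset Implicit Arguments.

Theorem theorem3p3 (R : realType) (n : nat) (n_gt1 : (1 < n)%N)
    (K : set 'M[R]_n) (K_closed : closed_subgroup_of_On K)
    (K_trans : transitive_on_spheres K) (lambda : R[i]) :
  irreducible_eigenspace K lambda <-> lambda <> 0.
Proof.
have n_gt0 := ltnW n_gt1; split=> [irr lambda0|/eqP lambda0].
  by rewrite lambda0 in irr; exact: reducible_of_eq0 irr.
exact: irreducible_of_neq0.
Qed.
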